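(* Let $M$ be a complete Riemannian manifold of dimension $n$ with metric $g$, let $\omega$ be a smooth positive function on $M$, and let $\beta>0$ be such that $d\mu_\beta=\omega^{-\beta}\,d\mathrm{vol}$ is a probability measure. Assume that $\beta\neq 2$ and that there exists $c>0$ such that $$\frac{\omega}{\beta-2}\,\mathrm{Ric}+\mathrm{Hess}(\omega)\ \geq\ c\,\mathrm{id}$$ everywhere on $M$ (in the sense of quadratic forms on the tangent spaces, $\mathrm{id}$ corresponding to $g$). Let $Lf=\omega\Delta f-(\beta-1)\langle d\omega,df\rangle$ be the symmetric diffusion operator associated with $\mu_\beta$, with spectral gap $\lambda_1(-L)$. If $n\geq 2$ and $\beta\geq n+1$, then $\lambda_1(-L)\geq c(\beta-1)$. If $n=1$ and $\beta>1$, then $\lambda_1(-L)\geq c(\beta-1)$.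
   Context: Here $\Delta$ is the Laplace-Beltrami operator (trace of the Hessian), $\mathrm{Ric}$ the Ricci tensor (zero when $n=1$), and $d\mathrm{vol}$ the Riemannian volume measure. The operator $L$ is defined on $\mathcal{C}^\infty_c(M)$ and is symmetric in $L^2(\mu_\beta)$. Standing assumptions: $L$ is essentially self-adjoint on $\mathcal{C}_c^\infty(M)$ in $L^2(\mu_\beta)$, its unique self-adjoint extension, still denoted $L$, has domain $\mathcal{D}(L)\subset L^2(\mu_\beta)$, and the $L^2(\mu_\beta)$-semigroup generated by $L$ is ergodic. The spectral gap is $$\lambda_1(-L)=\inf\left\{\frac{\int_M -f\,Lf\,d\mu_\beta}{\mathrm{Var}_{\mu_\beta}(f)}\ :\ f\in\mathcal{D}(L),\ \mathrm{Var}_{\mu_\beta}(f)\neq 0\right\},$$ where $\mathrm{Var}_{\mu_\beta}(f)=\int f^2d\mu_\beta-(\int f\,d\mu_\beta)^2$. *)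

(* Defs.v *)
From HB Require Import structures.
From mathcomp Require Import all_boot all_order all_algebra.
From mathcomp Require Import all_classical all_reals all_analysis.

Set Implicit Arguments.
Unset Strict Implicit.
Unset Printing Implicit Defensive.

Import Order.TTheory GRing.Theory Num.Theory.
Import numFieldNormedType.Exports.

Local Open Scope classical_set_scope.
Local Open Scope ring_scope.

Section Calculus.
Variables (R : realType) (n : nat).
Implicit Types (U : set 'rV[R]_n) (f h : 'rV[R]_n -> R) (y : 'rV[R]_n).

Definition partial (k : 'I_n) f y : R := 'D_(delta_mx ord0 k) f y.

(* Only meant for open U. *)
Fixpoint Ck (m : nat) U f : Prop :=
  (forall y, U y -> {for y, continuous f}) /\
  (if m is m'.+1 then
     forall k, (forall y, U y -> derivable f y (delta_mx ord0 k)) /\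
               Ck m' U (partial k f)
   else True).

Definition smooth_on U f : Prop := forall m, Ck m U f.

End Calculus.

(* The integral over R^n with respect to Lebesgue measure, as an iterated
   integral; by Tonelli's theorem this is the n-dimensional Lebesgue integral
   whenever f is Borel and nonnegative, the only case in which it is used. *)
Fixpoint lebesgue_int (R : realType) (n : nat) : ('rV[R]_n -> \bar R) -> \bar R :=
  match n with
  | 0 => fun f => f 0
  | m.+1 => fun f => (\int[@lebesgue_measure R]_t
      lebesgue_int (fun y : 'rV[R]_m => f (row_mx (const_mx t : 'rV_1) y)))%E
  end.

(* The Levi-Civita connection in one coordinate system, where the metric is
   given by the matrix field G. *)
Section LocalGeometry.
Variables (R : realType) (n : nat) (G : 'rV[R]_n -> 'M[R]_n).
Implicit Types (f h : 'rV[R]_n -> R) (y : 'rV[R]_n).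

Definition christoffel (k a b : 'I_n) y : R :=
  2^-1 * \sum_l invmx (G y) k l *
    (partial a (fun z => G z b l) y + partial b (fun z => G z a l) y
     - partial l (fun z => G z a b) y).

(* The component along d_l of
   R(d_a, d_b) d_k = nabla_a nabla_b d_k - nabla_b nabla_a d_k. *)
Definition riemann (l k a b : 'I_n) y : R :=
  partial a (christoffel l b k) y - partial b (christoffel l a k) y
  + \sum_m (christoffel l a m y * christoffel m b k y
            - christoffel l b m y * christoffel m a k y).

Definition local_ricci y : 'M[R]_n :=
  \matrix_(b, k) \sum_a riemann a k a b y.

Definition local_hess f y : 'M[R]_n :=
  \matrix_(a, b) (partial a (partial b f) y
                  - \sum_k christoffel k a b y * partial k f y).

Definition local_laplacian f y : R := \tr (invmx (G y) *m local_hess f y).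

Definition local_dprod f h y : R :=
  \sum_a \sum_b invmx (G y) a b * partial a f y * partial b h y.

End LocalGeometry.

Definition quad (R : realType) (n : nat) (B : 'M[R]_n) (v : 'rV[R]_n) : R :=
  (v *m B *m v^T) ord0 ord0.

(* A smooth structure of dimension n on M (without boundary). The chart phi_i
   is defined on chart_dom i only; chart i and chart_inv i take arbitrary values
   elsewhere. chart_at selects a chart around each point; the pointwise
   operators below are computed in that chart, the choice being irrelevant since
   they are tensorial. *)
Record smooth_atlas (R : realType) (n : nat) (M : topologicalType) := SmoothAtlas {
  chart_idx : Type;
  chart_dom : chart_idx -> set M;
  chart : chart_idx -> M -> 'rV[R]_n;
  chart_inv : chart_idx -> 'rV[R]_n -> M;
  chart_at : M -> chart_idx;
  atlas_hausdorff : hausdorff_space M;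
  atlas_second_countable : @second_countable M;
  chart_dom_open : forall i, open (chart_dom i);
  chart_cod_open : forall i, open (chart i @` chart_dom i);
  chartK : forall i x, chart_dom i x -> chart_inv i (chart i x) = x;
  chart_continuous : forall i x, chart_dom i x -> {for x, continuous (chart i)};
  chart_inv_continuous : forall i y, (chart i @` chart_dom i) y ->
    {for y, continuous (chart_inv i)};
  chart_atP : forall x, chart_dom (chart_at x) x;
  transition_smooth : forall i j (k : 'I_n),
    smooth_on (chart i @` (chart_dom i `&` chart_dom j))
      (fun y => chart j (chart_inv i y) ord0 k) }.

Definition chart_cod (R : realType) (n : nat) (M : topologicalType)
    (A : smooth_atlas R n M) (i : chart_idx A) : set 'rV[R]_n :=
  chart i @` chart_dom i.

(* A smooth positive definite symmetric (0,2)-tensor field, given by its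
   components in each chart. The library's jacobian acts on row vectors from the
   right. *)
Record riemannian_metric (R : realType) (n : nat) (M : topologicalType)
    (A : smooth_atlas R n M) := RiemannianMetric {
  metric : chart_idx A -> 'rV[R]_n -> 'M[R]_n;
  metric_smooth : forall i (a b : 'I_n),
    smooth_on (chart_cod i) (fun y => metric i y a b);
  metric_sym : forall i y, chart_cod i y -> (metric i y)^T = metric i y;
  metric_pos : forall i y v, chart_cod i y -> v != 0 -> 0 < quad (metric i y) v;
  metric_change : forall i j y,
    (chart i @` (chart_dom i `&` chart_dom j)) y ->
    let tau := fun z => chart j (chart_inv i z) in
    metric i y = jacobian tau y *m metric j (tau y) *m (jacobian tau y)^T }.

Section Manifold.
Variables (R : realType) (n : nat) (M : topologicalType) (A : smooth_atlas R n M).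

Definition smooth (f : M -> R) : Prop :=
  forall i : chart_idx A, smooth_on (chart_cod i) (f \o chart_inv i).

Definition Cc_infty (f : M -> R) : Prop :=
  smooth f /\ compact (closure [set x | f x != 0]).

Definition C1_curve (c : R -> M) : Prop :=
  continuous c /\
  forall (i : chart_idx A) (k : 'I_n) t, chart_dom i (c t) ->
    derivable (fun s => chart i (c s) ord0 k) t 1 /\
    {for t, continuous (derive1 (fun s => chart i (c s) ord0 k))}.

Definition velocity (i : chart_idx A) (c : R -> M) (t : R) : 'rV[R]_n :=
  \row_k derive1 (fun s => chart i (c s) ord0 k) t.

Variable g : riemannian_metric A.

Definition laplacian (f : M -> R) (x : M) : R :=
  let i := chart_at A x in
  local_laplacian (metric g i) (f \o chart_inv i) (chart i x).

Definition dprod (f h : M -> R) (x : M) : R :=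
  let i := chart_at A x in
  local_dprod (metric g i) (f \o chart_inv i) (h \o chart_inv i) (chart i x).

Definition hess (f : M -> R) (x : M) : 'M[R]_n :=
  let i := chart_at A x in
  local_hess (metric g i) (f \o chart_inv i) (chart i x).

Definition ricci (x : M) : 'M[R]_n :=
  let i := chart_at A x in local_ricci (metric g i) (chart i x).

Definition metric_at (x : M) : 'M[R]_n :=
  let i := chart_at A x in metric g i (chart i x).

Definition curve_length (c : R -> M) : \bar R :=
  (\int[@lebesgue_measure R]_(t in `[0%R, 1%R])
    (Num.sqrt (quad (metric_at (c t)) (velocity (chart_at A (c t)) c t)))%:E)%E.

(* Every piecewise C^1 curve from x to y can be reparametrized, with the same
   length, so as to stop at its break points and at its end points and to be
   constant outside [0, 1]; it is then C^1 on R. The infimum is thus the usual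
   Riemannian distance, and +oo if x and y are in different components. *)
Definition riem_dist (x y : M) : \bar R :=
  ereal_inf [set curve_length c | c in
    [set c | [/\ C1_curve c, c 0 = x & c 1 = y]]].

Definition riem_complete : Prop :=
  forall u : nat -> M,
    (forall e : R, 0 < e -> exists N, forall p q,
       (N <= p)%N -> (N <= q)%N -> (riem_dist (u p) (u q) < e%:E)%E) ->
    exists x, (fun p => riem_dist (u p) x) @ \oo --> 0%E.

End Manifold.

Definition borelType (M : ptopologicalType) := g_sigma_algebraType (@open M).
HB.instance Definition _ (M : ptopologicalType) := Measurable.on (borelType M).

Definition is_volume (R : realType) (n : nat) (M : ptopologicalType)
    (A : smooth_atlas R n M) (g : riemannian_metric A)
    (vol : {measure set (borelType M) -> \bar R}) : Prop :=
  forall (i : chart_idx A) (B : set (borelType M)),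
    measurable B -> B `<=` chart_dom i ->
    vol B = lebesgue_int (fun y =>
      (\1_(chart i @` B) y * Num.sqrt (\det (metric g i y)))%:E).

(* Unbounded operators of L^2(mu), represented by their graphs, as relations
   between square integrable functions (not classes modulo equality a.e.). *)
Section L2Operators.
Context d (T : measurableType d) (R : realType) (mu : {measure set T -> \bar R}).
Implicit Types (f h : T -> R) (A : (T -> R) -> (T -> R) -> Prop).

Definition L2 f : Prop := f \in Lfun mu 2%:E.

Definition L2norm f : \bar R := ('N[mu]_(2%:E) [EFin \o f])%E.

Definition L2cvg (F : nat -> T -> R) f : Prop :=
  (fun m => L2norm (F m \- f)) @ \oo --> 0%E.

Definition op_closure A f h : Prop :=
  [/\ L2 f, L2 h & exists F H : nat -> T -> R,
    [/\ forall m, A (F m) (H m), L2cvg F f & L2cvg H h]].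

Definition densely_defined A : Prop :=
  forall f, L2 f -> exists F : nat -> T -> R,
    (forall m, exists h, A (F m) h) /\ L2cvg F f.

Definition op_adjoint A f h : Prop :=
  [/\ L2 f, L2 h & forall u v, A u v ->
    \int[mu]_x (f x * v x) = \int[mu]_x (h x * u x)].

Definition self_adjoint A : Prop :=
  densely_defined A /\ forall f h, A f h <-> op_adjoint A f h.

(* The unique self-adjoint extension of A is then op_closure A. *)
Definition essentially_self_adjoint A : Prop := self_adjoint (op_closure A).

(* (P t)_{t >= 0} is a strongly continuous semigroup of bounded operators on
   L^2(mu), with generator A. *)
Record semigroup_generated_by A (P : R -> (T -> R) -> (T -> R)) : Prop := {
  semigroup_L2 : forall t f, 0 <= t -> L2 f -> L2 (P t f);
  semigroup_linear : forall t a f h, 0 <= t -> L2 f -> L2 h ->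
    P t (fun x => a * f x + h x) = (fun x => a * P t f x + P t h x) %[ae mu];
  semigroup_bounded : forall t, 0 <= t -> exists C : R, forall f, L2 f ->
    (L2norm (P t f) <= C%:E * L2norm f)%E;
  semigroup0 : forall f, L2 f -> P 0 f = f %[ae mu];
  semigroupD : forall s t f, 0 <= s -> 0 <= t -> L2 f ->
    P (s + t) f = P s (P t f) %[ae mu];
  semigroup_continuous : forall f, L2 f ->
    (fun t => L2norm (P t f \- f)) @ 0^'+ --> 0%E;
  semigroup_generator : forall f h, A f h <->
    [/\ L2 f, L2 h &
      (fun t => L2norm (fun x => t^-1 * (P t f x - f x) - h x)) @ 0^'+ --> 0%E] }.

Definition ergodic (P : R -> (T -> R) -> (T -> R)) : Prop :=
  forall f, L2 f -> (forall t, 0 <= t -> P t f = f %[ae mu]) ->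
    exists a : R, f = cst a %[ae mu].

Definition Var f : R := \int[mu]_x (f x ^+ 2) - (\int[mu]_x f x) ^+ 2.

(* lambda_1(-A) *)
Definition spectral_gap A : \bar R :=
  ereal_inf [set e | exists f h, [/\ A f h, Var f != 0 &
    e = ((\int[mu]_x (- f x * h x)) / Var f)%:E]].

End L2Operators.

Section WeightedOperator.
Variables (R : realType) (n : nat) (M : topologicalType) (A : smooth_atlas R n M).
Variables (g : riemannian_metric A) (omega : M -> R) (beta : R).

Definition diffusion (f : M -> R) (x : M) : R :=
  omega x * laplacian g f x - (beta - 1) * dprod g omega f x.

Definition diffusion_op (f h : M -> R) : Prop := Cc_infty A f /\ h = diffusion f.

Definition curvature_bound (c : R) : Prop :=
  forall (x : M) (v : 'rV[R]_n),
    c * quad (metric_at g x) v <=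
    quad ((omega x / (beta - 2)) *: ricci g x + hess g omega x) v.

End WeightedOperator.

(* Main.v *)
(* For the divergence [Theta q p = div (q grad p)] one has, pointwise,
     omega^(-beta) (L f)^2 - c (beta - 1) omega^(1-beta) |df|^2
       >= - K/2 Theta(omega^(2-beta), |df|^2) + K Theta(omega^(2-beta) Delta f, f)
          - (beta - 1) Theta(omega^(1-beta) <d omega, df>, f),  K = (beta-1)/(beta-2);
   by Bochner's formula the difference of the two sides is the curvature term plus
   a combination of |Hess f|^2 and (Delta f)^2 whose sign is given by beta >= n + 1
   (by beta > 1 when n = 1). Divergences of compactly supported fields have integral
   zero, hence the integrated inequality int (L f)^2 >= c (beta - 1) int - f L f on
   test functions. It extends to the domain of the closure, and the spectral gap
   follows because L is self-adjoint and, by ergodicity, its kernel consists of the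
   constants: Cauchy-Schwarz bounds the norm of the projection of f on the closure of
   the range of L. *)
From HB Require Import structures.
Require Import Defs.
From mathcomp Require Import perm.
From mathcomp Require Import all_boot all_order all_algebra.
From mathcomp Require Import all_classical all_reals all_analysis.
From mathcomp Require Import measurable_realfun ring lra.

Set Implicit Arguments.
Unset Strict Implicit.
Unset Printing Implicit Defensive.

Import Order.TTheory GRing.Theory Num.Theory.
Import numFieldNormedType.Exports.

Local Open Scope classical_set_scope.
Local Open Scope ring_scope.


(** * Positive definite matrices *)

Section PositiveDefinite.
Variable R : realType.

(** The weights are forced by cancellations. Differentiating [omega^(2-beta)] brings out [2 - beta],
    which absorbs the denominator of [K]. The terms [Hess f (grad omega, grad f)] of the first and
    third divergences then cancel, so do the terms [<d Delta f, df>] of the first two, and what is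
    left completes the square of [L f]. Dividing by [beta - 2] is harmless: it is positive when
    [n >= 2], and when [n = 1] the numerator contains the same factor. No spectral theorem is
    involved: if [r] is a limit of vectors [w = L u], Cauchy-Schwarz for the form [- <L u, v>]
    bounds [<r, w>^2] by [<L r, r> <L u, u>], and the integrated inequality bounds [- <L u, u>] by a
    multiple of [|w|^2]. Ergodicity speaks of the semigroup, so [L k = 0] has to give [P t k = k]
    first. The semigroup comes with a bound for each [t] separately, whence the uniform boundedness
    principle. Elements of L^2 are functions, so all Hilbert space arguments run modulo vectors of
    norm zero. Volume is given by iterated integrals, which have to be realized by a measure on
    [R^n] before integrating by parts. *)

Definition posdef n (G : 'M[R]_n) : Prop :=
  G^T = G /\ forall v, v != 0 -> 0 < quad G v.

(** Gaussian elimination by induction on the size: removing the pivot [a] leaves the Schur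
    complement [C - b^T b / a], which is again positive definite. This congruence plays the part of
    a diagonalization without any eigenvalues. *)
Lemma posdef_LDL n (G : 'M[R]_n) : posdef G ->
  exists (W : 'M[R]_n) (d : 'rV[R]_n),
    [/\ \det W = 1, forall i, 0 < d 0 i & G = W^T *m diag_mx d *m W].
Proof.
elim: n G => [|n IHn] G [Gsym Gpos].
  exists 1%:M, 0; split; [by rewrite det1|by case|].
  by apply/matrixP => -[].
rewrite -[n.+1]/(1 + n)%N in G Gsym Gpos *.
pose a : R := G 0 0; pose b : 'rV[R]_n := ursubmx G.
pose C : 'M[R]_n := drsubmx G.
have ulG : ulsubmx G = a%:M.
  by apply/matrixP => i j; rewrite !ord1 !mxE eqxx mulr1n; congr (G _ _); apply/val_inj.
have dlG : dlsubmx G = b^T by rewrite /b trmx_ursub Gsym.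
have GE : G = block_mx a%:M b b^T C by rewrite -ulG -dlG submxK.
have Csym : C^T = C by rewrite /C trmx_drsub Gsym.
have quadG (s : R) (v : 'rV_n) : quad G (row_mx s%:M v) =
    s * a * s + 2 * s * (v *m b^T) 0 0 + quad C v.
  rewrite /quad GE mul_row_block tr_row_mx mul_row_col tr_scalar_mx.
  rewrite !mulmxDl !mul_scalar_mx !mul_mx_scalar -!scalemxAl.
  have -> : b *m v^T = (v *m b^T)^T by rewrite trmx_mul trmxK.
  rewrite !mxE /=; ring.
have a_gt0 : 0 < a.
  have : 0 < quad G (row_mx 1%:M 0).
    apply: Gpos; apply/eqP => /matrixP/(_ 0 (lshift _ 0)).
    by rewrite row_mxEl !mxE eqxx => /eqP; rewrite oner_eq0.
  by rewrite quadG /quad !mul0mx !mxE; lra.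
have a_neq0 : a != 0 by rewrite gt_eqF.
pose S := C - a^-1 *: (b^T *m b).
have [|W' [d' [W'1 d'0 SE]]] := IHn S.
  split; first by rewrite /S linearB /= linearZ /= trmx_mul trmxK Csym.
  move=> v v0.
  (* This first coordinate minimizes the quadratic polynomial of [quadG]; the minimum is the Schur
     form at [v]. *)
  have : 0 < quad G (row_mx (- (a^-1 * (v *m b^T) 0 0))%:M v).
    apply: Gpos; apply: contra_neq v0 => /(congr1 rsubmx).
    by rewrite row_mxKr => ->; apply/matrixP => i j; rewrite !mxE.
  rewrite quadG; suff -> : quad S v = quad C v - a^-1 * (v *m b^T) 0 0 ^+ 2.
    set q := (v *m b^T) 0 0; move/lt_le_trans; apply.
    by rewrite le_eqVlt; apply/orP; left; apply/eqP; field.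
  rewrite /quad /S mulmxBr mulmxBl -scalemxAr -scalemxAl mulmxA -(mulmxA (v *m _)).
  have -> : b *m v^T = (v *m b^T)^T by rewrite trmx_mul trmxK.
  rewrite [in LHS]mxE; congr (_ + _); rewrite mxE [in LHS]mxE.
  by congr (- (_ * _)); rewrite mxE big_ord1 [X in _ * X]mxE expr2.
exists (block_mx 1%:M (a^-1 *: b) 0 W'), (row_mx a%:M d'); split.
- by rewrite det_ublock det1 W'1 mulr1.
- move=> i; rewrite mxE; case: splitP => j _; last exact: d'0.
  by rewrite ord1 mxE.
- rewrite diag_mx_row (_ : diag_mx a%:M = a%:M); last first.
    by apply/matrixP => i j; rewrite !ord1 !mxE eqxx.
  rewrite tr_block_mx trmx0 trmx1 !mulmx_block !(mulmx0, mul0mx, addr0, add0r).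
  rewrite !(mul1mx, mulmx1) !mul_mx_scalar !mul_scalar_mx.
  rewrite [(a^-1 *: b)^T]linearZ /= !scalerA divff // !scale1r.
  by rewrite -SE /S -scalemxAr addrC subrK.
Qed.

Lemma posdef_det n (G : 'M[R]_n) : posdef G -> 0 < \det G.
Proof.
move=> /posdef_LDL[W [d [W1 d0 ->]]].
rewrite !det_mulmx det_tr W1 mul1r mulr1 det_diag.
by apply: prodr_gt0 => i _.
Qed.

Lemma posdef_unit n (G : 'M[R]_n) : posdef G -> G \in unitmx.
Proof. by move=> /posdef_det; rewrite unitmxE unitfE => /lt0r_neq0. Qed.

Lemma posdef_inv n (G : 'M[R]_n) : posdef G -> posdef (invmx G).
Proof.
move=> Gp; have Gu := posdef_unit Gp; case: Gp => Gsym Gpos.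
have Hsym : (invmx G)^T = invmx G by rewrite trmx_inv Gsym.
split=> // v v0.
have /Gpos : v *m invmx G != 0.
  by apply: contra_neq v0 => /(congr1 (mulmx^~ G)); rewrite mulmxKV // mul0mx.
by rewrite /quad mulmxKV // trmx_mul Hsym mulmxA.
Qed.

(** Writing [H = W^T D W] and cycling the trace gives the sum of [d_i d_j k_ij^2] for the symmetric
    matrix [k = W h W^T]. For [H] the inverse metric and [h] a Hessian this is the squared norm of
    the Hessian. *)
Lemma posdef_trace_sqr n (H h : 'M[R]_n) : posdef H -> h^T = h ->
  0 <= \tr (H *m h *m (H *m h)).
Proof.
move=> /posdef_LDL[W [d [_ d0 ->]]] hsym.
pose k := W *m h *m W^T.
have ksym : k^T = k by rewrite /k !trmx_mul trmxK hsym mulmxA.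
have -> : \tr (W^T *m diag_mx d *m W *m h *m (W^T *m diag_mx d *m W *m h)) =
    \tr (diag_mx d *m k *m (diag_mx d *m k)).
  by rewrite -!mulmxA mxtrace_mulC /k !mulmxA.
clearbody k; rewrite /mxtrace; apply: sumr_ge0 => i _; rewrite mxE; apply: sumr_ge0 => j _.
have kij : k j i = k i j by rewrite -[in LHS]ksym mxE.
rewrite !mul_diag_mx !mxE kij.
have -> : d 0 i * k i j * (d 0 j * k i j) = d 0 i * d 0 j * (k i j) ^+ 2 by ring.
by rewrite mulr_ge0 ?sqr_ge0 // mulr_ge0 // ltW.
Qed.

(* The trace-free part [H h - (tr (H h) / n) I] has nonnegative squared trace. *)
Lemma posdef_trace_CS n (G h : 'M[R]_n) : posdef G -> h^T = h ->
  \tr (invmx G *m h) ^+ 2 <= n%:R * \tr (invmx G *m h *m (invmx G *m h)).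
Proof.
case: n G h => [|n] G h Gp hsym.
  by rewrite {1}/mxtrace big_ord0 expr0n mul0r.
set t := \tr (invmx G *m h).
have Gu := posdef_unit Gp.
have [N [N0 NE NnE]] : exists N : R, [/\ 0 < N, N = n.+1%:R & forall x : R, x *+ n.+1 = x * N].
  by exists n.+1%:R; split; rewrite ?ltr0n // => x; rewrite mulr_natr.
rewrite -NE.
have N1 : N != 0 by rewrite gt_eqF.
have hsym' : (h - (t / N) *: G)^T = h - (t / N) *: G.
  by rewrite linearB /= linearZ /= hsym Gp.1.
have := posdef_trace_sqr (posdef_inv Gp) hsym'.
rewrite mulmxBr -scalemxAr mulVmx // scalemx1 mulmxBr !mulmxBl !linearB /=.
rewrite mul_mx_scalar !mul_scalar_mx scale_scalar_mx !mxtrace_scalar.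
rewrite !linearZ /= -/t -!mulNrn !NnE => h0.
rewrite -subr_ge0; apply: le_trans (mulr_ge0 (ltW N0) h0) _.
by rewrite le_eqVlt; apply/orP; left; apply/eqP; rewrite -![_ *: _]/(_ * _); field.
Qed.

End PositiveDefinite.

(** * Partial derivatives and functions of class C^k *)

Section DirectionalDerivative.
Variables (R : realType) (V : normedModType R).
Implicit Types (f : V -> R) (y v : V).

(** Restriction to a line reduces directional derivatives to one real variable, where the chain rule
    and the mean value theorem are at hand. *)
Lemma is_derive_lineP f y v t d :
  is_derive (y + t *: v) v f d <-> is_derive t 1 (fun s : R => f (y + s *: v)) d.
Proof.
have E : (fun h : R => h^-1 *: ((f \o shift (y + t *: v)) (h *: v) - f (y + t *: v))) =
    (fun h : R => h^-1 *: (((fun s : R => f (y + s *: v)) \o shift t) (h *: 1)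
       - f (y + t *: v))).
  apply/funext => h /=; congr (_ *: (f _ - _)).
  by rewrite scalerDl [h *: 1]mulr1 addrCA.
by split=> -[dv dE]; split; move: dv dE; rewrite /derivable /derive E.
Qed.

Lemma is_derive_comp_scalar (psi : R -> R) f y v d c :
  is_derive (f y) 1 psi c -> is_derive y v f d -> is_derive y v (psi \o f) (c * d).
Proof.
move=> Hpsi; have {1}-> : y = y + 0 *: v by rewrite scale0r addr0.
move=> /is_derive_lineP Hf.
have {1}-> : y = y + 0 *: v by rewrite scale0r addr0.
apply/is_derive_lineP.
have Hpsi' : is_derive ((fun s : R => f (y + s *: v)) 0) 1 psi c.
  by rewrite /= scale0r addr0.
exact: (is_derive1_comp (f := psi)).
Qed.

Lemma directional_MVT f y v (s : R) :
  (forall t : R, `|t| <= `|s| -> derivable f (y + t *: v) v) ->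
  exists2 t : R, `|t| <= `|s| & f (y + s *: v) - f y = s * 'D_v f (y + t *: v).
Proof.
move=> df.
have dl (t : R) : `|t| <= `|s| ->
    is_derive t 1 (fun s : R => f (y + s *: v)) ('D_v f (y + t *: v)).
  by move=> ts; apply/is_derive_lineP; apply: DeriveDef => //; exact: df.
have cl (t : R) : `|t| <= `|s| -> {for t, continuous (fun s : R => f (y + s *: v))}.
  move=> ts; apply/differentiable_continuous/derivable1_diffP.
  by have [] := dl t ts.
have [s0|s0|->] := ltgtP s 0; last first.
- by exists 0; rewrite // scale0r addr0 subrr mul0r.
- have [||c cin cE] := @MVT R (fun t : R => f (y + t *: v))
      (fun t => 'D_v f (y + t *: v)) 0 s s0.
  + move=> x; rewrite in_itv /= => /andP[x0 xs]; apply: dl.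
    by rewrite !ger0_norm // ltW.
  + apply: derivable_within_continuous => x; rewrite in_itv /= => /andP[x0 xs].
    have [] // := dl x _.
    by rewrite !ger0_norm // ltW.
  + exists c; first by move: cin; rewrite in_itv /= => /andP[x0 xs]; rewrite !ger0_norm // ltW.
    by move: cE; rewrite scale0r addr0 subr0 mulrC.
- have [||c cin cE] := @MVT R (fun t : R => f (y + t *: v))
      (fun t => 'D_v f (y + t *: v)) s 0 s0.
  + move=> x; rewrite in_itv /= => /andP[x0 xs]; apply: dl.
    by rewrite !ltr0_norm // lerN2 ltW.
  + apply: derivable_within_continuous => x; rewrite in_itv /= => /andP[x0 xs].
    have [] // := dl x _.
    by rewrite ler0_norm // ltr0_norm // lerN2.
  + exists c.
      by move: cin; rewrite in_itv /= => /andP[x0 xs]; rewrite !ltr0_norm // lerN2 ltW.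
    move: cE; rewrite scale0r addr0 sub0r => cE.
    by rewrite -opprB cE mulrN opprK mulrC.
Qed.

End DirectionalDerivative.

Section Ck_algebra.
Variables (R : realType) (n : nat).
Implicit Types (U : set 'rV[R]_n) (f h : 'rV[R]_n -> R) (y : 'rV[R]_n).

Lemma norm_delta (k : 'I_n) (s : R) : `|s *: delta_mx ord0 k : 'rV[R]_n| <= `|s|.
Proof.
rewrite [leLHS]/Num.norm /= mx_normrE; apply: bigmax_le => // -[i j] _ /=.
rewrite !mxE normrM; case: eqP => _; case: eqP => _ /=; rewrite ?normr0 ?mulr0 //.
by rewrite normr1 mulr1.
Qed.

Lemma Ck_continuous m U f y : Ck m U f -> U y -> {for y, continuous f}.
Proof. by case: m => [|m] [cf _]; exact: cf. Qed.

Lemma Ck_derivable m U f y k : Ck m.+1 U f -> U y -> derivable f y (delta_mx ord0 k).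
Proof. by move=> [_ /(_ k)[df _]]; exact: df. Qed.

Lemma Ck_partial m U f k : Ck m.+1 U f -> Ck m U (partial k f).
Proof. by move=> [_ /(_ k)[]]. Qed.

Lemma CkS m U f : Ck m.+1 U f -> Ck m U f.
Proof.
elim: m f => [|m IHm] f [cf df]; split=> // k; have [df1 df2] := df k.
by split=> //; apply: IHm.
Qed.

Lemma Ck_sub m U U' f : U `<=` U' -> Ck m U' f -> Ck m U f.
Proof.
move=> sub; elim: m f => [|m IHm] f [cf df]; split.
- by move=> y /sub; exact: cf.
- by [].
- by move=> y /sub; exact: cf.
- by move=> k; have [df1 df2] := df k; split; [move=> y /sub; exact: df1|exact: IHm].
Qed.

(** [Ck] is a pointwise condition on derivatives taken in the whole space, hence it glues. This is
    how functions extended by zero are seen to be C^1. *)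
Lemma Ck_local m U f : (forall y, U y -> exists2 U', U' y & Ck m U' f) -> Ck m U f.
Proof.
elim: m f => [|m IHm] f H.
  by split=> // y /H[U' U'y [cf _]]; exact: cf.
split; first by move=> y /H[U' U'y [cf _]]; exact: cf.
move=> k; split; first by move=> y /H[U' U'y [_ /(_ k)[df _]]]; exact: df.
by apply: IHm => y /H[U' U'y [_ /(_ k)[_ df]]]; exists U'.
Qed.

Lemma near_eq_partial f h k y : {near y, f =1 h} -> partial k f y = partial k h y.
Proof. exact: near_eq_derive. Qed.

Lemma open_near_eq U f h y : open U -> {in U, f =1 h} -> U y -> {near y, f =1 h}.
Proof.
move=> oU fh Uy; near=> z; apply: fh; rewrite inE; near: z.
exact: open_nbhs_nbhs.
Unshelve. all: by end_near. Qed.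

Lemma eq_Ck m U f h : open U -> {in U, f =1 h} -> Ck m U f -> Ck m U h.
Proof.
move=> oU.
have cont f' h' : {in U, f' =1 h'} -> (forall y, U y -> {for y, continuous f'}) ->
    forall y, U y -> {for y, continuous h'}.
  move=> fh cf y Uy; have nfh := open_near_eq oU fh Uy.
  rewrite /prop_for /continuous_at -(nbhs_singleton nfh).
  apply: cvg_trans (cf y Uy).
  exact: (near_eq_cvg nfh).
elim: m f h => [|m IHm] f h fh [cf df].
- by split=> //; exact: cont cf.
- split=> [|k]; [exact: cont cf|have [df1 df2] := df k; split].
    move=> y Uy; apply: near_eq_derivable (df1 y Uy); exact: open_near_eq Uy.
  apply: IHm df2 => y; rewrite inE => Uy.
  by apply: near_eq_partial; exact: open_near_eq Uy.
Qed.

Lemma partial_cst (a : R) k y : partial k (fun=> a) y = 0.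
Proof. exact: derive_cst. Qed.

Lemma partialD f h k y : derivable f y (delta_mx ord0 k) -> derivable h y (delta_mx ord0 k) ->
  partial k (fun z => f z + h z) y = partial k f y + partial k h y.
Proof. exact: deriveD. Qed.

Lemma partialB f h k y : derivable f y (delta_mx ord0 k) -> derivable h y (delta_mx ord0 k) ->
  partial k (fun z => f z - h z) y = partial k f y - partial k h y.
Proof. exact: deriveB. Qed.

Lemma partialM f h k y : derivable f y (delta_mx ord0 k) -> derivable h y (delta_mx ord0 k) ->
  partial k (fun z => f z * h z) y = f y * partial k h y + h y * partial k f y.
Proof. by move=> df dh; rewrite /partial deriveM. Qed.

Lemma partial_sum I (r : seq I) (P : pred I) (F : I -> 'rV[R]_n -> R) k y :
  (forall i, P i -> derivable (F i) y (delta_mx ord0 k)) ->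
  derivable (fun z => \sum_(i <- r | P i) F i z) y (delta_mx ord0 k) /\
  partial k (fun z => \sum_(i <- r | P i) F i z) y =
    \sum_(i <- r | P i) partial k (F i) y.
Proof.
move=> dF; elim: r => [|i r [IH1 IH2]].
  rewrite big_nil; under eq_fun do rewrite big_nil.
  by split; [exact: derivable_cst|exact: partial_cst].
rewrite big_cons -IH2; under eq_fun do rewrite big_cons.
case: ifPn => Pi //.
by split; [exact: derivableD (dF i Pi) IH1|rewrite partialD //; exact: dF].
Qed.

Lemma derivable_powR_comp f (s : R) k y : 0 < f y -> derivable f y (delta_mx ord0 k) ->
  derivable (fun z => f z `^ s) y (delta_mx ord0 k) /\
  partial k (fun z => f z `^ s) y = s * f y `^ (s - 1) * partial k f y.
Proof.
move=> f0 df.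
have := is_derive_comp_scalar (is_derive1_powR s f0) (DeriveDef df erefl).
by move=> [d1 d2]; split.
Qed.

Lemma Ck_cst m U (a : R) : Ck m U (fun=> a).
Proof.
elim: m a => [|m IHm] a; split=> //.
- by move=> y _; exact: cst_continuous.
- by move=> y _; exact: cst_continuous.
move=> k; split; first by move=> y _; exact: derivable_cst.
suff -> : partial k (fun=> a) = fun=> 0 by [].
by apply/funext => y; exact: partial_cst.
Qed.

Lemma CkD m U f h : open U -> Ck m U f -> Ck m U h -> Ck m U (fun z => f z + h z).
Proof.
move=> oU; elim: m f h => [|m IHm] f h Cf Ch; split=> //.
- by move=> y Uy; apply: continuousD; [exact: (Ck_continuous Cf Uy)|exact: (Ck_continuous Ch Uy)].
- by move=> y Uy; apply: continuousD; [exact: (Ck_continuous Cf Uy)|exact: (Ck_continuous Ch Uy)].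
move=> k; split.
  by move=> y Uy; exact: (derivableD (Ck_derivable Cf Uy) (Ck_derivable Ch Uy)).
apply: (@eq_Ck _ _ (fun z => partial k f z + partial k h z)) => //.
  move=> y; rewrite inE => Uy.
  by rewrite partialD //; [exact: (Ck_derivable Cf Uy)|exact: (Ck_derivable Ch Uy)].
by apply: IHm; exact: Ck_partial.
Qed.

Lemma CkM m U f h : open U -> Ck m U f -> Ck m U h -> Ck m U (fun z => f z * h z).
Proof.
move=> oU; elim: m f h => [|m IHm] f h Cf Ch; split=> //.
- by move=> y Uy; apply: continuousM; [exact: (Ck_continuous Cf Uy)|exact: (Ck_continuous Ch Uy)].
- by move=> y Uy; apply: continuousM; [exact: (Ck_continuous Cf Uy)|exact: (Ck_continuous Ch Uy)].
move=> k; split.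
  by move=> y Uy; exact: (derivableM (Ck_derivable Cf Uy) (Ck_derivable Ch Uy)).
apply: (@eq_Ck _ _ (fun z => f z * partial k h z + h z * partial k f z)) => //.
  move=> y; rewrite inE => Uy.
  rewrite partialM //; [exact: (Ck_derivable Cf Uy)|exact: (Ck_derivable Ch Uy)].
apply: CkD => //; apply: IHm; first exact: CkS.
- exact: Ck_partial.
- exact: CkS.
- exact: Ck_partial.
Qed.

Lemma CkN m U f : open U -> Ck m U f -> Ck m U (fun z => - f z).
Proof.
move=> oU Cf; have : Ck m U (fun z => (-1) * f z) by exact/CkM/Cf/Ck_cst.
by apply: eq_Ck => // y _; rewrite mulN1r.
Qed.

Lemma CkB m U f h : open U -> Ck m U f -> Ck m U h -> Ck m U (fun z => f z - h z).
Proof. by move=> oU Cf Ch; apply: CkD => //; exact: CkN. Qed.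

Lemma Ck_sum m U I (r : seq I) (P : pred I) (F : I -> 'rV[R]_n -> R) : open U ->
  (forall i, P i -> Ck m U (F i)) -> Ck m U (fun z => \sum_(i <- r | P i) F i z).
Proof.
move=> oU CF; elim: r => [|i r IH].
  by under eq_fun do rewrite big_nil; exact: Ck_cst.
under eq_fun do rewrite big_cons.
by case: (P i) (CF i) => // Ci; apply: CkD => //; exact: Ci.
Qed.

Lemma Ck_prod m U I (r : seq I) (P : pred I) (F : I -> 'rV[R]_n -> R) : open U ->
  (forall i, P i -> Ck m U (F i)) -> Ck m U (fun z => \prod_(i <- r | P i) F i z).
Proof.
move=> oU CF; elim: r => [|i r IH].
  by under eq_fun do rewrite big_nil; exact: Ck_cst.
under eq_fun do rewrite big_cons.
by case: (P i) (CF i) => // Ci; apply: CkM => //; exact: Ci.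
Qed.

(** The exponent varies in the induction, since differentiating lowers it by one. Exponents [-1] and
    [1/2] provide reciprocals and square roots as well. *)
Lemma Ck_powR m U f (s : R) : open U -> (forall y, U y -> 0 < f y) ->
  Ck m U f -> Ck m U (fun z => f z `^ s).
Proof.
move=> oU f0; elim: m s => [|m IHm] s Cf.
all: have cont : forall y, U y -> {for y, continuous (fun z => f z `^ s)}.
1,3: move=> y Uy; apply: (@continuous_comp _ _ _ f (@powR R ^~ s));
  [exact: (Ck_continuous Cf Uy)|];
  apply/differentiable_continuous/derivable1_diffP;
  by have [] := is_derive1_powR s (f0 y Uy).
- by split.
- split=> // k; split.
    move=> y Uy; exact: (derivable_powR_comp s (f0 y Uy) (Ck_derivable Cf Uy)).1.
  apply: (@eq_Ck _ _ (fun z => s * f z `^ (s - 1) * partial k f z)) => //.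
    move=> y; rewrite inE => Uy.
    by rewrite (derivable_powR_comp s (f0 y Uy) (Ck_derivable Cf Uy)).2.
  apply: CkM => //; last exact: Ck_partial.
  by apply: CkM => //; [exact: Ck_cst|apply: IHm; exact: CkS].
Qed.

(** Meant for the squared positive part, which is C^1 but not C^2. *)
Lemma C1_comp_scalar U f (psi dpsi : R -> R) : open U ->
  (forall t : R, is_derive t 1 psi (dpsi t)) -> continuous dpsi ->
  Ck 1 U f -> Ck 1 U (psi \o f).
Proof.
move=> oU dp cdp Cf; split.
  move=> y Uy; apply: continuous_comp; first exact: (Ck_continuous Cf Uy).
  by apply/differentiable_continuous/derivable1_diffP; have [] := dp (f y).
have dpf y k : U y -> is_derive y (delta_mx ord0 k) (psi \o f) (dpsi (f y) * partial k f y).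
  move=> Uy; apply: is_derive_comp_scalar.
  by apply: DeriveDef => //; exact: (Ck_derivable Cf Uy).
move=> k; split; first by move=> y Uy; have [] := dpf y k Uy.
apply: (@eq_Ck _ _ (fun z => dpsi (f z) * partial k f z)) => //.
  by move=> y; rewrite inE => Uy; rewrite /partial; have [_ ->] := dpf y k Uy.
apply: CkM => //; last exact: Ck_partial.
split=> // y Uy; apply: (@continuous_comp _ _ _ f dpsi); first exact: (Ck_continuous Cf Uy).
exact: cdp.
Qed.

End Ck_algebra.

(** * Lebesgue measure on R^n and integration by parts *)

Section Density.
Context d (T : measurableType d) (R : realType).
Variables (mu nu : {measure set T -> \bar R}) (rho : T -> R).
Hypotheses (mrho : measurable_fun [set: T] rho) (rho0 : forall x, 0 <= rho x).
Hypothesis nuE : forall A, measurable A -> nu A = (\int[mu]_(x in A) (rho x)%:E)%E.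

Import HBNNSimple.

(** The hypothesis is the case of indicators; simple functions and monotone convergence do the
    rest. *)
Lemma ge0_integral_density (f : T -> \bar R) : measurable_fun [set: T] f ->
  (forall x, 0 <= f x)%E ->
  (\int[nu]_x f x = \int[mu]_x (f x * (rho x)%:E))%E.
Proof.
move=> mf f0; pose f_ := nnsfun_approx measurableT mf.
have mf_ n : measurable_fun [set: T] (fun x => (f_ n x * rho x)%:E).
  by apply/measurable_EFinP; exact: measurable_funM.
have nd x : {homo (fun n => f_ n x) : m n / (m <= n)%N >-> m <= n}.
  by move=> m n mn; exact/lefP/nd_nnsfun_approx.
have cf x : (EFin \o f_ ^~ x) @ \oo --> f x by apply: cvg_nnsfun_approx => // y _; exact: f0.
transitivity (limn (fun n => \int[nu]_x (f_ n x)%:E))%E.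
  rewrite -monotone_convergence //.
  - by apply: eq_integral => x _; apply: esym; apply: cvg_lim => //; exact: cf.
  - by move=> n; exact/measurable_EFinP.
  - by move=> n x _; rewrite lee_fin.
  - by move=> x _ m n mn; rewrite lee_fin nd.
transitivity (limn (fun n => \int[mu]_x (f_ n x * rho x)%:E))%E; last first.
  rewrite -monotone_convergence //.
  - apply: eq_integral => x _; apply/cvg_lim => //.
    under eq_fun do rewrite EFinM muleC.
    by rewrite muleC; apply: cvgeZl => //; exact: cf.
  - by move=> n x _; rewrite lee_fin mulr_ge0.
  - by move=> x _ m n mn; rewrite lee_fin ler_wpM2r // nd.
congr (limn _); apply/funext => n.
have mpre r : measurable (f_ n @^-1` [set r]) by exact: measurable_sfunP.
transitivity (\sum_(r \in range (f_ n))
    \int[mu]_x (r * \1_(f_ n @^-1` [set r]) x * rho x)%:E)%E.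
  under eq_integral do rewrite fimfunE -fsumEFin //.
  rewrite ge0_integral_fsum //; last 2 first.
  - by move=> r; exact/measurable_EFinP/measurable_funM.
  - by move=> r x _; rewrite nnfun_muleindic_ge0.
  apply: eq_fsbigr => r _; rewrite integralZl_indic_nnsfun // integral_indic // setIT nuE //.
  (* A negative [r] is not a value of the nonnegative simple function, so both sides vanish; the
     scalar can then be taken out as a nonnegative one. *)
  have [r0|r0] := ltP r 0; first by rewrite preimage_nnfun0 // integral_set0 mule0 integral0_eq // => x _; rewrite indicE in_set0 mulr0 mul0r.
  rewrite -ge0_integralZl //; last 2 first.
  - by apply/measurable_EFinP; exact: measurable_funTS.
  - by move=> x _; rewrite lee_fin.
  rewrite integral_mkcond; apply: eq_integral => x _; rewrite patchE indicE.
  by case: ifPn => _; rewrite ?mulr1 ?mulr0 ?mul0r ?EFinM.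
rewrite -ge0_integral_fsum //; last 2 first.
- by move=> r; apply/measurable_EFinP; apply: measurable_funM => //; exact: measurable_funM.
- move=> r x _; have := nnfun_muleindic_ge0 (f_ n) r x; rewrite !lee_fin => h.
  exact: mulr_ge0.
apply: eq_integral => x _; rewrite fsumEFin //; congr EFin.
have fr : finite_set (range (f_ n)) by exact: fimfunP.
have -> : \sum_(r \in range (f_ n)) r * \1_(f_ n @^-1` [set r]) x * rho x =
    rho x * \sum_(r \in range (f_ n)) r * \1_(f_ n @^-1` [set r]) x.
  by rewrite fsbig_distrr //; apply: eq_fsbigr => r _; rewrite mulrC.
by rewrite -(fimfunE (f_ n) x) mulrC.
Qed.

Lemma integral_density (f : T -> R) : measurable_fun [set: T] f ->
  (\int[nu]_x (f x)%:E = \int[mu]_x (f x * rho x)%:E)%E.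
Proof.
move=> mf; have mf' : measurable_fun [set: T] (EFin \o f) by exact/measurable_EFinP.
rewrite integralE [RHS]integralE; congr (_ - _)%E; rewrite ge0_integral_density //.
- by apply: eq_integral => x _; rewrite !funeposE -!EFin_max -EFinM maxr_pMl // mul0r.
- exact: measurable_funepos.
- by apply: eq_integral => x _; rewrite !funenegE -!EFinN -!EFin_max -EFinM maxr_pMl // mul0r mulNr.
- exact: measurable_funeneg.
Qed.

End Density.

(** * Borel sets and Borel functions *)

Section BorelSets.
Variables (M N : ptopologicalType) (R : realType).

Lemma open_borel (U : set M) : open U -> measurable (U : set (borelType M)).
Proof. exact: sub_sigma_algebra. Qed.

Lemma closed_borel (U : set M) : closed U -> measurable (U : set (borelType M)).
Proof.
move=> cU; rewrite -[U]setCK; apply: measurableC.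
by apply: open_borel; exact: closed_openC.
Qed.

Lemma open_preimage (U : set M) (h : M -> N) (V : set N) : open U ->
  (forall x, U x -> {for x, continuous h}) -> open V -> open (U `&` h @^-1` V).
Proof.
rewrite !openE => oU ch oV x [Ux Vx]; apply: filterI; first exact: oU.
by apply: (ch x Ux); exact: oV.
Qed.

Lemma borel_measurable (U : set M) (h : M -> N) : open U ->
  (forall x, U x -> {for x, continuous h}) ->
  measurable_fun (U : set (borelType M)) (h : borelType M -> borelType N).
Proof.
move=> oU ch; apply: (@measurability _ _ (borelType M) (borelType N) U h (@open N) erefl).
by move=> _ [V oV <-]; apply: open_borel; exact: open_preimage.
Qed.

End BorelSets.

Lemma borel_measurable_real (M : ptopologicalType) (R : realType) (U : set M) (h : M -> R) :
  open U -> (forall x, U x -> {for x, continuous h}) ->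
  measurable_fun (U : set (borelType M)) (h : borelType M -> R).
Proof.
move=> oU ch; apply: (@measurability _ _ (borelType M) _ U h _ (RGenOpens.measurableE R)).
move=> _ [_ [a [b ->]] <-]; apply: open_borel; apply: open_preimage => //.
Qed.

(** * Adding a coordinate to a vector *)

Section ConsVector.
Variables (R : realType) (n : nat).

Definition consv (t : R) (y : 'rV[R]_n) : 'rV[R]_n.+1 := row_mx (const_mx t : 'rV_1) y.

Lemma consv0 t y : consv t y ord0 ord0 = t.
Proof.
rewrite mxE; case: splitP => j; first by rewrite mxE.
by [].
Qed.

Lemma consvS t y (j : 'I_n) : consv t y ord0 (lift ord0 j) = y ord0 j.
Proof.
rewrite mxE; case: splitP => k /=; first by case: k => [[]].
rewrite /bump /= add1n => -[jk]; congr (y _ _); exact/val_inj.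
Qed.

Lemma consvP (z : 'rV[R]_n.+1) t (y : 'rV[R]_n) :
  z ord0 ord0 = t -> (forall j : 'I_n, z ord0 (lift ord0 j) = y ord0 j) -> z = consv t y.
Proof.
move=> z0 zS; apply/rowP => k; case: (unliftP ord0 k) => [j ->|->].
  by rewrite consvS.
by rewrite consv0.
Qed.

Definition box (m : nat) (a : R) : set 'rV[R]_m := [set y | forall j, `|y ord0 j| <= a].

Lemma consv_box a t y : box a (consv t y) <-> `|t| <= a /\ box a y.
Proof.
split=> [H|[ta yb] k].
  split=> [|j]; first by have := H ord0; rewrite consv0.
  by have := H (lift ord0 j); rewrite consvS.
case: (unliftP ord0 k) => [j ->|->]; first by rewrite consvS.
by rewrite consv0.
Qed.

Lemma consv_continuous_r t y : {for y, continuous (consv t)}.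
Proof.
move=> U /nbhs_ballP[e /= e0 He]; apply/nbhs_ballP; exists e => //= z [_ yz]; apply: He; split=> // i k.
rewrite (ord1 i); case: (unliftP ord0 k) => [j ->|->]; first by rewrite !consvS.
by rewrite !consv0; exact: ballxx.
Qed.

Lemma consv_continuous_l t y : {for t, continuous (consv^~ y)}.
Proof.
move=> U /nbhs_ballP[e /= e0 He]; apply/nbhs_ballP; exists e => //= s ts; apply: He; split=> // i k.
rewrite (ord1 i); case: (unliftP ord0 k) => [j ->|->]; last by rewrite !consv0.
by rewrite !consvS; exact: ballxx.
Qed.

(** The source carries the product sigma-algebra, so continuity alone does not conclude. An open set
    is a countable union of cubes with rational centre and radius, and the preimage of a cube is a
    rectangle. *)
Lemma consv_measurable : measurable_fun [set: R * borelType 'rV[R]_n]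
  (fun p => consv p.1 p.2 : borelType 'rV[R]_n.+1).
Proof.
apply: (@measurability _ _ _ (borelType 'rV[R]_n.+1) _ _ (@open 'rV[R]_n.+1) erefl) => _ [U oU <-]; rewrite setTI.
pose cube (q : 'rV[rat]_n.+1) (r : rat) : set 'rV[R]_n.+1 :=
  [set z | forall k, `|z ord0 k - ratr (q ord0 k)| < ratr r].
(* Cubes not contained in [U] are replaced by the empty set, so that the union runs over a countable
   type. *)
pose F (p : 'rV[rat]_n.+1 * rat) := if `[< cube p.1 p.2 `<=` U >] then cube p.1 p.2 else set0.
have UE : U = \bigcup_p F p.
  apply/seteqP; split=> [z Uz|z [p _]]; last by rewrite /F; case: asboolP => // H /H.
  move: oU; rewrite openE => /(_ _ Uz)/nbhs_ballP[r /= r0 Hr].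
  have r2 : 0 < r / 2 by rewrite divr_gt0.
  have /rat_in_itvoo[s] := r2; rewrite in_itv /= => /andP[s0 sr].
  have /choice[q Hq] k : exists q : rat, `|z ord0 k - ratr q| < ratr s.
    have : z ord0 k - ratr s < z ord0 k + ratr s by lra.
    move=> /rat_in_itvoo[q]; rewrite in_itv /= => /andP[q1 q2]; exists q.
    by rewrite ltr_norml; lra.
  exists (\row_k q k, s) => //; rewrite /F /=; case: asboolP => [_|].
    by move=> k; rewrite /cube /= !mxE.
  case=> w Hw; apply: Hr; split=> // i k; rewrite (ord1 i) /ball /=.
  have := Hw k; have := Hq k; rewrite !mxE => h1 h2.
  by rewrite !ltr_norml in h1 h2 *; lra.
rewrite UE preimage_bigcup; apply: countable_bigcupT_measurable => [|p]; first exact: countableP.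
rewrite /F; case: ifP => _; last by rewrite preimage_set0.
rewrite (_ : _ @^-1` _ = [set t | `|t - ratr (p.1 ord0 ord0)| < ratr p.2] `*`
  ([set y | forall j, `|y ord0 j - ratr (p.1 ord0 (lift ord0 j))| < ratr p.2] : set (borelType 'rV[R]_n))); last first.
  apply/seteqP; split=> [[t y] /= H|[t y] /= [H1 H2] k].
    split=> [|j]; first by have := H ord0; rewrite consv0.
    by have := H (lift ord0 j); rewrite consvS.
  case: (unliftP ord0 k) => [j ->|->]; first by rewrite consvS.
  by rewrite consv0.
apply: measurableX.
  rewrite (_ : [set _ | _] = `]ratr (p.1 ord0 ord0) - ratr p.2, ratr (p.1 ord0 ord0) + ratr p.2[%classic) //.
  apply/funext => t; apply/propext; rewrite /= in_itv /= ltr_norml ltrBrDl ltrBlDr.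
  by rewrite ltrBlDr [ratr p.2 + _]addrC.
apply: open_borel; rewrite openE => y /= Hy; apply/nbhs_ballP.
(* The default value 1 keeps the radius positive when there is no coordinate. *)
pose e := \big[Num.min/1]_(j < n) (ratr p.2 - `|y ord0 j - ratr (p.1 ord0 (lift ord0 j))|).
have e0 : 0 < e by rewrite /e; apply: (big_ind (fun x => 0 < x)) => //= [x x' x0 x'0|j _]; [rewrite lt_min x0|rewrite subr_gt0].
exists e => //= z [_ yz] j; have := yz ord0 j; rewrite /ball /= => h.
have ej : e <= ratr p.2 - `|y ord0 j - ratr (p.1 ord0 (lift ord0 j))| by exact: bigmin_le.
have := ler_normD (z ord0 j - y ord0 j) (y ord0 j - ratr (p.1 ord0 (lift ord0 j))).
by rewrite addrA subrK [`|z ord0 j - y ord0 j|]distrC; move: h ej; lra.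
Qed.

End ConsVector.

Section Boxes.
Variables (R : realType) (n : nat).
Implicit Types (a : R) (g : 'rV[R]_n -> R).

Lemma box_compact a : compact (box a : set 'rV[R]_n).
Proof.
rewrite (_ : box a = [set v | forall i : 'I_n, `[- a, a]%classic (v ord0 i)]).
  by apply: (@rV_compact R n (fun=> `[- a, a]%classic)) => i; exact: segment_compact.
by apply/funext => y; apply/propext; split=> H j; have := H j; rewrite /= in_itv /= ler_norml.
Qed.

Lemma box_closed a : closed (box a : set 'rV[R]_n).
Proof. by apply: compact_closed; [exact: norm_hausdorff|exact: box_compact]. Qed.

Lemma box_measurable a : measurable (box a : set (borelType 'rV[R]_n)).
Proof. by apply: closed_borel; exact: box_closed. Qed.

Lemma partial_eq0_outside g a k y : (forall y, ~ box a y -> g y = 0) -> ~ box a y ->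
  partial k g y = 0.
Proof.
move=> g0 nb; rewrite -(partial_cst 0 k y); apply: near_eq_partial.
apply: (@open_near_eq _ _ (~` box a)) => //; first exact/closed_openC/box_closed.
by move=> z; rewrite inE => nz; exact: g0.
Qed.

Lemma box_integrable (m : {measure set (borelType 'rV[R]_n) -> \bar R}) g a :
  (m (box a) < +oo)%E -> (forall y, {for y, continuous g}) ->
  (forall y, ~ box a y -> g y = 0) -> m.-integrable [set: _] (EFin \o g).
Proof.
move=> ma cg g0.
have mg : measurable_fun [set: borelType 'rV[R]_n] (g : borelType 'rV[R]_n -> R).
  by apply: borel_measurable_real => //; exact: openT.
pose g' : borelType 'rV[R]_n -> \bar R := EFin \o g.
rewrite -[EFin \o g]/g' (_ : g' = g' \_ (box a)); last first.
  by apply/funext => y; rewrite patchE; case: ifPn => //; rewrite notin_setE /g' /= => /g0 ->.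
apply: (integrable_mkcond _ (box_measurable a)).1.
apply: measurable_bounded_integrable => //; first exact: box_measurable.
  exact: measurable_funTS.
have /compact_bounded[M [Mr HM]] : compact (g @` box a).
  by apply: continuous_compact; [exact/continuous_subspaceT|exact: box_compact].
by exists M; split=> // N MN y yb /=; apply: (HM N MN); exists y.
Qed.

End Boxes.

Section ConsPartial.
Variables (R : realType) (n : nat).
Implicit Types (Phi : 'rV[R]_n.+1 -> R).

Lemma partial_consvS Phi t y (j : 'I_n) :
  (derivable (Phi \o consv t) y (delta_mx ord0 j) <->
   derivable Phi (consv t y) (delta_mx ord0 (lift ord0 j))) /\
  partial j (Phi \o consv t) y = partial (lift ord0 j) Phi (consv t y).
Proof.
have E : (fun h : R => h^-1 *: (((Phi \o consv t) \o shift y) (h *: delta_mx ord0 j) - (Phi \o consv t) y)) =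
    (fun h => h^-1 *: ((Phi \o shift (consv t y)) (h *: delta_mx ord0 (lift ord0 j)) - Phi (consv t y))).
  apply/funext => h /=; congr (_ *: (Phi _ - _)); apply/esym/consvP => [|i].
    by rewrite !mxE mulr0 add0r -[RHS](consv0 t y) mxE.
  by rewrite [LHS]mxE consvS !mxE /= (inj_eq lift_inj).
by split; [rewrite /derivable E|rewrite /partial [LHS]/derive E].
Qed.

Lemma partial_consv0 Phi t y :
  (derivable (fun s => Phi (consv s y)) t 1 <->
   derivable Phi (consv t y) (delta_mx ord0 ord0)) /\
  'D_1 (fun s => Phi (consv s y)) t = partial ord0 Phi (consv t y).
Proof.
have E : (fun h : R => h^-1 *: (((fun s => Phi (consv s y)) \o shift t) (h *: 1) - Phi (consv t y))) =
    (fun h => h^-1 *: ((Phi \o shift (consv t y)) (h *: delta_mx ord0 ord0) - Phi (consv t y))).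
  apply/funext => h /=; congr (_ *: (Phi _ - _)); apply/esym/consvP => [|i].
    by rewrite [LHS]mxE consv0 !mxE.
  by rewrite [LHS]mxE consvS !mxE /= mulr0 add0r.
by split; [rewrite /derivable E|rewrite /partial [LHS]/derive E].
Qed.

Local Opaque derive.

Lemma C1_consv Phi t : Ck 1 setT Phi -> Ck 1 setT (Phi \o consv t).
Proof.
move=> CPhi; have cont y : {for y, continuous (Phi \o consv t)}.
  by apply: continuous_comp; [exact: consv_continuous_r|exact: (Ck_continuous CPhi I)].
split=> // k; split=> [y _|].
  by apply/(partial_consvS _ _ _ _).1; exact: (Ck_derivable CPhi I).
split=> // y _; rewrite (_ : partial k _ = partial (lift ord0 k) Phi \o consv t).
  by apply: continuous_comp; [exact: consv_continuous_r|exact: (Ck_continuous (Ck_partial (lift ord0 k) CPhi) I)].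
by apply/funext => z; exact: (partial_consvS _ _ _ _).2.
Qed.

(* The fundamental theorem of calculus along the first coordinate. *)
Lemma integral_partial_consv0 Phi a y : Ck 1 setT Phi ->
  (forall z, ~ box a z -> Phi z = 0) ->
  (\int[lebesgue_measure]_t (partial ord0 Phi (consv t y))%:E = 0)%E.
Proof.
move=> CPhi Phi0; pose b := `|a| + 1.
have ab : a < b by rewrite /b; have := ler_norm a; lra.
have b0 : 0 < b by rewrite /b; have := normr_ge0 a; lra.
have Out t : b <= `|t| -> ~ box a (consv t y).
  by move=> bt /consv_box[]; lra.
pose phi t := Phi (consv t y).
have dphi t : derivable phi t 1.
  by apply/(partial_consv0 _ _ _).1; exact: (Ck_derivable CPhi I).
have phi'E t : derive1 phi t = partial ord0 Phi (consv t y).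
  by rewrite derive1E (partial_consv0 _ _ _).2.
have c' (t : R) : {for t, continuous (partial ord0 Phi \o (fun s => consv s y))}.
  apply: continuous_comp; first exact: consv_continuous_l.
  exact: (Ck_continuous (Ck_partial ord0 CPhi) I).
have -> : (\int[lebesgue_measure]_t (partial ord0 Phi (consv t y))%:E =
    \int[lebesgue_measure]_(t in `[(- b)%R, b]) (partial ord0 Phi (consv t y))%:E)%E.
  rewrite [RHS]integral_mkcond; apply: eq_integral => t _; rewrite patchE; case: ifPn => //.
  rewrite notin_setE /= in_itv /= -ler_norml => /negP; rewrite -ltNge => tb.
  by rewrite (partial_eq0_outside _ Phi0) //; apply: Out; exact: ltW.
rewrite (@continuous_FTC2 _ _ phi).
- by rewrite -EFinB /phi !Phi0 ?subrr //; apply: Out; rewrite ?normrN ger0_norm // ltW.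
- by lra.
- by apply: continuous_subspaceT => t; exact: c'.
- have cphi t : phi @ t --> phi t by apply/differentiable_continuous/derivable1_diffP.
  by split=> [t _| |]; [exact: dphi|exact/cvg_at_right_filter|exact/cvg_at_left_filter].
- by move=> t _; exact: phi'E.
Qed.

End ConsPartial.

(** All that is used of Lebesgue measure on [R^n]: it represents the iterated integral, is finite on
    boxes, and annihilates partial derivatives of compactly supported C^1 functions. Finiteness on
    boxes belongs to the induction because it gives the sigma-finiteness required by Fubini. *)
Definition lebesgue_like (R : realType) (n : nat) (m : set (borelType 'rV[R]_n) -> \bar R) :=
  [/\ forall f : borelType 'rV[R]_n -> \bar R, measurable_fun setT f -> (forall y, 0 <= f y)%E ->
        lebesgue_int f = (\int[m]_y f y)%E,
      forall a, (m (box a) < +oo)%E &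
      forall k (Phi : 'rV[R]_n -> R) a, Ck 1 setT Phi -> (forall y, ~ box a y -> Phi y = 0) ->
        (\int[m]_y (partial k Phi y)%:E = 0)%E].

Lemma box_sigma_finite (R : realType) (n : nat) (m : {measure set (borelType 'rV[R]_n) -> \bar R}) :
  (forall a, (m (box a) < +oo)%E) -> sigma_finite [set: borelType 'rV[R]_n] m.
Proof.
move=> mb; exists (fun k => box k%:R); last by move=> k; split; [exact: box_measurable|exact: mb].
apply/esym/seteqP; split=> // y _.
exists (Num.truncn `|y|).+1 => // j; apply: le_trans (ltW (truncnS_gt _)).
rewrite [leRHS]/Num.norm /= mx_normrE.
exact: (le_bigmax _ (fun i : 'I_1 * 'I_n => `|y i.1 i.2|) (ord0, j)).
Qed.

Local Opaque derive.

Section LebesgueMeasure.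
Variable R : realType.

Lemma lebesgue_like0 :
  exists m : {measure set (borelType 'rV[R]_0) -> \bar R}, lebesgue_like m.
Proof.
exists (@dirac _ (borelType 'rV[R]_0) 0 R); split.
- move=> f mf f0 /=; rewrite integral_dirac // diracT mul1e //.
- by move=> a; rewrite /dirac ltry.
- by case.
Qed.

Section Step.
Variables (n : nat) (m : {measure set (borelType 'rV[R]_n) -> \bar R}).
Hypothesis Lm : lebesgue_like m.

Let ms : set (borelType 'rV[R]_n) -> \bar R := m.
HB.instance Definition _ := Measure.on ms.
HB.instance Definition _ := Measure_isSigmaFinite.Build _ _ _ ms
  (box_sigma_finite (let: And3 _ mb _ := Lm in mb)).

Let e (p : measurableTypeR R * borelType 'rV[R]_n) : borelType 'rV[R]_n.+1 := consv p.1 p.2.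
Let me : measurable_fun setT e := @consv_measurable R n.
Let pm : {measure set (measurableTypeR R * borelType 'rV[R]_n)%type -> \bar R} :=
  (@lebesgue_measure R \x ms)%E.

(** The product of Lebesgue measure on the line with [m] lives on pairs; its image under [consv]
    lives on row vectors, and Tonelli unfolds one level of the iterated integral. *)
Lemma lebesgue_likeS :
  exists m' : {measure set (borelType 'rV[R]_n.+1) -> \bar R}, lebesgue_like m'.
Proof.
have [mE mb mS] := Lm.
have mbox' a : (pushforward pm e (box a) < +oo)%E.
  rewrite /pushforward (_ : e @^-1` box a = `[- a, a]%classic `*` box a).
    have -> : pm (`[- a, a]%classic `*` box a) =
        (@lebesgue_measure R [set` `[(- a)%R, a%R]] * m (box a))%E.
      by apply: product_measure1E => //; exact: box_measurable.
    apply: lte_mul_pinfty; [by []| |exact: mb].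
    by rewrite lebesgue_measure_itv /=; case: ifP.
  apply/seteqP; split=> -[t y] /=; rewrite in_itv /= -ler_norml; first by move/consv_box.
  by move=> ?; exact/consv_box.
have [M ME] : exists M : {measure set (borelType 'rV[R]_n.+1) -> \bar R},
    M = pushforward pm e :> (set (borelType 'rV[R]_n.+1) -> \bar R).
  by unshelve eexists (pushforward pm e); first exact: me.
exists M; rewrite /lebesgue_like ME; split=> //.
- move=> f mf f0; rewrite ge0_integral_pushforward //.
  rewrite fubini_tonelli1 //=; last exact: measurableT_comp.
  apply: eq_integral => t _; rewrite mE //.
  exact: (measurableT_comp mf (measurableT_comp me (measurable_pair1 t))).
- move=> k Phi a CPhi Phi0.
  have cont : forall y, {for y, continuous (partial k Phi)}.
    by move=> y; exact: (Ck_continuous (Ck_partial k CPhi) I).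
  have mP : measurable_fun [set: borelType 'rV[R]_n.+1] (EFin \o (partial k Phi : borelType _ -> R)).
    by apply/measurable_EFinP; apply: borel_measurable_real => //; exact: openT.
  have iP : pm.-integrable setT ((EFin \o partial k Phi) \o e).
    have := box_integrable (m := M) (a := a) _ cont (fun y => partial_eq0_outside k (y := y) Phi0).
    rewrite ME => /(_ (mbox' a))/integrableP[_].
    rewrite ge0_integral_pushforward //; last exact: measurableT_comp.
    by move=> fin; apply/integrableP; split=> //; exact: measurableT_comp.
  rewrite integral_pushforward // preimage_setT.
  (* For a later coordinate the slices at fixed [t] are integrated inside and the induction
     hypothesis applies; for the first coordinate the order is reversed and the fundamental theorem
     of calculus applies. *)
  move: mP iP; case: (unliftP ord0 k) => [j ->|->] mP iP.
    rewrite -integral12_prod_meas1 //= integral0_eq // => t _.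
    have := mS j (Phi \o consv t) a (C1_consv t CPhi).
    under eq_integral do rewrite (partial_consvS _ _ _ _).2.
    apply => y nb; apply: Phi0 => /consv_box[_]; exact: nb.
  rewrite -integral21_prod_meas1 //= integral0_eq // => y _.
  exact: (integral_partial_consv0 y CPhi Phi0).
Qed.
End Step.

Lemma lebesgue_measure_rV n :
  exists m : {measure set (borelType 'rV[R]_n) -> \bar R}, lebesgue_like m.
Proof.
by elim: n => [|n [m Lm]]; [exact: lebesgue_like0|exact: lebesgue_likeS Lm].
Qed.

End LebesgueMeasure.

(** * The chain rule and the symmetry of second derivatives *)

Section MultivariateCalculus.
Variables (R : realType) (n : nat).
Implicit Types (U : set 'rV[R]_n) (f h : 'rV[R]_n -> R) (y : 'rV[R]_n).

Lemma open_rV_ball U y : open U -> U y ->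
  exists2 r : R, 0 < r & forall z, `|z - y| < r -> U z.
Proof.
move=> oU Uy; have /nbhs_ballP[r /= r0 H] : nbhs y U by exact: open_nbhs_nbhs.
by exists r => // z zy; apply: H; rewrite -ball_normE /= distrC.
Qed.

Lemma Ck_uniform_near m U f y (e : R) : open U -> Ck m U f -> U y -> 0 < e ->
  exists2 r : R, 0 < r & forall z, `|z - y| < r -> U z /\ `|f z - f y| < e.
Proof.
move=> oU Cf Uy e0.
have /cvgrPdist_lt/(_ e e0) : {for y, continuous f} by exact: Ck_continuous Cf Uy.
move=> /nbhs_ballP[r /= r0 H].
have [r' r'0 H'] := open_rV_ball oU Uy.
exists (Num.min r r'); first by rewrite lt_min r0.
move=> z; rewrite lt_min => /andP[zr zr']; split; first exact: H'.
by rewrite distrC; apply: H; rewrite -ball_normE /= distrC.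
Qed.

Lemma is_derive_shift_arg f (w z e : 'rV[R]_n) d :
  is_derive (z + w) e f d -> is_derive z e (fun x => f (x + w)) d.
Proof.
have {1}-> : z + w = z + w + 0 *: e by rewrite scale0r addr0.
move=> /is_derive_lineP H.
have -> : z = z + 0 *: e by rewrite scale0r addr0.
apply/is_derive_lineP.
have <- // : (fun s : R => f (z + w + s *: e)) = (fun s : R => f (z + s *: e + w)).
by apply/funext => s; rewrite addrAC.
Qed.

(** Two mean value theorems: along [a] for the increment of [f] by [s] along [b], then along [b] for
    [partial a f]. The left side is symmetric in [a] and [b], which forces the mixed derivatives to
    agree in the limit. *)
Lemma second_difference U f y a b (r s : R) : Ck 2 U f ->
  (forall z, `|z - y| < r -> U z) -> 0 < s -> s + s < r ->
  exists2 p, `|p - y| < r &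
    f (y + s *: delta_mx ord0 a + s *: delta_mx ord0 b) - f (y + s *: delta_mx ord0 a)
    - (f (y + s *: delta_mx ord0 b) - f y) = s * s * partial b (partial a f) p.
Proof.
move=> Cf Ur s0 sr.
set ea := delta_mx ord0 a; set eb := delta_mx ord0 b.
have near2 (t t' : R) : `|t| <= s -> `|t'| <= s -> `|y + t *: ea + t' *: eb - y| < r.
  move=> ts t's; rewrite -[y + _ + _]addrA [y + _]addrC addrK.
  apply: le_lt_trans sr; apply: le_trans (ler_normD _ _) _.
  by rewrite lerD //; [apply: le_trans ts|apply: le_trans t's]; exact: norm_delta.
have near1 (t : R) : `|t| <= s -> `|y + t *: ea - y| < r.
  by move=> ts; have := near2 t 0 ts; rewrite scale0r addr0 normr0; apply; exact: ltW.
have ns : `|s| = s by rewrite gtr0_norm.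
have dphi (t : R) : `|t| <= s -> is_derive (y + t *: ea) ea
    (fun x => f (x + s *: eb) - f x)
    (partial a f (y + t *: ea + s *: eb) - partial a f (y + t *: ea)).
  move=> ts; apply: is_deriveB.
    apply: is_derive_shift_arg; apply: DeriveDef => //.
    by apply: Ck_derivable Cf _; apply/Ur/near2; rewrite ?ns.
  by apply: DeriveDef => //; apply: Ck_derivable Cf _; exact/Ur/near1.
have [|t ts] := @directional_MVT _ _ (fun x => f (x + s *: eb) - f x) y ea s.
  by move=> t; rewrite ns => ts; have [] := dphi t ts.
rewrite ns in ts; have [_ ->] := dphi t ts.
move=> ->.
have [|t'] := @directional_MVT _ _ (partial a f) (y + t *: ea) eb s.
  by move=> t'; rewrite ns => t's; apply: (Ck_derivable (Ck_partial a Cf)); exact/Ur/near2.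
rewrite ns => t's ->; exists (y + t *: ea + t' *: eb); first exact: near2.
by rewrite mulrA.
Qed.

Lemma partial_comm U f y a b : open U -> Ck 2 U f -> U y ->
  partial a (partial b f) y = partial b (partial a f) y.
Proof.
move=> oU Cf Uy.
have sub_exchange (X X' A B C : R) : X = X' -> X - A - (B - C) = X' - B - (A - C).
  by move=> ->; ring.
have close (A B C D e : R) : A = D -> `|A - B| < e / 2 -> `|D - C| < e / 2 -> `|C - B| <= e.
  move=> ->; rewrite !ltr_norml ler_norml => /andP[? ?] /andP[? ?].
  by apply/andP; split; lra.
have C1 c d := Ck_partial c (Ck_partial d Cf) : Ck 0 U (partial c (partial d f)).
apply/eqP; rewrite -subr_eq0 -normr_le0; apply/ler_addgt0Pr => e e0.
rewrite add0r.
have e2 : 0 < e / 2 by rewrite divr_gt0.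
have [r1 r10 H1] := Ck_uniform_near oU (C1 a b) Uy e2.
have [r2 r20 H2] := Ck_uniform_near oU (C1 b a) Uy e2.
(* Two steps of length [s] must stay inside the ball of radius [r]. *)
pose r := Num.min r1 r2; pose s := r / 3.
have r0 : 0 < r by rewrite lt_min r10.
have s0 : 0 < s by rewrite divr_gt0.
have sr : s + s < r by rewrite /s; lra.
have Ur z : `|z - y| < r -> U z by rewrite lt_min => /andP[/H1[]].
clearbody s.
have [p pr E1] := second_difference a b Cf Ur s0 sr.
have [q qr E2] := second_difference b a Cf Ur s0 sr.
have E : partial b (partial a f) p = partial a (partial b f) q.
  apply: (mulfI (x := s * s)); first by rewrite mulf_neq0 // gt_eqF.
  apply: eq_trans (esym E1) (eq_trans _ E2); apply: sub_exchange.
  by rewrite addrAC.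
move: pr qr; rewrite !lt_min => /andP[_ /H2[_ h1]] /andP[/H1[_ h2] _].
exact: close E h1 h2.
Qed.

(* Mean value estimate along a path moving one coordinate at a time. *)
Lemma coordinate_path_bound f y (r e : R) :
  (forall z k, `|z - y| < r -> derivable f z (delta_mx ord0 k) /\ `|partial k f z| <= e) ->
  0 <= e -> forall v, `|v| < r -> `|f (y + v) - f y| <= n%:R * e * `|v|.
Proof.
move=> Hf e0 v vr.
pose w k : 'rV[R]_n := \row_i (if (i < k)%N then v ord0 i else 0).
have wS (k : 'I_n) : w k.+1 = w k + v ord0 k *: delta_mx ord0 k.
  apply/rowP => i; rewrite !mxE ltnS leq_eqVlt eqxx /=.
  have [->|ik] := eqVneq i k; first by rewrite ltnn eqxx mulr1 add0r.
  by rewrite (inj_eq val_inj) (negbTE ik) /= mulr0 addr0.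
have vk (k : 'I_n) : `|v ord0 k| <= `|v|.
  rewrite [leRHS]/Num.norm /= mx_normrE.
  exact: (le_bigmax _ (fun i : 'I_1 * 'I_n => `|v i.1 i.2|) (ord0, k)).
(* In the sup norm, replacing coordinates of [v] by zero or shrinking them keeps the path in the
   ball. *)
have wk (k : 'I_n) (t : R) : `|t| <= `|v ord0 k| ->
    `|y + w k + t *: delta_mx ord0 k - y| < r.
  move=> tv; rewrite -[y + _ + _]addrA [y + _]addrC addrK; apply: le_lt_trans vr.
  rewrite [leLHS]/Num.norm /= mx_normrE; apply: bigmax_le => // -[i j] _ /=.
  have -> : i = ord0 by apply/val_inj; case: i => -[].
  rewrite !mxE /=.
  have [->|jk] := eqVneq j k.
    by rewrite ltnn add0r mulr1; apply: le_trans tv (vk k).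
  by rewrite mulr0 addr0; case: ifP => _ //; rewrite normr0.
have step (k : 'I_n) : `|f (y + w k.+1) - f (y + w k)| <= e * `|v|.
  rewrite wS addrA.
  have [t tv|t tv ->] := @directional_MVT _ _ f (y + w k) (delta_mx ord0 k) (v ord0 k).
    by have [] := Hf _ k (wk k t tv).
  rewrite normrM mulrC ler_pM //.
  by have [] := Hf _ k (wk k t tv).
suff /(_ n (leqnn n)) : forall m, (m <= n)%N -> `|f (y + w m) - f y| <= m%:R * e * `|v|.
  by have -> : w n = v by apply/rowP => i; rewrite mxE ltn_ord.
elim=> [|m IHm] mn.
  have -> : w 0%N = 0 by apply/rowP => i; rewrite !mxE.
  by rewrite addr0 subrr normr0 !mul0r.
have := IHm (ltnW mn); have := step (Ordinal mn) => /= h1 h2.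
have -> : f (y + w m.+1) - f y = (f (y + w m.+1) - f (y + w m)) + (f (y + w m) - f y).
  by rewrite addrA subrK.
apply: le_trans (ler_normD _ _) _.
by rewrite -natr1 -mulrA mulrDl mul1r mulrA addrC lerD.
Qed.

Definition grad_form f y (v : 'rV[R]_n) : R := \sum_k v ord0 k * partial k f y.

Lemma grad_form_linear f y : linear (grad_form f y).
Proof.
move=> a u v; rewrite /grad_form scaler_sumr -big_split /=.
by apply: eq_bigr => k _; rewrite !mxE mulrDl /GRing.scale /= mulrA.
Qed.

HB.instance Definition _ f y := GRing.isLinear.Build R 'rV[R]_n R _ (grad_form f y)
  (grad_form_linear f y).

Lemma grad_form_delta f y k : grad_form f y (delta_mx ord0 k) = partial k f y.
Proof.
rewrite /grad_form (bigD1 k) //= big1 ?addr0 ?mxE ?eqxx ?mul1r // => i ik.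
by rewrite mxE (negbTE ik) andbF mul0r.
Qed.

(** Subtracting the candidate differential leaves a function whose partial derivatives are small
    near [y]; [coordinate_path_bound] turns this into a remainder that is small compared with the
    increment. *)
Lemma C1_diff U f y : open U -> Ck 1 U f -> U y -> is_diff y f (grad_form f y).
Proof.
move=> oU Cf Uy.
have cl : continuous (grad_form f y).
  have C : Ck 0 setT (grad_form f y).
    apply: Ck_sum => [|k _]; first exact: openT.
    apply: CkM; [exact: openT| |exact: Ck_cst].
    by split=> // v _; exact: coord_continuous.
  by move=> v; exact: (Ck_continuous C I).
suff H : f \o shift y = cst (f y) + grad_form f y +o_ (nbhs (0 : 'rV[R]_n)) id.
  have E := diff_unique cl H.
  by apply: DiffDef => //; apply/diff_locallyP; rewrite E.
apply/eqaddoP => _/posnumP[e].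
(* The path bound costs a factor [n]; adding 1 avoids a division by zero in dimension zero. *)
pose e' := e%:num / (n%:R + 1).
have n1 : 0 < n%:R + 1 :> R by rewrite ltr_wpDl.
have e'0 : 0 < e' by rewrite divr_gt0.
pose g z := f z - grad_form f y (z - y).
have dlin k z : is_derive z (delta_mx ord0 k) (fun z => grad_form f y (z - y)) (partial k f y).
  apply: is_derive_shift_arg.
  have D : differentiable (grad_form f y) (z - y) by exact: linear_differentiable.
  apply: DeriveDef; first exact: diff_derivable.
  by rewrite deriveE // diff_lin //; exact: grad_form_delta.
have [r r0 Hr] : exists2 r : R, 0 < r & forall z k, `|z - y| < r ->
    derivable g z (delta_mx ord0 k) /\ `|partial k g z| <= e'.
  have [r' r'0 H'] := open_rV_ball oU Uy.
  have [r0 r00 H0] : exists2 r : R, 0 < r & forall k z, `|z - y| < r ->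
      `|partial k f z - partial k f y| < e'.
    have H1 (k : 'I_n) : \forall r \near (0:R)^'+, forall z, `|z - y| < r ->
        `|partial k f z - partial k f y| < e'.
      have [r r0 H] := Ck_uniform_near oU (Ck_partial k Cf) Uy e'0.
      near=> s => z zs; apply: (H z _).2; apply: lt_trans zs _.
      near: s; exact: nbhs_right_lt.
    have : \forall r \near (0:R)^'+, (0 < r) /\ forall k z, `|z - y| < r ->
        `|partial k f z - partial k f y| < e'.
      apply: filterI; first exact: nbhs_right_gt.
      exact: (filter_forall (f := fun k r => forall z, `|z - y| < r -> `|partial k f z - partial k f y| < e') _ H1).
    by move=> /filter_ex[r [r0 H]]; exists r.
  exists (Num.min r0 r'); first by rewrite lt_min r00.
  move=> z k; rewrite lt_min => /andP[zr zr'].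
  have := is_deriveB (DeriveDef (Ck_derivable Cf (H' z zr')) erefl) (dlin k z).
  move=> [d1 d2]; split; first exact: d1.
  rewrite /partial; have -> : 'D_(delta_mx ord0 k) g z = partial k f z - partial k f y by exact: d2.
  exact/ltW/H0.
apply/nbhs_ballP; exists r => // v; rewrite -ball_normE /= sub0r normrN => vr.
have := coordinate_path_bound Hr (ltW e'0) vr.
rewrite /g [y + v - y]addrAC subrr add0r linear0 subr0.
move=> H; rewrite -[X in `|X|]/(f (v + y) - (f y + grad_form f y v)).
rewrite opprD addrA addrAC [v + y]addrC; apply: le_trans H _.
rewrite ler_wpM2r // /e' mulrA ler_pdivrMr // mulrC ler_wpM2l //.
by rewrite lerDl.
Unshelve. all: by end_near. Qed.

End MultivariateCalculus.

Section ChainRule.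
Variables (R : realType) (n m : nat).

Lemma partial_coords_derivable (tau : 'rV[R]_n -> 'rV[R]_m) U y (k : 'I_n) :
  open U -> (forall l, Ck 1 U (fun z => tau z ord0 l)) -> U y ->
  is_derive y (delta_mx ord0 k) tau (\row_l partial k (fun z => tau z ord0 l) y).
Proof.
move=> oU Ct Uy.
have dt : derivable tau y (delta_mx ord0 k).
  by apply/derivable_mxP => i j; rewrite ord1; exact: Ck_derivable (Ct j) Uy.
apply: DeriveDef => //; rewrite derive_mx //.
by apply/rowP => l; rewrite !mxE.
Qed.

Lemma C1_mx_differentiable (tau : 'rV[R]_n -> 'rV[R]_m) U y :
  open U -> (forall l, Ck 1 U (fun z => tau z ord0 l)) -> U y ->
  differentiable tau y.
Proof.
move=> oU Ct Uy.
have -> : tau = (fun z => \sum_l tau z ord0 l *: (delta_mx ord0 l : 'rV[R]_m)).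
  by apply/funext => z; exact: row_sum_delta.
have -> : (fun z => \sum_l tau z ord0 l *: (delta_mx ord0 l : 'rV[R]_m)) =
    \sum_l (fun z => tau z ord0 l *: (delta_mx ord0 l : 'rV[R]_m)).
  by apply/funext => z; rewrite fct_sumE.
apply: differentiable_sum => l; apply: differentiableZl.
by have [] := C1_diff oU (Ct l) Uy.
Qed.

Lemma jacobianE (tau : 'rV[R]_n -> 'rV[R]_m) U y k l :
  open U -> (forall l, Ck 1 U (fun z => tau z ord0 l)) -> U y ->
  jacobian tau y k l = partial k (fun z => tau z ord0 l) y.
Proof.
move=> oU Ct Uy.
have := deriveEjacobian (delta_mx ord0 k) (C1_mx_differentiable oU Ct Uy).
have [_ ->] := partial_coords_derivable k oU Ct Uy.
by rewrite -rowE => /rowP/(_ l); rewrite !mxE.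
Qed.

Lemma chain_rule (tau : 'rV[R]_n -> 'rV[R]_m) f U U' y k :
  open U -> open U' -> (forall l, Ck 1 U (fun z => tau z ord0 l)) ->
  Ck 1 U' f -> U y -> U' (tau y) ->
  derivable (f \o tau) y (delta_mx ord0 k) /\
  partial k (f \o tau) y =
    \sum_l partial l f (tau y) * partial k (fun z => tau z ord0 l) y.
Proof.
move=> oU oU' Ct Cf Uy U'ty.
have dt := C1_mx_differentiable oU Ct Uy.
have [df dfE] := C1_diff oU' Cf U'ty.
have dc : differentiable (f \o tau) y by exact: differentiable_comp.
split; first exact: diff_derivable.
rewrite /partial deriveE // diff_comp //= dfE /grad_form.
rewrite -deriveE //; have [_ ->] := partial_coords_derivable k oU Ct Uy.
by apply: eq_bigr => l _; rewrite mxE mulrC.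
Qed.

Lemma C1_comp (tau : 'rV[R]_n -> 'rV[R]_m) f U U' :
  open U -> open U' -> (forall l, Ck 1 U (fun z => tau z ord0 l)) ->
  (forall y, U y -> U' (tau y)) -> Ck 1 U' f -> Ck 1 U (f \o tau).
Proof.
move=> oU oU' Ct UU' Cf.
have ct y : U y -> {for y, continuous tau}.
  by move=> Uy; apply: differentiable_continuous; exact: C1_mx_differentiable Uy.
split.
  move=> y Uy; apply: continuous_comp; first exact: ct.
  exact: Ck_continuous Cf (UU' _ Uy).
move=> k; split.
  by move=> y Uy; exact: (chain_rule k oU oU' Ct Cf Uy (UU' _ Uy)).1.
apply: (@eq_Ck _ _ _ _ (fun y => \sum_l partial l f (tau y) *
    partial k (fun z => tau z ord0 l) y)) => //.
  by move=> y; rewrite inE => Uy; rewrite (chain_rule k oU oU' Ct Cf Uy (UU' _ Uy)).2.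
apply: Ck_sum => // l _; apply: CkM => //; last exact: (Ck_partial k (Ct l)).
split=> // y Uy; apply: (@continuous_comp _ _ _ tau (partial l f)); first exact: ct.
exact: Ck_continuous (Ck_partial l Cf) (UU' _ Uy).
Qed.

End ChainRule.

(** * The pointwise curvature-dimension inequality *)

(* The contracted Ricci identity on arrays of numbers: [X a] are the components
   of a vector field, [dX a b] and [ddX a b c] their first and second partial
   derivatives along [b] and [c], [Gam a b c] the symbols with upper index [a],
   and [dGam a b c d] their derivative along [d]. *)
Section Weitzenboeck.
Variables (R : comRingType) (n : nat).
Variables (X : 'I_n -> R) (dX : 'I_n -> 'I_n -> R) (ddX : 'I_n -> 'I_n -> 'I_n -> R).
Variables (Gam : 'I_n -> 'I_n -> 'I_n -> R) (dGam : 'I_n -> 'I_n -> 'I_n -> 'I_n -> R).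
Hypothesis ddX_sym : forall a b c, ddX a b c = ddX a c b.
Hypothesis Gam_sym : forall a b c, Gam a b c = Gam a c b.

(** [A] is the covariant derivative of [X], [dA] its partial derivatives by the product rule, [t]
    the divergence of [X], [c] the contracted symbols and [Ric] the Ricci tensor in terms of the
    symbols. *)
Let A a b := dX a b + \sum_m Gam a b m * X m.
Let dA a b d := ddX a b d + \sum_m (Gam a b m * dX m d + X m * dGam a b m d).
Let t := \sum_a A a a.
Let dt d := \sum_a dA a a d.
Let c a := \sum_m Gam m m a.
Let Ric b k := \sum_a (dGam a b k a - dGam a a k b
  + \sum_m (Gam a a m * Gam m b k - Gam a b m * Gam m a k)).

Let dXE a b : dX a b = A a b - \sum_m Gam a b m * X m.
Proof. by rewrite /A addrK. Qed.

(** The commutator of two covariant derivatives, contracted. Second derivatives of [X] cancel by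
    symmetry; rewriting [dX] as [A] minus its connection part produces the quadratic terms of the
    curvature. The two sums in [A] remain because [dA] consists of partial, not covariant,
    derivatives. *)
Let ricci_row b : \sum_a (dA a b a - dA a a b) =
  \sum_k Ric b k * X k + \sum_a \sum_m Gam a b m * A m a - \sum_m c m * A m b.
Proof.
have -> : \sum_k Ric b k * X k = \sum_a \sum_k ((dGam a b k a - dGam a a k b) * X k
    + \sum_m (Gam a a m * Gam m b k - Gam a b m * Gam m a k) * X k).
  rewrite exchange_big; apply: eq_bigr => k _ /=.
  by rewrite mulr_suml; apply: eq_bigr => a _; rewrite mulrDl mulr_suml.
have -> : \sum_m c m * A m b = \sum_a \sum_m Gam a a m * A m b.
  by rewrite exchange_big; apply: eq_bigr => m _; rewrite mulr_suml.
rewrite -big_split -sumrB /=; apply: eq_bigr => a _.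
have -> : \sum_k ((dGam a b k a - dGam a a k b) * X k
    + \sum_m (Gam a a m * Gam m b k - Gam a b m * Gam m a k) * X k) =
  \sum_m ((dGam a b m a - dGam a a m b) * X m
    + \sum_k (Gam a a m * Gam m b k - Gam a b m * Gam m a k) * X k).
  rewrite !big_split /=; congr (_ + _); rewrite exchange_big.
  by apply: eq_bigr => k _; apply: eq_bigr.
rewrite -big_split -sumrB /= /dA (ddX_sym a b a).
rewrite opprD addrACA subrr add0r -sumrB; apply: eq_bigr => m _.
rewrite !dXE.
have -> : \sum_k (Gam a a m * Gam m b k - Gam a b m * Gam m a k) * X k =
    Gam a a m * (\sum_k Gam m b k * X k) - Gam a b m * (\sum_k Gam m a k * X k).
  rewrite !mulr_sumr -sumrB; apply: eq_bigr => k _; ring.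
ring.
Qed.

(** The left side is the divergence of the field with components [sum_b X^b A^a_b - t X^a], expanded
    by the product rule. *)
Lemma weitzenboeck_algebra :
  \sum_a (\sum_b (X b * dA a b a + A a b * dX b a) - (X a * dt a + t * dX a a)
     + c a * (\sum_b X b * A a b - X a * t)) =
  \sum_b \sum_k Ric b k * X b * X k + \sum_a \sum_b A a b * A b a - t ^+ 2.
Proof.
have s1 : \sum_a \sum_b A a b * dX b a = \sum_a \sum_b A a b * A b a -
    \sum_a \sum_b A a b * \sum_m Gam b a m * X m.
  rewrite -sumrB; apply: eq_bigr => a _; rewrite -sumrB; apply: eq_bigr => b _.
  by rewrite dXE mulrBr.
have s2 : \sum_a t * dX a a = t ^+ 2 - t * \sum_a \sum_m Gam a a m * X m.
  rewrite -mulr_sumr (eq_bigr _ (fun a _ => dXE a a)) sumrB -/t; ring.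
have s3 : \sum_a c a * (X a * t) = t * \sum_a \sum_m Gam a a m * X m.
  rewrite exchange_big mulr_sumr; apply: eq_bigr => m _ /=.
  rewrite -mulr_suml -/(c m); ring.
have s4 : \sum_a \sum_b X b * dA a b a - \sum_a X a * dt a =
    \sum_b X b * \sum_a (dA a b a - dA a a b).
  rewrite exchange_big -sumrB; apply: eq_bigr => b _.
  by rewrite -mulr_sumr -mulrBr; congr (_ * _); rewrite sumrB.
have s5 : \sum_b X b * \sum_a \sum_m Gam a b m * A m a =
    \sum_a \sum_b A a b * \sum_m Gam b a m * X m.
  transitivity (\sum_m \sum_b \sum_a X m * (Gam b m a * A a b)).
    by apply: eq_bigr => m _; rewrite mulr_sumr; apply: eq_bigr => b _; rewrite mulr_sumr.
  rewrite exchange_big /=.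
  under eq_bigr do rewrite exchange_big /=.
  rewrite exchange_big /=; apply: eq_bigr => a _; apply: eq_bigr => b _.
  rewrite mulr_sumr; apply: eq_bigr => m _; rewrite Gam_sym; ring.
have s6 : \sum_b X b * \sum_m c m * A m b = \sum_a c a * \sum_b X b * A a b.
  transitivity (\sum_b \sum_a X b * (c a * A a b)).
    by apply: eq_bigr => b _; rewrite mulr_sumr.
  rewrite exchange_big; apply: eq_bigr => a _; rewrite mulr_sumr.
  by apply: eq_bigr => b _; ring.
transitivity ((\sum_a \sum_b X b * dA a b a - \sum_a X a * dt a)
  + (\sum_a \sum_b A a b * dX b a) - \sum_a t * dX a a
  + (\sum_a c a * \sum_b X b * A a b - \sum_a c a * (X a * t))).
  rewrite -!sumrB -big_split /= -sumrB -big_split /=; apply: eq_bigr => a _.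
  rewrite big_split /= mulrBr; ring.
rewrite s4 (eq_bigr _ (fun b _ => congr1 ( *%R (X b)) (ricci_row b))).
have -> : \sum_b X b * (\sum_k Ric b k * X k + \sum_a \sum_m Gam a b m * A m a
     - \sum_m c m * A m b) =
   \sum_b \sum_k Ric b k * X b * X k + \sum_b X b * \sum_a \sum_m Gam a b m * A m a
   - \sum_b X b * \sum_m c m * A m b.
  rewrite -big_split /= -sumrB; apply: eq_bigr => b _.
  rewrite mulrBr mulrDr; congr (_ + _ - _).
  by rewrite mulr_sumr; apply: eq_bigr => k _; ring.
rewrite s1 s2 s3 s5 s6; ring.
Qed.

End Weitzenboeck.

(** * Closure properties of smooth functions *)

Section SmoothClosure.
Variables (R : realType) (n : nat) (U : set 'rV[R]_n).
Hypothesis oU : open U.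
Implicit Types f h : 'rV[R]_n -> R.

Lemma smooth_onD f h : smooth_on U f -> smooth_on U h -> smooth_on U (fun y => f y + h y).
Proof. by move=> Sf Sh m; exact: CkD. Qed.

Lemma smooth_onB f h : smooth_on U f -> smooth_on U h -> smooth_on U (fun y => f y - h y).
Proof. by move=> Sf Sh m; exact: CkB. Qed.

Lemma smooth_onM f h : smooth_on U f -> smooth_on U h -> smooth_on U (fun y => f y * h y).
Proof. by move=> Sf Sh m; exact: CkM. Qed.

Lemma smooth_on_cst (a : R) : smooth_on U (fun=> a).
Proof. by move=> m; exact: Ck_cst. Qed.

Lemma smooth_on_sum I (r : seq I) (P : pred I) (F : I -> 'rV[R]_n -> R) :
  (forall i, P i -> smooth_on U (F i)) -> smooth_on U (fun y => \sum_(i <- r | P i) F i y).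
Proof. by move=> SF m; apply: Ck_sum => // i Pi; exact: SF. Qed.

Lemma smooth_on_powR f s : (forall y, U y -> 0 < f y) ->
  smooth_on U f -> smooth_on U (fun y => f y `^ s).
Proof. by move=> f0 Sf m; exact: Ck_powR. Qed.

Lemma smooth_on_partial k f : smooth_on U f -> smooth_on U (partial k f).
Proof. by move=> Sf m; exact: (Ck_partial k (Sf m.+1)). Qed.

Lemma eq_smooth_on f h : {in U, f =1 h} -> smooth_on U f -> smooth_on U h.
Proof. by move=> fh Sf m; apply: eq_Ck (Sf m). Qed.

Lemma smooth_on_derivable f y k : smooth_on U f -> U y -> derivable f y (delta_mx ord0 k).
Proof. by move=> Sf Uy; exact: (Ck_derivable (Sf 1%N) Uy). Qed.

Lemma eq_partial_on k f h y : {in U, f =1 h} -> U y -> partial k f y = partial k h y.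
Proof. by move=> fh Uy; apply: near_eq_partial; exact: open_near_eq fh Uy. Qed.

Lemma smooth_on_partial_comm f y a b : smooth_on U f -> U y ->
  partial a (partial b f) y = partial b (partial a f) y.
Proof. by move=> Sf Uy; exact: partial_comm oU (Sf 2%N) Uy. Qed.

Lemma smooth_on_det p (M : 'rV[R]_n -> 'M[R]_p) :
  (forall i j, smooth_on U (fun y => M y i j)) -> smooth_on U (fun y => \det (M y)).
Proof.
move=> SM m; apply: Ck_sum => // s _; apply: CkM => //; first exact: Ck_cst.
by apply: Ck_prod => // i _; exact: SM.
Qed.

(** Cramer's rule; the reciprocal of the determinant is written as a real power, positive
    definiteness making its base positive. *)
Lemma smooth_on_inv p (M : 'rV[R]_n -> 'M[R]_p) i j :
  (forall i j, smooth_on U (fun y => M y i j)) -> (forall y, U y -> posdef (M y)) ->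
  smooth_on U (fun y => invmx (M y) i j).
Proof.
move=> SM Mp.
apply: (@eq_smooth_on (fun y => \det (M y) `^ (-1) * ((-1) ^+ (j + i) *
    \det (row' j (col' i (M y)))))).
  move=> y; rewrite inE => Uy; have dM := posdef_det (Mp y Uy).
  rewrite /invmx (posdef_unit (Mp y Uy)) !mxE /cofactor.
  by rewrite powR_inv1 // ltW.
apply: smooth_onM; last first.
  apply: smooth_onM; first exact: smooth_on_cst.
  apply: smooth_on_det => i' j'.
  by under eq_fun do rewrite !mxE; exact: SM.
apply: smooth_on_powR; last exact: smooth_on_det.
by move=> y Uy; exact/posdef_det/Mp.
Qed.

End SmoothClosure.

(** * Derivatives of matrix fields *)

Section MatrixDerivative.
Variables (R : realType) (n : nat).

Definition dmx p q (k : 'I_n) (F : 'rV[R]_n -> 'M[R]_(p, q)) (y : 'rV[R]_n) : 'M[R]_(p, q) :=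
  \matrix_(i, j) partial k (fun z => F z i j) y.

Definition mx_derivable p q (k : 'I_n) (F : 'rV[R]_n -> 'M[R]_(p, q)) (y : 'rV[R]_n) :=
  forall i j, derivable (fun z => F z i j) y (delta_mx ord0 k).

Lemma partialZ (a : R) (f : 'rV[R]_n -> R) k y : derivable f y (delta_mx ord0 k) ->
  derivable (fun z => a * f z) y (delta_mx ord0 k) /\
  partial k (fun z => a * f z) y = a * partial k f y.
Proof.
move=> df; have da : derivable (fun=> a : R) y (delta_mx ord0 k) by exact: derivable_cst.
split; first exact: (derivableM da df).
by rewrite (partialM da df) partial_cst mulr0 addr0.
Qed.

Lemma dmx_mul p q r k (F : 'rV[R]_n -> 'M[R]_(p, q)) (K : 'rV[R]_n -> 'M[R]_(q, r)) y :
  mx_derivable k F y -> mx_derivable k K y ->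
  mx_derivable k (fun z => F z *m K z) y /\
  dmx k (fun z => F z *m K z) y = dmx k F y *m K y + F y *m dmx k K y.
Proof.
move=> dF dK.
have dsum i j := @partial_sum R n _ (index_enum 'I_q) xpredT
  (fun l z => F z i l * K z l j) k y (fun l _ => derivableM (dF i l) (dK l j)).
have E i j : (fun z => (F z *m K z) i j) = (fun z => \sum_l F z i l * K z l j).
  by apply/funext => z; rewrite mxE.
split; first by move=> i j; rewrite E; exact: (dsum i j).1.
apply/matrixP => i j; rewrite !mxE E (dsum i j).2 -big_split /=.
by apply: eq_bigr => l _; rewrite partialM // !mxE [RHS]addrC [X in _ + X]mulrC.
Qed.

Lemma partial_prod (I : eqType) (r : seq I) (F : I -> 'rV[R]_n -> R) k y : uniq r ->
  (forall i, derivable (F i) y (delta_mx ord0 k)) ->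
  derivable (fun z => \prod_(i <- r) F i z) y (delta_mx ord0 k) /\
  partial k (fun z => \prod_(i <- r) F i z) y =
    \sum_(j <- r) partial k (F j) y * \prod_(i <- r | i != j) F i y.
Proof.
move=> + dF; elim: r => [|a r IHr].
  move=> _; rewrite big_nil; under eq_fun do rewrite big_nil.
  by split; [exact: derivable_cst|exact: partial_cst].
rewrite cons_uniq => /andP[ar /IHr[IH1 IH2]].
under eq_fun do rewrite big_cons.
split; first exact: (derivableM (dF a) IH1).
rewrite (partialM (dF a) IH1) IH2 !big_cons eqxx /= addrC mulrC; congr (_ * _ + _).
  rewrite big_seq_cond [RHS]big_seq_cond; apply: eq_bigl => i.
  by rewrite andbT; case ir : (i \in r) => //=; apply/esym; apply: contraNneq ar => <-.
rewrite mulr_sumr; apply: eq_big_seq => j jr.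
rewrite big_cons ifT; last by apply: contraNneq ar => ->.
by rewrite mulrCA.
Qed.

(** Jacobi's formula: in the derivative of the Leibniz expansion, the terms where row [j] is
    differentiated add up to a determinant with that row replaced. *)
Lemma partial_det p k (F : 'rV[R]_n -> 'M[R]_p) y : mx_derivable k F y ->
  derivable (fun z => \det (F z)) y (delta_mx ord0 k) /\
  partial k (fun z => \det (F z)) y = \tr (\adj (F y) *m dmx k F y).
Proof.
move=> dF.
have dprod (s : {perm 'I_p}) := @partial_prod _ (index_enum 'I_p) (fun i z => F z i (s i)) k y
  (index_enum_uniq _) (fun i => dF i (s i)).
have dterm (s : {perm 'I_p}) : derivable (fun z => (-1) ^+ s * \prod_i F z i (s i)) y (delta_mx ord0 k)
    /\ partial k (fun z => (-1) ^+ s * \prod_i F z i (s i)) y =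
       \sum_j (-1) ^+ s * (dmx k F y j (s j) * \prod_(i | i != j) F y i (s i)).
  have [d1 d2] := dprod s; have [d3 d4] := partialZ ((-1) ^+ s) d1.
  split; first exact: d3.
  rewrite [LHS]d4 d2 mulr_sumr.
  by apply: eq_bigr => j _; rewrite mxE.
have [d1 d2] := @partial_sum R n _ (index_enum {perm 'I_p}) xpredT _ k y (fun s _ => (dterm s).1).
split; first exact: d1.
rewrite [LHS]d2 (eq_bigr _ (fun s _ => (dterm s).2)) exchange_big /=.
rewrite mxtrace_mulC /mxtrace; apply: eq_bigr => j _.
(* Expanded along row [j], this determinant has the cofactors of [F y], since the other rows are
   unchanged. *)
pose Mj : 'M[R]_p := \matrix_(i, l) if i == j then dmx k F y j l else F y i l.
transitivity (\det Mj).
  apply: eq_bigr => s _; congr (_ * _); rewrite [RHS](bigD1 j) //= [Mj _ _]mxE eqxx.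
  by congr (_ * _); apply: eq_bigr => i ij; rewrite mxE (negbTE ij).
rewrite (expand_det_row _ j) [RHS]mxE; apply: eq_bigr => l _.
rewrite [Mj _ _]mxE eqxx [X in _ = _ * X]mxE; congr (_ * (_ * \det _)).
apply/matrixP => i' j'; have ji' : lift j i' != j by rewrite eq_sym neq_lift.
by rewrite !mxE (negbTE ji').
Qed.

End MatrixDerivative.

(** * Connection, Hessian and divergence in coordinates *)

Section LocalGeometryTheory.
Variables (R : realType) (n : nat) (U : set 'rV[R]_n) (G : 'rV[R]_n -> 'M[R]_n).
Hypothesis oU : open U.
Hypothesis Gs : forall a b, smooth_on U (fun y => G y a b).
Hypothesis Gp : forall y, U y -> posdef (G y).
Implicit Types (f h p q : 'rV[R]_n -> R) (y : 'rV[R]_n).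

Let H y := invmx (G y).
(** The connection matrix in direction [k]. The covariant derivative adds [Z *m (Gam k y)^T] for a
    vector field [Z] and subtracts [p *m Gam k y] for a covector field [p]. *)
Definition Gam k y : 'M[R]_n := \matrix_(a, m) christoffel G a k m y.
Definition drow p y : 'rV[R]_n := \row_a partial a p y.
Definition lgrad p y : 'rV[R]_n := drow p y *m invmx (G y).
(** The logarithmic derivative of the volume density, as [partial_sqrt_det] shows. *)
Definition ctrace a y : R := \sum_m christoffel G m m a y.

Let Hs a b : smooth_on U (fun y => H y a b).
Proof. exact: smooth_on_inv. Qed.

Lemma metric_symE y : U y -> (G y)^T = G y.
Proof. by move=> /Gp[]. Qed.

Lemma inv_metric_sym y : U y -> (invmx (G y))^T = invmx (G y).
Proof. by move=> Uy; rewrite trmx_inv metric_symE. Qed.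

Lemma partial_metric_sym k a b y : U y ->
  partial k (fun z => G z a b) y = partial k (fun z => G z b a) y.
Proof.
move=> Uy; apply: (eq_partial_on oU k _ Uy) => z; rewrite inE => Uz.
by rewrite -[in LHS](metric_symE Uz) mxE.
Qed.

Lemma christoffel_sym k a b y : U y -> christoffel G k a b y = christoffel G k b a y.
Proof.
move=> Uy; congr (_ * _); apply: eq_bigr => l _; congr (_ * (_ - _)).
  by rewrite addrC.
exact: partial_metric_sym.
Qed.

Lemma christoffel_smooth k a b : smooth_on U (christoffel G k a b).
Proof.
apply: smooth_onM => //; first exact: smooth_on_cst.
apply: smooth_on_sum => // l _; apply: smooth_onM => //.
by apply: smooth_onB => //; [apply: smooth_onD => //|]; apply: smooth_on_partial.
Qed.

Lemma drow_smooth p a : smooth_on U p -> smooth_on U (fun y => drow p y ord0 a).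
Proof. by move=> Sp; under eq_fun do rewrite mxE; exact: smooth_on_partial. Qed.

Lemma lgrad_smooth p a : smooth_on U p -> smooth_on U (fun y => lgrad p y ord0 a).
Proof.
move=> Sp; under eq_fun do rewrite mxE; apply: smooth_on_sum => // b _.
by apply: smooth_onM => //; exact: drow_smooth.
Qed.

Lemma hess_smooth p a b : smooth_on U p -> smooth_on U (fun y => local_hess G p y a b).
Proof.
move=> Sp; under eq_fun do rewrite mxE; apply: smooth_onB => //.
  exact/smooth_on_partial/smooth_on_partial.
apply: smooth_on_sum => // k _; apply: smooth_onM => //.
  exact: christoffel_smooth.
exact: smooth_on_partial.
Qed.

Lemma laplacian_smooth p : smooth_on U p -> smooth_on U (local_laplacian G p).
Proof.
move=> Sp; rewrite /local_laplacian /mxtrace; apply: smooth_on_sum => // a _.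
under eq_fun do rewrite mxE; apply: smooth_on_sum => // b _.
by apply: smooth_onM => //; exact: hess_smooth.
Qed.

Lemma dprod_smooth p q : smooth_on U p -> smooth_on U q -> smooth_on U (local_dprod G p q).
Proof.
move=> Sp Sq; apply: smooth_on_sum => // a _; apply: smooth_on_sum => // b _.
apply: smooth_onM => //; last exact: smooth_on_partial.
by apply: smooth_onM => //; exact: smooth_on_partial.
Qed.

Lemma local_dprodE p q y : local_dprod G p q y = \sum_b lgrad p y ord0 b * partial b q y.
Proof.
rewrite /local_dprod exchange_big; apply: eq_bigr => b _ /=.
rewrite mxE mulr_suml; apply: eq_bigr => a _.
by rewrite mxE [invmx _ _ _ * _]mulrC.
Qed.

Lemma local_dprod_mx p q y :
  local_dprod G p q y = (drow p y *m invmx (G y) *m (drow q y)^T) ord0 ord0.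
Proof. by rewrite local_dprodE mxE; apply: eq_bigr => b _; rewrite !mxE. Qed.

Lemma local_dprodC p q y : U y -> local_dprod G p q y = local_dprod G q p y.
Proof.
move=> Uy; rewrite !local_dprod_mx.
rewrite -[in RHS](trmxK (drow q y *m _ *m _)) [in RHS]mxE.
by rewrite !trmx_mul trmxK inv_metric_sym // mulmxA.
Qed.

Lemma lgrad_quad p y : U y -> quad (G y) (lgrad p y) = local_dprod G p p y.
Proof.
move=> Uy; rewrite /quad /lgrad mulmxKV ?(posdef_unit (Gp Uy)) //.
by rewrite trmx_mul inv_metric_sym // mulmxA local_dprod_mx.
Qed.

Lemma hess_sym p y : smooth_on U p -> U y -> (local_hess G p y)^T = local_hess G p y.
Proof.
move=> Sp Uy; apply/matrixP => a b; rewrite !mxE.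
rewrite (smooth_on_partial_comm oU b a Sp Uy); congr (_ - _).
by apply: eq_bigr => k _; rewrite christoffel_sym.
Qed.

Lemma G_mx_derivable k y : U y -> mx_derivable k G y.
Proof. by move=> Uy a b; exact: smooth_on_derivable (Gs a b) Uy. Qed.

Lemma H_mx_derivable k y : U y -> mx_derivable k H y.
Proof. by move=> Uy a b; exact: smooth_on_derivable (Hs a b) Uy. Qed.

(** Lowering the upper index cancels the inverse metric and leaves the symbols of the first kind. *)
Lemma christoffel_lower k c b y : U y -> (G y *m Gam k y) c b =
  2^-1 * (partial k (fun z => G z b c) y + partial b (fun z => G z k c) y
    - partial c (fun z => G z k b) y).
Proof.
move=> Uy; rewrite mxE.
pose S l := partial k (fun z => G z b l) y + partial b (fun z => G z k l) y
    - partial l (fun z => G z k b) y.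
transitivity (2^-1 * \sum_l (G y *m H y) c l * S l); last first.
  rewrite mulmxV ?(posdef_unit (Gp Uy)) // (bigD1 c) //= big1.
    by rewrite mxE eqxx mul1r addr0.
  by move=> l lc; rewrite mxE eq_sym (negbTE lc) mul0r.
rewrite mulr_sumr; under [RHS]eq_bigr => l _ do rewrite mxE mulr_suml mulr_sumr.
rewrite exchange_big /=; apply: eq_bigr => a _.
rewrite mxE /christoffel mulrCA !mulr_sumr.
by apply: eq_bigr => l _; rewrite -/(S l) !mulrA.
Qed.

(** The connection preserves the metric: adding the two symbols of the first kind cancels the
    derivatives along [b] and [c] and doubles the one along [k]. *)
Lemma metric_compat k y : U y -> dmx k G y = G y *m Gam k y + (G y *m Gam k y)^T.
Proof.
move=> Uy; apply/matrixP => c b; rewrite [LHS]mxE [RHS]mxE [X in _ + X]mxE.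
rewrite !christoffel_lower // (partial_metric_sym k b c) //.
by move: (partial k _ y) (partial b _ y) (partial c _ y) => D1 D2 D3; field.
Qed.

Lemma inv_metric_compat k y : U y ->
  dmx k H y = - (Gam k y *m H y + H y *m (Gam k y)^T).
Proof.
move=> Uy; have Gu := posdef_unit (Gp Uy).
have [_] := dmx_mul (G_mx_derivable (k:=k) Uy) (H_mx_derivable (k:=k) Uy).
have -> : dmx k (fun z => G z *m H z) y = 0.
  apply/matrixP => a b; rewrite [LHS]mxE mxE.
  rewrite (@eq_partial_on _ _ _ oU k _ (fun=> (1%:M : 'M[R]_n) a b)) ?partial_cst //.
  by move=> z; rewrite inE => Uz; rewrite mulmxV // (posdef_unit (Gp Uz)).
move=> /esym/eqP; rewrite addrC addr_eq0 => /eqP/(congr1 (mulmx (H y))).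
rewrite mulmxA mulVmx // mul1mx metric_compat // => ->.
rewrite mulmxN; congr (- _); rewrite mulmxDl mulmxDr !mulmxA mulVmx // mul1mx.
congr (_ + _); rewrite trmx_mul metric_symE // !mulmxA.
by rewrite -(mulmxA (H y *m _)) mulmxV // mulmx1.
Qed.

Lemma drow_mx_derivable k p y : smooth_on U p -> U y -> mx_derivable k (drow p) y.
Proof.
by move=> Sp Uy i a; rewrite ord1; exact: smooth_on_derivable (drow_smooth a Sp) Uy.
Qed.

Lemma drow_covariant k p y : dmx k (drow p) y - drow p y *m Gam k y = row k (local_hess G p y).
Proof.
apply/rowP => a.
have E : (fun z => drow p z ord0 a) = partial a p by apply/funext => z; rewrite mxE.
rewrite [LHS]mxE [X in X + _]mxE E [RHS]mxE [RHS]mxE; congr (_ + _).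
rewrite mxE mxE; congr (- _).
by apply: eq_bigr => m _; rewrite !mxE mulrC.
Qed.

Lemma lgrad_mx_derivable k p y : smooth_on U p -> U y -> mx_derivable k (lgrad p) y.
Proof.
move=> Sp Uy; apply: (dmx_mul _ _).1; first exact: drow_mx_derivable.
exact: H_mx_derivable.
Qed.

Lemma dmx_lgrad k p y : smooth_on U p -> U y ->
  dmx k (lgrad p) y = row k (local_hess G p y) *m invmx (G y) - lgrad p y *m (Gam k y)^T.
Proof.
move=> Sp Uy.
have [_ ->] := dmx_mul (drow_mx_derivable (k:=k) Sp Uy) (H_mx_derivable (k:=k) Uy).
rewrite inv_metric_compat // -drow_covariant mulmxBl mulmxN mulmxDr opprD addrA.
by rewrite !mulmxA.
Qed.

(** The metric being parallel, raising an index of the Hessian gives the covariant derivative of the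
    gradient. *)
Lemma partial_lgrad k p y a : smooth_on U p -> U y ->
  partial k (fun z => lgrad p z ord0 a) y + \sum_m christoffel G a k m y * lgrad p y ord0 m =
  (invmx (G y) *m local_hess G p y) a k.
Proof.
move=> Sp Uy; have /rowP/(_ a) := dmx_lgrad k Sp Uy.
rewrite [LHS]mxE => ->; rewrite [X in X + _]mxE [X in _ + X + _]mxE.
rewrite (_ : \sum_m _ = (lgrad p y *m (Gam k y)^T) ord0 a); last first.
  by rewrite [RHS]mxE; apply: eq_bigr => m _; rewrite !mxE mulrC.
rewrite subrK -row_mul mxE -[in LHS](trmxK (_ *m _)) mxE trmx_mul.
by rewrite hess_sym // inv_metric_sym.
Qed.

(** The connection terms of the gradient of [p] and of the differential of [q] are opposite. *)
Lemma partial_dprod k p q y : smooth_on U p -> smooth_on U q -> U y ->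
  partial k (local_dprod G p q) y =
  \sum_a local_hess G p y k a * lgrad q y ord0 a +
  \sum_a local_hess G q y k a * lgrad p y ord0 a.
Proof.
move=> Sp Sq Uy.
have dq : mx_derivable k (fun z => (drow q z)^T) y.
  by move=> i j; under eq_fun do rewrite mxE; exact: drow_mx_derivable.
have [_ /matrixP/(_ ord0 ord0)] := dmx_mul (lgrad_mx_derivable (k:=k) Sp Uy) dq.
rewrite [LHS]mxE.
rewrite -(_ : local_dprod G p q = fun z => (lgrad p z *m (drow q z)^T) ord0 ord0); last first.
  by apply/funext => z; rewrite local_dprod_mx.
move=> ->.
have -> : dmx k (fun z => (drow q z)^T) y = (row k (local_hess G q y))^T
    + (Gam k y)^T *m (drow q y)^T.
  rewrite -trmx_mul -linearD /= -drow_covariant subrK.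
  by apply/matrixP => i j; rewrite !mxE; congr (partial _ _ _); apply/funext => z; rewrite mxE.
have cancel_mid (u v w : 'M[R]_1) : u - w + (v + w) = u + v.
  by rewrite addrACA addNr addr0.
rewrite dmx_lgrad // mulmxBl mulmxDr !mulmxA cancel_mid mxE; congr (_ + _).
  rewrite -mulmxA (_ : invmx (G y) *m (drow q y)^T = (lgrad q y)^T); last first.
    by rewrite trmx_mul inv_metric_sym.
  by rewrite mxE; apply: eq_bigr => a _; rewrite !mxE.
by rewrite mxE; apply: eq_bigr => a _; rewrite !mxE mulrC.
Qed.

(** The Riemannian divergence, in the form that needs the symbols only through their trace. *)
Definition ldiv (Z : 'rV[R]_n -> 'rV[R]_n) y : R :=
  \sum_a (partial a (fun z => Z z ord0 a) y + ctrace a y * Z y ord0 a).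

Lemma ldiv_grad p y : smooth_on U p -> U y -> ldiv (lgrad p) y = local_laplacian G p y.
Proof.
move=> Sp Uy; rewrite /ldiv /local_laplacian /mxtrace.
rewrite -(eq_bigr _ (fun a _ => partial_lgrad a a Sp Uy)) !big_split /=; congr (_ + _).
rewrite exchange_big; apply: eq_bigr => a _ /=.
rewrite mulr_suml; apply: eq_bigr => m _.
by rewrite christoffel_sym // [X in _ = X * _]christoffel_sym.
Qed.

Lemma ldiv_scale q (Z : 'rV[R]_n -> 'rV[R]_n) y : smooth_on U q ->
  (forall a, smooth_on U (fun y => Z y ord0 a)) -> U y ->
  ldiv (fun z => q z *: Z z) y = q y * ldiv Z y + \sum_a Z y ord0 a * partial a q y.
Proof.
move=> Sq SZ Uy; rewrite /ldiv mulr_sumr -big_split /=; apply: eq_bigr => a _.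
under eq_fun do rewrite mxE.
rewrite partialM; [|exact: smooth_on_derivable Sq Uy|exact: smooth_on_derivable (SZ a) Uy].
rewrite mxE; ring.
Qed.

Lemma ldivB (Z T : 'rV[R]_n -> 'rV[R]_n) y :
  (forall a, smooth_on U (fun y => Z y ord0 a)) ->
  (forall a, smooth_on U (fun y => T y ord0 a)) -> U y ->
  ldiv (fun z => Z z - T z) y = ldiv Z y - ldiv T y.
Proof.
move=> SZ ST Uy; rewrite /ldiv -sumrB; apply: eq_bigr => a _.
have -> : (fun z => (Z z - T z) ord0 a) = (fun z => Z z ord0 a - T z ord0 a).
  by apply/funext => z; rewrite !mxE.
rewrite partialB; [|exact: smooth_on_derivable (SZ a) Uy|exact: smooth_on_derivable (ST a) Uy].
rewrite !mxE; ring.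
Qed.

Lemma eq_ldiv (Z T : 'rV[R]_n -> 'rV[R]_n) y : {in U, Z =1 T} -> U y -> ldiv Z y = ldiv T y.
Proof.
move=> ZT Uy; apply: eq_bigr => a _; rewrite ZT ?inE //; congr (_ + _).
by apply: (eq_partial_on oU a _ Uy) => z zU; rewrite ZT.
Qed.

Lemma ldiv_scale_grad q p y : smooth_on U q -> smooth_on U p -> U y ->
  ldiv (fun z => q z *: lgrad p z) y = q y * local_laplacian G p y + local_dprod G q p y.
Proof.
move=> Sq Sp Uy; rewrite ldiv_scale //; last by move=> a; exact: lgrad_smooth.
by rewrite ldiv_grad // local_dprodC // local_dprodE.
Qed.

Lemma sqrt_det_smooth : smooth_on U (fun y => Num.sqrt (\det (G y))).
Proof.
apply: (@eq_smooth_on _ _ _ oU (fun y => \det (G y) `^ (2^-1))).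
  by move=> y; rewrite inE => Uy; rewrite powR12_sqrt // ltW // posdef_det //; exact: Gp.
apply: smooth_on_powR => //; last exact: smooth_on_det.
by move=> y Uy; exact/posdef_det/Gp.
Qed.

(** By Jacobi's formula the derivative involves the trace of [invmx (G y) *m dmx k G y], which
    metric compatibility makes twice the trace of [Gam k y]. *)
Lemma partial_sqrt_det k y : U y ->
  partial k (fun z => Num.sqrt (\det (G z))) y = Num.sqrt (\det (G y)) * ctrace k y.
Proof.
move=> Uy; have d0 := posdef_det (Gp Uy).
rewrite -(@eq_partial_on _ _ _ oU k (fun y => \det (G y) `^ (2^-1))) //; last first.
  by move=> z; rewrite inE => Uz; rewrite powR12_sqrt // ltW // posdef_det //; exact: Gp.
have [dd ddE] := partial_det (G_mx_derivable (k:=k) Uy).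
have [_ ->] := derivable_powR_comp (2^-1) d0 dd.
rewrite ddE powRB; last by apply/implyP => _; rewrite gt_eqF.
rewrite powR12_sqrt ?(ltW d0) // powRr1 ?(ltW d0) //.
have -> : \adj (G y) = \det (G y) *: H y.
  by rewrite /H /invmx (posdef_unit (Gp Uy)) scalerA divff ?gt_eqF // scale1r.
rewrite -scalemxAl linearZ /= metric_compat // mulmxDr linearD /=.
rewrite mulmxA mulVmx ?(posdef_unit (Gp Uy)) // mul1mx trmx_mul metric_symE //.
rewrite [\tr (H y *m _)]mxtrace_mulC -mulmxA mulmxV ?(posdef_unit (Gp Uy)) // mulmx1.
rewrite mxtrace_tr (_ : \tr (Gam k y) = ctrace k y); last first.
  by apply: eq_bigr => m _; rewrite mxE christoffel_sym.
by field; rewrite gt_eqF.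
Qed.

(** Against the volume density a divergence is a sum of plain partial derivatives; this is what
    allows integration by parts in a chart. *)
Lemma sqrt_det_ldiv (Z : 'rV[R]_n -> 'rV[R]_n) y :
  (forall a, derivable (fun y => Z y ord0 a) y (delta_mx ord0 a)) -> U y ->
  \sum_a partial a (fun z => Num.sqrt (\det (G z)) * Z z ord0 a) y =
  Num.sqrt (\det (G y)) * ldiv Z y.
Proof.
move=> dZ Uy; rewrite mulr_sumr; apply: eq_bigr => a _.
rewrite partialM //; last exact: smooth_on_derivable sqrt_det_smooth Uy.
rewrite partial_sqrt_det //; ring.
Qed.

End LocalGeometryTheory.

(** * Bochner's formula and the divergence identity *)

Section Bochner.
Variables (R : realType) (n : nat) (U : set 'rV[R]_n) (G : 'rV[R]_n -> 'M[R]_n).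
Hypothesis oU : open U.
Hypothesis Gs : forall a b, smooth_on U (fun y => G y a b).
Hypothesis Gp : forall y, U y -> posdef (G y).
Implicit Types (f h p q w : 'rV[R]_n -> R) (y : 'rV[R]_n).

Let gs p a : smooth_on U p -> smooth_on U (fun y => lgrad G p y ord0 a).
Proof. exact: lgrad_smooth. Qed.

Let ims y : U y -> (invmx (G y))^T = invmx (G y) := @inv_metric_sym _ _ _ _ Gp y.

Let pdp k p q y (Sp : smooth_on U p) (Sq : smooth_on U q) (Uy : U y) :=
  partial_dprod oU Gs Gp k Sp Sq Uy.

Let dpC p q y (Uy : U y) := local_dprodC Gp p q Uy.

Let chs k a b : smooth_on U (christoffel G k a b).
Proof. exact: christoffel_smooth. Qed.

Definition ltheta q p y : R := q y * local_laplacian G p y + local_dprod G q p y.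

Definition grad_endo p y : 'M[R]_n := invmx (G y) *m local_hess G p y.

Lemma local_laplacian_endo p y : local_laplacian G p y = \tr (grad_endo p y).
Proof. by []. Qed.

Lemma lgrad_dprod p y : smooth_on U p -> U y ->
  2^-1 *: lgrad G (local_dprod G p p) y = lgrad G p y *m (grad_endo p y)^T.
Proof.
move=> Sp Uy; rewrite trmx_mul ims // mulmxA /lgrad scalemxAl.
congr (_ *m _); apply/rowP => a; rewrite !mxE pdp //.
have half (x : R) : 2^-1 * (x + x) = x by field.
rewrite half.
by apply: eq_bigr => b _; rewrite [RHS]mulrC [X in _ = X * _]mxE.
Qed.

(** The left side is the divergence of half the gradient of [|dp|^2] minus the Laplacian times the
    gradient of [p], which is the field treated by [weitzenboeck_algebra] for [X] the gradient. The
    squared Laplacian stays on both sides to keep the left one a divergence. *)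
Lemma bochner p y : smooth_on U p -> U y ->
  2^-1 * local_laplacian G (local_dprod G p p) y
    - local_dprod G (local_laplacian G p) p y - local_laplacian G p y ^+ 2 =
  quad (local_ricci G y) (lgrad G p y) + \tr (grad_endo p y *m grad_endo p y)
    - local_laplacian G p y ^+ 2.
Proof.
move=> Sp Uy.
pose X a z := lgrad G p z ord0 a.
have SX a : smooth_on U (X a) by exact: gs.
have Su : smooth_on U (local_dprod G p p) by exact: dprod_smooth.
have SL : smooth_on U (local_laplacian G p) by exact: laplacian_smooth.
pose A (a b : 'I_n) z := partial b (X a) z + \sum_m christoffel G a b m z * X m z.
have AE a b z : U z -> A a b z = grad_endo p z a b.
  by move=> Uz; rewrite /A (partial_lgrad oU Gs Gp).
have SA a b : smooth_on U (A a b).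
  apply: smooth_onD => //; first exact: smooth_on_partial.
  by apply: smooth_on_sum => // m _; exact: smooth_onM.
pose t z := \sum_a A a a z.
have tE z : U z -> t z = local_laplacian G p z.
  by move=> Uz; apply: eq_bigr => a _; rewrite AE.
have St : smooth_on U t by exact: smooth_on_sum.
pose Z z : 'rV[R]_n := \row_a (\sum_b X b z * A a b z - X a z * t z).
have divZ : ldiv G Z y = 2^-1 * local_laplacian G (local_dprod G p p) y
    - (local_laplacian G p y * local_laplacian G p y
       + local_dprod G (local_laplacian G p) p y).
  rewrite -(ldiv_scale_grad oU Gs Gp SL Sp Uy).
  rewrite -[X in _ * X](ldiv_grad oU Gs Gp Su Uy).
  have Sg a : smooth_on U (fun z => (2^-1 *: lgrad G (local_dprod G p p) z) ord0 a).
    under eq_fun do rewrite mxE; apply: smooth_onM => //; first exact: smooth_on_cst.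
    exact: gs.
  have Sg' a : smooth_on U (fun z => (local_laplacian G p z *: lgrad G p z) ord0 a).
    by under eq_fun do rewrite mxE; apply: smooth_onM => //; exact: gs.
  have -> : 2^-1 * ldiv G (lgrad G (local_dprod G p p)) y =
      ldiv G (fun z => 2^-1 *: lgrad G (local_dprod G p p) z) y.
    have S2 : smooth_on U (fun=> 2^-1 : R) by exact: smooth_on_cst.
    rewrite (ldiv_scale G S2) //; last by move=> a; exact: gs.
    by rewrite big1 ?addr0 // => a _; rewrite partial_cst mulr0.
  rewrite -(ldivB G Sg Sg') //; apply: (eq_ldiv G oU _ Uy) => z; rewrite inE => Uz.
  rewrite lgrad_dprod //; apply/rowP => a; rewrite !mxE tE // [X in _ - X]mulrC; congr (_ - _); last by rewrite /X [in LHS]mxE.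
  by apply: eq_bigr => b _; rewrite [X in _ = _ * X]mxE AE.
have dp (f : 'rV[R]_n -> R) k : smooth_on U f -> derivable f y (delta_mx ord0 k).
  by move=> Sf; exact: smooth_on_derivable Sf Uy.
pose dA (a b d : 'I_n) := partial d (partial b (X a)) y +
  \sum_m (christoffel G a b m y * partial d (X m) y
    + X m y * partial d (christoffel G a b m) y).
have dAE a b d : partial d (A a b) y = dA a b d.
  rewrite partialD; last 2 first.
  - exact/dp/smooth_on_partial.
  - by apply/dp/smooth_on_sum => // m _; exact: smooth_onM.
  congr (_ + _).
  rewrite (partial_sum _ _).2; last by move=> m _; apply/dp; exact: smooth_onM.
  by apply: eq_bigr => m _; rewrite partialM //; exact: dp.
have dtE d : partial d t y = \sum_a dA a a d.
  rewrite (partial_sum _ _).2; last by move=> m _; exact: dp.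
  by apply: eq_bigr => a _.
have dZ a : partial a (fun z => Z z ord0 a) y =
    \sum_b (X b y * dA a b a + A a b y * partial a (X b) y)
    - (X a y * \sum_d dA d d a + t y * partial a (X a) y).
  under eq_fun do rewrite mxE.
  rewrite partialB; last 2 first.
  - by apply/dp/smooth_on_sum => // b _; exact: smooth_onM.
  - by apply/dp; exact: smooth_onM.
  congr (_ - _); last by rewrite partialM ?dtE //; exact: dp.
  rewrite (partial_sum _ _).2; last by move=> m _; apply/dp; exact: smooth_onM.
  by apply: eq_bigr => b _; rewrite partialM ?dAE //; exact: dp.
have ddX_sym a b c : partial c (partial b (X a)) y = partial b (partial c (X a)) y.
  exact: (smooth_on_partial_comm oU c b (SX a) Uy).
have Gam_sym a b c : christoffel G a b c y = christoffel G a c b y.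
  exact: (christoffel_sym oU Gp).
have W := @weitzenboeck_algebra R n (X ^~ y) (fun a b => partial b (X a) y)
  (fun a b c => partial c (partial b (X a)) y) (fun a b c => christoffel G a b c y)
  (fun a b c d => partial d (christoffel G a b c) y) ddX_sym Gam_sym.
have -> : 2^-1 * local_laplacian G (local_dprod G p p) y
    - local_dprod G (local_laplacian G p) p y - local_laplacian G p y ^+ 2 = ldiv G Z y.
  by rewrite divZ -expr2 opprD [- (_ ^+ 2) + _]addrC addrA.
transitivity (\sum_a
  (\sum_b (X b y * dA a b a + A a b y * partial a (X b) y)
    - (X a y * \sum_d dA d d a + t y * partial a (X a) y)
   + ctrace G a y * (\sum_b X b y * A a b y - X a y * t y))).
  by apply: eq_bigr => a _; rewrite dZ mxE.
rewrite [LHS]W.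
rewrite -tE //; congr (_ + _ - _).
- rewrite /quad mxE exchange_big /=; apply: eq_bigr => k _.
  rewrite [X in _ = X * _]mxE mulr_suml; apply: eq_bigr => b _.
  rewrite [local_ricci _ _ _ _]mxE [X in _ = _ * X]mxE -/(X k y) -/(X b y).
  by rewrite [X b y * _]mulrC.
- rewrite /mxtrace; apply: eq_bigr => a _; rewrite mxE; apply: eq_bigr => b _.
  by rewrite -!AE.
Qed.

Lemma bochner_laplacian p y : smooth_on U p -> U y ->
  2^-1 * local_laplacian G (local_dprod G p p) y =
  local_dprod G (local_laplacian G p) p y
  + quad (local_ricci G y) (lgrad G p y) + \tr (grad_endo p y *m grad_endo p y).
Proof.
move=> Sp Uy; have := bochner Sp Uy.
move: (2^-1 * _) (local_dprod _ _ _ _) (_ ^+ 2) (quad _ _) (\tr _) => a b c d e.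
by move=> /eqP; rewrite -subr_eq0 => /eqP E; apply/eqP; rewrite -subr_eq0 -E; apply/eqP; ring.
Qed.

Lemma dprod_mull p q f y : smooth_on U p -> smooth_on U q -> U y ->
  local_dprod G (fun z => p z * q z) f y =
  p y * local_dprod G q f y + q y * local_dprod G p f y.
Proof.
move=> Sp Sq Uy; rewrite /local_dprod !mulr_sumr -big_split; apply: eq_bigr => a _ /=.
rewrite !mulr_sumr -big_split; apply: eq_bigr => b _ /=.
rewrite partialM; [|exact: smooth_on_derivable Sp Uy|exact: smooth_on_derivable Sq Uy].
ring.
Qed.

Lemma dprod_powR w s f y : smooth_on U w -> U y -> 0 < w y ->
  local_dprod G (fun z => w z `^ s) f y = s * w y `^ (s - 1) * local_dprod G w f y.
Proof.
move=> Sw Uy w0; rewrite /local_dprod !mulr_sumr; apply: eq_bigr => a _.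
rewrite !mulr_sumr; apply: eq_bigr => b _.
have [_ ->] := derivable_powR_comp s w0 (smooth_on_derivable (k := a) Sw Uy).
ring.
Qed.

Definition hess_form p y (u v : 'rV[R]_n) : R :=
  \sum_k \sum_a local_hess G p y k a * u ord0 k * v ord0 a.

Lemma hess_form_quad p y u : hess_form p y u u = quad (local_hess G p y) u.
Proof.
rewrite /quad mxE /hess_form exchange_big; apply: eq_bigr => a _ /=.
rewrite mxE mulr_suml; apply: eq_bigr => k _.
by rewrite !mxE [_ * u ord0 k]mulrC.
Qed.

Lemma dprod_dprod p q f y : smooth_on U p -> smooth_on U q -> U y ->
  local_dprod G (local_dprod G p q) f y =
  hess_form p y (lgrad G f y) (lgrad G q y) + hess_form q y (lgrad G f y) (lgrad G p y).
Proof.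
move=> Sp Sq Uy; rewrite dpC // local_dprodE /hess_form -big_split /=.
apply: eq_bigr => k _; rewrite pdp // mulrDr !mulr_sumr.
by congr (_ + _); apply: eq_bigr => a _; rewrite mulrA [lgrad _ _ _ _ _ * _]mulrC.
Qed.

Lemma hess_formC p y u v : smooth_on U p -> U y -> hess_form p y u v = hess_form p y v u.
Proof.
move=> Sp Uy; rewrite /hess_form exchange_big; apply: eq_bigr => a _ /=.
apply: eq_bigr => k _; by rewrite -[in LHS](hess_sym oU Gp Sp Uy) mxE mulrAC.
Qed.

(* Both sides are the integrand of the Bochner-type identity; the right one is
   a divergence. *)
Lemma divergence_identity w f (b : R) y : smooth_on U w -> smooth_on U f ->
  (forall z, U z -> 0 < w z) -> b != 2 -> U y ->
  let L := w y * local_laplacian G f y - (b - 1) * local_dprod G w f y in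
  let X := lgrad G f y in
  let A := grad_endo f y in
  w y `^ (- b) * L ^+ 2
  - (b - 1) * w y `^ (1 - b) *
    quad ((w y / (b - 2)) *: local_ricci G y + local_hess G w y) X
  - w y `^ (2 - b) / (b - 2) * ((b - 1) * \tr (A *m A) - (\tr A) ^+ 2) =
  - (b - 1) / (b - 2) / 2 * ltheta (fun z => w z `^ (2 - b)) (local_dprod G f f) y
  + (b - 1) / (b - 2) *
      ltheta (fun z => w z `^ (2 - b) * local_laplacian G f z) f y
  - (b - 1) * ltheta (fun z => w z `^ (1 - b) * local_dprod G w f z) f y.
Proof.
move=> Sw Sf w0 b2 Uy L X A.
have wy := w0 y Uy.
have Sp s : smooth_on U (fun z => w z `^ s) by exact: smooth_on_powR.
have SL : smooth_on U (local_laplacian G f) by exact: laplacian_smooth.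
have Swf : smooth_on U (local_dprod G w f) by exact: dprod_smooth.
(* Once all powers are multiples of [w y] to the power [- b], the claim is a rational identity
   between independent quantities. *)
have w1 : w y `^ (1 - b) = w y * w y `^ (- b).
  by rewrite powRD ?powRr1 ?(ltW wy) //; apply/implyP => _; rewrite gt_eqF.
have w2 : w y `^ (2 - b) = w y ^+ 2 * w y `^ (- b).
  by rewrite powRD ?powR_mulrn ?(ltW wy) //; apply/implyP => _; rewrite gt_eqF.
have -> : quad ((w y / (b - 2)) *: local_ricci G y + local_hess G w y) X =
    w y / (b - 2) * quad (local_ricci G y) X + quad (local_hess G w y) X.
  by rewrite /quad mulmxDr mulmxDl -scalemxAr -scalemxAl 2!mxE.
rewrite /ltheta !dprod_mull // !dprod_powR // -local_laplacian_endo.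
rewrite dprod_dprod // (dpC w) // dprod_dprod //.
rewrite -hess_form_quad -/X (hess_formC X (lgrad G w y) Sf Uy).
have := bochner_laplacian Sf Uy; rewrite -/X -/A.
have -> : 2 - b - 1 = 1 - b by ring.
have -> : 1 - b - 1 = - b by ring.
rewrite w1 w2 /L => B.
have -> : local_laplacian G (local_dprod G f f) y = 2 * (2^-1 *
  local_laplacian G (local_dprod G f f) y) by rewrite mulrA divff ?mul1r // pnatr_eq0.
rewrite B.
have b20 : b - 2 != 0 by rewrite subr_eq0.
clear - b20.
move: (w y `^ (- b)) (w y) (local_laplacian G f y) (local_dprod G w f y)
  (local_dprod G (local_laplacian G f) f y) (quad (local_ricci G y) X)
  (\tr (A *m A)) (hess_form w y X X) (hess_form f y (lgrad G w y) X).
move=> v W D p E Ric T Hw h; field.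
exact: b20.
Qed.

Lemma curvature_dimension_ineq w f (b c : R) y : smooth_on U w -> smooth_on U f ->
  (forall z, U z -> 0 < w z) -> b != 2 -> 1 < b -> U y ->
  ((2 <= n)%N /\ n.+1%:R <= b) \/ n = 1%N ->
  (forall v, c * quad (G y) v <=
    quad ((w y / (b - 2)) *: local_ricci G y + local_hess G w y) v) ->
  - (b - 1) / (b - 2) / 2 * ltheta (fun z => w z `^ (2 - b)) (local_dprod G f f) y
  + (b - 1) / (b - 2) *
      ltheta (fun z => w z `^ (2 - b) * local_laplacian G f z) f y
  - (b - 1) * ltheta (fun z => w z `^ (1 - b) * local_dprod G w f z) f y <=
  w y `^ (- b) * (w y * local_laplacian G f y - (b - 1) * local_dprod G w f y) ^+ 2
  - c * (b - 1) * w y `^ (1 - b) * local_dprod G f f y.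
Proof.
move=> Sw Sf w0 b2 b1 Uy dim curv.
rewrite -(divergence_identity Sw Sf w0 b2 Uy) -addrA lerD2l -opprD lerN2.
have K0 : 0 <= (b - 1) * w y `^ (1 - b) by rewrite mulr_ge0 ?powR_ge0 // subr_ge0 ltW.
have := ler_wpM2l K0 (curv (lgrad G f y)); rewrite (lgrad_quad Gp) // => H1.
suff H2 : 0 <= w y `^ (2 - b) / (b - 2) * ((b - 1) *
    \tr (grad_endo f y *m grad_endo f y) - \tr (grad_endo f y) ^+ 2).
  apply: le_trans (_ : _ <= (b - 1) * w y `^ (1 - b) * (c * local_dprod G f f y)) _.
    by rewrite le_eqVlt; apply/orP; left; apply/eqP; ring.
  by rewrite -[leLHS]addr0 lerD.
rewrite -mulrA mulr_ge0 ?powR_ge0 //.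
have CS := posdef_trace_CS (Gp Uy) (hess_sym oU Gp Sf Uy).
rewrite -/(grad_endo f y) in CS.
case: dim => [[n2 nb]|n1].
(* The trace inequality costs a factor [n], and [b - 1 >= n] pays for it. *)
- have b20 : 0 < b - 2.
    rewrite subr_gt0; apply: lt_le_trans nb; rewrite ltr_nat //.
  rewrite mulr_ge0 ?invr_ge0 ?(ltW b20) // subr_ge0; apply: le_trans CS _.
  apply: ler_wpM2r.
    apply: posdef_trace_sqr; first exact: posdef_inv (Gp Uy).
    exact: hess_sym Sf Uy.
  by rewrite lerBrDr natr1.
(* For a 1 by 1 matrix both traces are the same square, so the bracket is [b - 2] times a square and
   the denominator disappears whatever its sign. *)
- have -> : \tr (grad_endo f y *m grad_endo f y) = \tr (grad_endo f y) ^+ 2.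
    move: (grad_endo f y); rewrite n1 => M.
    by rewrite /mxtrace !big_ord1 mxE big_ord1 expr2.
  have := sqr_ge0 (\tr (grad_endo f y)); move: (_ ^+ 2) => T T0.
  have -> : (b - 1) * T - T = (b - 2) * T by ring.
  by rewrite mulKf // subr_eq0.
Qed.

End Bochner.

(** * Calculus on a manifold *)

Lemma ge0_integral_mrestr d (T : measurableType d) (R : realType)
    (mu : {measure set T -> \bar R}) (D : set T) (mD : measurable D) (f : T -> \bar R) :
  measurable_fun [set: T] f -> (forall x, 0 <= f x)%E ->
  (\int[mrestr mu mD]_x f x = \int[mu]_(x in D) f x)%E.
Proof.
move=> mf f0.
rewrite (@ge0_integral_density _ _ _ mu _ (\1_D : T -> R)) //.
- rewrite [RHS]integral_mkcond; apply: eq_integral => x _.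
  by rewrite patchE indicE; case: ifP => _; rewrite ?mule1 ?mule0.
- by move=> A mA; rewrite integral_indic // setIC.
Qed.

(** * Riemannian volume in a chart *)

Section ChartIntegral.
Variables (R : realType) (n : nat) (M : ptopologicalType) (A : smooth_atlas R n M).
Variables (g : riemannian_metric A) (vol : {measure set (borelType M) -> \bar R}).
Hypothesis vol_g : is_volume g vol.
Variable m : {measure set (borelType 'rV[R]_n) -> \bar R}.
Hypothesis Lm : lebesgue_like m.
Variable i : chart_idx A.

Local Notation cod := (chart_cod i).
Local Notation dom := (chart_dom i).
Local Notation psi := (chart_inv i).
Local Notation phi := (chart i).

Lemma chart_cod_psi y : cod y -> dom (psi y) /\ phi (psi y) = y.
Proof. by case=> x dx <-; rewrite chartK. Qed.

Lemma chart_cod_phi x : dom x -> cod (phi x).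
Proof. by move=> dx; exists x. Qed.

Lemma codo : open cod.
Proof. exact: chart_cod_open. Qed.

Lemma measurable_dom : measurable (dom : set (borelType M)).
Proof. by apply: open_borel; exact: chart_dom_open. Qed.

Lemma measurable_cod : measurable (cod : set (borelType 'rV[R]_n)).
Proof. by apply: open_borel; exact: codo. Qed.

(** The chart has arbitrary values off its domain; a constant value there makes it a Borel function
    on all of [M]. *)
Let ch : borelType M -> borelType 'rV[R]_n := (phi : borelType M -> borelType 'rV[R]_n) \_ dom.

Let mch : measurable_fun setT ch.
Proof.
apply: (measurable_restrictT _ measurable_dom).1; apply: borel_measurable.
  exact: chart_dom_open.
by move=> x dx; exact: chart_continuous.
Qed.

(** The indicator discards the arbitrary values of the metric coefficients off the chart image. *)
Definition vol_weight (y : borelType 'rV[R]_n) : R := Num.sqrt (\det (metric g i y)) * \1_cod y.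

Lemma vol_weight_ge0 y : 0 <= vol_weight y.
Proof. by rewrite mulr_ge0 // sqrtr_ge0. Qed.

Lemma vol_weight_measurable : measurable_fun [set: borelType 'rV[R]_n] vol_weight.
Proof.
have : measurable_fun (cod : set (borelType 'rV[R]_n))
    ((fun y => Num.sqrt (\det (metric g i y))) : borelType 'rV[R]_n -> R).
  apply: borel_measurable_real; first exact: codo.
  move=> y cy; apply: continuous_comp; last exact: sqrt_continuous.
  exact: (Ck_continuous (smooth_on_det codo (@metric_smooth _ _ _ _ g i) 0%N) cy).
move=> /(measurable_restrictT _ measurable_cod).1; congr (measurable_fun _ _).
by apply/funext => y; rewrite /vol_weight patchE indicE; case: ifP => _; rewrite ?mulr1 ?mulr0.
Qed.

(** The image under the chart of the volume restricted to its domain has density [vol_weight]: on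
    sets this is [is_volume], and [ge0_integral_density] extends it to functions. *)
Lemma ge0_chart_integral (F : borelType M -> \bar R) : measurable_fun [set: borelType M] F ->
  (forall x, 0 <= F x)%E ->
  (\int[vol]_(x in dom) F x = \int[m]_y (F (psi y) * (vol_weight y)%:E))%E.
Proof.
move=> mF F0.
pose f : borelType 'rV[R]_n -> \bar R := (F \o psi) \_ cod.
have mf : measurable_fun setT f.
  apply: (measurable_restrictT _ measurable_cod).1.
  apply: (measurable_comp _ _ mF) => //.
  apply: borel_measurable; first exact: codo.
  by move=> y cy; exact: chart_inv_continuous.
have f0 y : (0 <= f y)%E by rewrite /f patchE; case: ifP => _; [exact: F0|exact: lexx].
have [m' m'E] : exists m' : {measure set (borelType 'rV[R]_n) -> \bar R},
    m' = pushforward (mrestr vol measurable_dom) ch :> (set (borelType 'rV[R]_n) -> \bar R).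
  by unshelve eexists (pushforward (mrestr vol measurable_dom) ch); first exact: mch.
have [mE _ _] := Lm.
have mfch : measurable_fun setT (f \o ch) by exact: measurableT_comp mf mch.
transitivity (\int[vol]_(x in dom) (f \o ch) x)%E.
  apply: eq_integral => x dx; rewrite /f /ch /= !patchE dx ifT //= ?inE ?chartK //.
    by rewrite inE in dx.
  by apply: chart_cod_phi; rewrite inE in dx.
rewrite -(ge0_integral_mrestr vol measurable_dom mfch); last by move=> x; exact: f0.
transitivity (\int[m']_y f y)%E.
  by rewrite m'E ge0_integral_pushforward.
rewrite (@ge0_integral_density _ _ _ m _ vol_weight) //.
- apply: eq_integral => y _; rewrite /f patchE /vol_weight indicE.
  by case: ifP => _ //; rewrite mulr0 !mule0.
- exact: vol_weight_measurable.
- exact: vol_weight_ge0.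
- move=> B mB; rewrite m'E /pushforward /mrestr.
  have mC : measurable (ch @^-1` B `&` dom).
    by apply: measurableI; [rewrite -[X in measurable X]setTI; exact: mch|exact: measurable_dom].
  rewrite (@vol_g i _ mC); last by move=> x [].
  have CE : phi @` (ch @^-1` B `&` dom) = B `&` cod.
    apply/seteqP; split=> [_ [x [Bx dx] <-]|y [By [x dx xy]]].
      by split; [move: Bx; rewrite /= /ch patchE mem_set|exact: chart_cod_phi].
    by exists x => //; split=> //=; rewrite /ch patchE mem_set // xy.
  rewrite CE; have E : (fun y => (\1_(B `&` cod) y * Num.sqrt (\det (metric g i y)))%:E) =
      ((fun y => (vol_weight y)%:E) : borelType 'rV[R]_n -> \bar R) \_ B.
    apply/funext => y; rewrite patchE /vol_weight !indicE in_setI.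
    by case: (y \in B) => /=; rewrite ?mul0r // mulrC.
  rewrite E mE -?integral_mkcond //.
  + apply: (measurable_restrictT _ mB).1; apply/measurable_EFinP; apply: measurable_funTS.
    exact: vol_weight_measurable.
  + by move=> y; rewrite patchE; case: ifP => // _; rewrite lee_fin vol_weight_ge0.
Qed.

Lemma chart_integral (F : borelType M -> R) : measurable_fun [set: borelType M] F ->
  (forall x, ~ dom x -> F x = 0) ->
  (\int[vol]_x (F x)%:E = \int[m]_y (F (psi y) * vol_weight y)%:E)%E.
Proof.
move=> mF F0; have mF' : measurable_fun [set: borelType M] (EFin \o F) by exact/measurable_EFinP.
have E (H : borelType M -> \bar R) : (forall x, ~ dom x -> H x = 0)%E ->
    (\int[vol]_x H x = \int[vol]_(x in dom) H x)%E.
  move=> H0; rewrite [RHS]integral_mkcond; apply: eq_integral => x _.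
  by rewrite patchE; case: ifPn => //; rewrite notin_setE => /H0.
rewrite integralE [RHS]integralE; congr (_ - _)%E; rewrite E ?ge0_chart_integral //.
- apply: eq_integral => y _; rewrite !funeposE -!EFin_max -EFinM maxr_pMl ?mul0r //.
  exact: vol_weight_ge0.
- exact: measurable_funepos.
- by move=> x dx; rewrite funeposE F0 // maxxx.
- apply: eq_integral => y _; rewrite !funenegE -!EFinN -!EFin_max -EFinM maxr_pMl ?mul0r ?mulNr //.
  exact: vol_weight_ge0.
- exact: measurable_funeneg.
- by move=> x dx; rewrite funenegE F0 // oppe0 maxxx.
Qed.

End ChartIntegral.

(** * Invariance under changes of coordinates *)

Section ChangeOfCoordinates.
Variables (R : realType) (n : nat) (U U' : set 'rV[R]_n).
Variables (G G' : 'rV[R]_n -> 'M[R]_n) (tau : 'rV[R]_n -> 'rV[R]_n).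
Hypotheses (oU : open U) (oU' : open U').
Hypothesis Gs : forall a b, smooth_on U (fun y => G y a b).
Hypothesis Gs' : forall a b, smooth_on U' (fun y => G' y a b).
Hypothesis Gp : forall y, U y -> posdef (G y).
Hypothesis Gp' : forall y, U' y -> posdef (G' y).
Hypothesis taus : forall l, smooth_on U (fun y => tau y ord0 l).
Hypothesis tauU : forall y, U y -> U' (tau y).

(** Rows are indexed by the source coordinates, so that vectors are transported by [J] on the right
    and differentials are pulled back by its transpose. *)
Let J y : 'M[R]_n := \matrix_(k, l) partial k (fun z => tau z ord0 l) y.
Hypothesis GJ : forall y, U y -> G y = J y *m G' (tau y) *m (J y)^T.

Let Ct l : Ck 1 U (fun z => tau z ord0 l).
Proof. exact: taus. Qed.

Lemma transition_unit y : U y -> J y \in unitmx.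
Proof.
move=> Uy; have := posdef_unit (Gp Uy); rewrite GJ // !unitmx_mul.
by case/andP => /andP[].
Qed.

Lemma drow_transition f y : Ck 1 U' f -> U y ->
  drow (f \o tau) y = drow f (tau y) *m (J y)^T.
Proof.
move=> Cf Uy; apply/rowP => k; rewrite !mxE.
have [_ ->] := chain_rule k oU oU' Ct Cf Uy (tauU Uy).
by apply: eq_bigr => l _; rewrite !mxE.
Qed.

Lemma inv_metric_transition y : U y ->
  (J y)^T *m invmx (G y) *m J y = invmx (G' (tau y)).
Proof.
move=> Uy; have Ju := transition_unit Uy; have Gu' := posdef_unit (Gp' (tauU Uy)).
suff H : G' (tau y) *m ((J y)^T *m invmx (G y) *m J y) = 1%:M.
  by rewrite -[LHS](mulKmx Gu') H mulmx1.
apply: (can_inj (mulKmx Ju)).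
by rewrite mulmx1 !mulmxA -GJ // mulmxV ?mul1mx // posdef_unit //; exact: Gp.
Qed.

Lemma local_dprod_transition f h y : Ck 1 U' f -> Ck 1 U' h -> U y ->
  local_dprod G (f \o tau) (h \o tau) y = local_dprod G' f h (tau y).
Proof.
move=> Cf Ch Uy; rewrite !local_dprod_mx !drow_transition // trmx_mul trmxK.
by rewrite -(inv_metric_transition Uy) !mulmxA.
Qed.

Lemma lgrad_transition f y : Ck 1 U' f -> U y ->
  lgrad G (f \o tau) y *m J y = lgrad G' f (tau y).
Proof.
move=> Cf Uy; rewrite /lgrad drow_transition // -(inv_metric_transition Uy).
by rewrite !mulmxA.
Qed.

Lemma partial_det_metric (V : set 'rV[R]_n) (F : 'rV[R]_n -> 'M[R]_n) k y :
  open V -> (forall a b, smooth_on V (fun y => F y a b)) ->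
  (forall y, V y -> posdef (F y)) -> V y ->
  partial k (fun z => \det (F z)) y = 2 * \det (F y) * ctrace F k y.
Proof.
move=> oV Fs Fp Vy; have d0 := posdef_det (Fp _ Vy).
rewrite -(@eq_partial_on _ _ _ oV k (fun z => Num.sqrt (\det (F z)) * Num.sqrt (\det (F z)))) //; last first.
  by move=> z; rewrite inE => Vz; rewrite -expr2 sqr_sqrtr // ltW // posdef_det //; exact: Fp.
have ds := smooth_on_derivable (k := k) (sqrt_det_smooth oV Fs Fp) Vy.
rewrite (partialM ds ds) (partial_sqrt_det oV Fs Fp) //.
have : Num.sqrt (\det (F y)) ^+ 2 = \det (F y) by rewrite sqr_sqrtr // ltW.
by move: (Num.sqrt _) => s <-; ring.
Qed.

Let J_smooth k l : smooth_on U (fun y => J y k l).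
Proof. by under eq_fun do rewrite mxE; exact: smooth_on_partial. Qed.

Let J_derivable k y : U y -> mx_derivable k J y.
Proof. by move=> Uy i j; exact: smooth_on_derivable (J_smooth i j) Uy. Qed.

Lemma partial_comp_tau p k y : Ck 1 U' p -> U y ->
  derivable (p \o tau) y (delta_mx ord0 k) /\
  partial k (p \o tau) y = \sum_l J y k l * partial l p (tau y).
Proof.
move=> Cp Uy; have [d ->] := chain_rule k oU oU' Ct Cp Uy (tauU Uy).
by split=> //; apply: eq_bigr => l _; rewrite mxE mulrC.
Qed.

(* The logarithmic derivative of [det G = (det J)^2 det G']. *)
Lemma ctrace_transition k y : U y ->
  ctrace G k y = \tr (dmx k J y *m invmx (J y)) + \sum_l J y k l * ctrace G' l (tau y).
Proof.
move=> Uy; have dG := posdef_det (Gp Uy); have dG' := posdef_det (Gp' (tauU Uy)).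
have dJ : \det (J y) != 0 by rewrite -unitfE -unitmxE transition_unit.
have E : {in U, (fun z => \det (G z)) =1 (fun z => \det (J z) * \det (J z) * \det (G' (tau z)))}.
  by move=> z; rewrite inE => Uz; rewrite GJ // !det_mulmx det_tr mulrAC.
have := eq_partial_on oU k E Uy.
rewrite (partial_det_metric k oU Gs Gp Uy).
have [dd ddE] := partial_det (J_derivable (k:=k) Uy).
have [d' d'E] := partial_comp_tau k (smooth_on_det oU' Gs' 1%N) Uy.
have -> : partial k (fun z => \det (J z) * \det (J z) * \det (G' (tau z))) y =
    \det (J y) * \det (J y)
      * \sum_l J y k l * partial l (fun y : 'rV_n => \det (G' y)) (tau y) +
    \det (G' (tau y)) * (\det (J y) * \tr (\adj (J y) *m dmx k J y)
      + \det (J y) * \tr (\adj (J y) *m dmx k J y)).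
  rewrite -d'E -ddE; apply: (etrans (partialM (derivableM dd dd) d')).
  congr (_ + _ * _); exact: (partialM dd dd).
have -> : \adj (J y) = \det (J y) *: invmx (J y).
  by rewrite /invmx transition_unit // scalerA divff // scale1r.
rewrite -scalemxAl linearZ /= mxtrace_mulC.
rewrite (eq_bigr (fun l => 2 * \det (G' (tau y)) * (J y k l * ctrace G' l (tau y)))); last first.
  move=> l _; rewrite (partial_det_metric l oU' Gs' Gp' (tauU Uy)); ring.
rewrite -mulr_sumr [in X in X = _ -> _]GJ // !det_mulmx det_tr.
move: (\tr _) (\sum_l _) (ctrace _ _ _) (\det (J y)) (\det (G' _)) dJ dG' => T S c j g' j0 g'0 H.
have g0 : g' != 0 by rewrite gt_eqF.
have two0 : (2 : R) != 0 by rewrite pnatr_eq0.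
have nz := mulf_neq0 (mulf_neq0 (mulf_neq0 two0 j0) j0) g0.
apply: (mulfI nz).
by transitivity (2 * (j * g' * j) * c); [ring|rewrite H; ring].
Qed.

(** Comparing divergences of gradients avoids the transformation law of the Christoffel symbols:
    only their trace enters, through [ctrace_transition]. Differentiating the relation between the
    two gradients produces derivatives of [J], which compensate those in the trace. *)
Lemma local_laplacian_transition f y : smooth_on U' f -> smooth_on U (f \o tau) -> U y ->
  local_laplacian G (f \o tau) y = local_laplacian G' f (tau y).
Proof.
move=> Sf Sft Uy.
rewrite -(ldiv_grad oU Gs Gp Sft Uy) -(ldiv_grad oU' Gs' Gp' Sf (tauU Uy)).
set Z := lgrad G (f \o tau); set W := lgrad G' f.
have Ju := transition_unit Uy.
have dZ k : mx_derivable k Z y by exact: (lgrad_mx_derivable oU Gs Gp).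
have WS a : smooth_on U' (fun z => W z ord0 a) by exact: (lgrad_smooth oU' Gs' Gp').
have E k : dmx k Z y + Z y *m (dmx k J y *m invmx (J y)) =
    (\sum_l J y k l *: dmx l W (tau y)) *m invmx (J y).
  apply: (canRL (mulmxK Ju)); rewrite mulmxDl [Z y *m _]mulmxA mulmxKV //.
  rewrite -(dmx_mul (dZ k) (J_derivable (k:=k) Uy)).2.
  apply/rowP => a; rewrite [LHS]mxE summxE.
  rewrite (eq_partial_on oU k (h := (fun z => W z ord0 a) \o tau) _ Uy); last first.
    by move=> z; rewrite inE => Uz; rewrite /= /Z /W lgrad_transition //; exact: Sf.
  rewrite (partial_comp_tau k (WS a 1%N) Uy).2.
  by apply: eq_bigr => l _; rewrite !mxE.
have Zr k : dmx k Z y ord0 k = partial k (fun z => Z z ord0 k) y by rewrite mxE.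
have WJ b : \sum_a Z y ord0 a * J y a b = W (tau y) ord0 b.
  by rewrite /W -lgrad_transition ?mxE //; exact: Sf.
rewrite /ldiv !big_split /=.
have -> : \sum_a ctrace G a y * Z y ord0 a =
    \sum_a \tr (dmx a J y *m invmx (J y)) * Z y ord0 a + \sum_l ctrace G' l (tau y) * W (tau y) ord0 l.
  rewrite (eq_bigr _ (fun l _ => congr1 (fun t => ctrace G' l (tau y) * t) (esym (WJ l)))).
  rewrite (eq_bigr _ (fun a _ => congr1 (fun t => t * Z y ord0 a) (ctrace_transition a Uy))).
  under eq_bigr do rewrite mulrDl; rewrite big_split /=; congr (_ + _).
  under eq_bigr do rewrite mulr_suml; under [RHS]eq_bigr do rewrite mulr_sumr.
  by rewrite exchange_big /=; apply: eq_bigr => l _; apply: eq_bigr => a _; ring.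
rewrite addrA; congr (_ + _).
(* The two kinds of derivatives of [J] agree because they are second derivatives of [tau] with the
   indices exchanged. *)
have sym : \sum_k (Z y *m (dmx k J y *m invmx (J y))) ord0 k =
    \sum_a \tr (dmx a J y *m invmx (J y)) * Z y ord0 a.
  under eq_bigr do rewrite mxE; rewrite exchange_big /=; apply: eq_bigr => a _.
  rewrite -mulr_sumr mulrC /mxtrace; congr (_ * _); apply: eq_bigr => k _.
  rewrite [LHS]mxE [RHS]mxE; apply: eq_bigr => b _; congr (_ * _); rewrite [LHS]mxE [RHS]mxE.
  rewrite [LHS](eq_partial_on oU k (h := partial a (fun z => tau z ord0 b)) _ Uy); last first.
    by move=> z _; rewrite [LHS]mxE.
  rewrite [RHS](eq_partial_on oU a (h := partial k (fun z => tau z ord0 b)) _ Uy); last first.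
    by move=> z _; rewrite [LHS]mxE.
  exact: (smooth_on_partial_comm oU k a (taus b) Uy).
rewrite -sym -(eq_bigr _ (fun k _ => Zr k)) -big_split /=.
transitivity (\sum_k ((\sum_l J y k l *: dmx l W (tau y)) *m invmx (J y)) ord0 k).
  by apply: eq_bigr => k _; rewrite -E [RHS]mxE.
have lin k : ((\sum_l J y k l *: dmx l W (tau y)) *m invmx (J y)) ord0 k =
    \sum_l (J y k l *: dmx l W (tau y) *m invmx (J y)) ord0 k.
  rewrite mxE; under eq_bigr do rewrite summxE mulr_suml.
  by rewrite exchange_big /=; apply: eq_bigr => l _; rewrite [RHS]mxE.
rewrite (eq_bigr _ (fun k _ => lin k)).
rewrite exchange_big /=; apply: eq_bigr => l _.
transitivity ((dmx l W (tau y) *m (invmx (J y) *m J y)) ord0 l).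
  rewrite mulmxA mxE; apply: eq_bigr => k _.
  by rewrite -scalemxAl mxE mulrC.
by rewrite mulVmx // mulmx1 mxE.
Qed.

End ChangeOfCoordinates.

Section LocalOperatorsCongruence.
Variables (R : realType) (n : nat) (U : set 'rV[R]_n) (G : 'rV[R]_n -> 'M[R]_n).
Hypothesis oU : open U.

Lemma eq_local_dprod f f' h h' y : {in U, f =1 f'} -> {in U, h =1 h'} -> U y ->
  local_dprod G f h y = local_dprod G f' h' y.
Proof.
move=> ff hh Uy; apply: eq_bigr => a _; apply: eq_bigr => b _.
by rewrite (eq_partial_on oU a ff Uy) (eq_partial_on oU b hh Uy).
Qed.

Lemma eq_local_laplacian f f' y : {in U, f =1 f'} -> U y ->
  local_laplacian G f y = local_laplacian G f' y.
Proof.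
move=> ff Uy; rewrite /local_laplacian.
suff -> : local_hess G f y = local_hess G f' y by [].
apply/matrixP => a b; rewrite [LHS]mxE [RHS]mxE.
have -> : partial a (partial b f) y = partial a (partial b f') y.
  apply: (eq_partial_on oU a _ Uy) => z; rewrite inE => Uz.
  exact: (eq_partial_on oU b ff Uz).
suff -> : \sum_k christoffel G k a b y * partial k f y = \sum_k christoffel G k a b y * partial k f' y by [].
by apply: eq_bigr => k _; rewrite (eq_partial_on oU k ff Uy).
Qed.

End LocalOperatorsCongruence.

(** * Operators on the manifold *)

Section ManifoldCalculus.
Variables (R : realType) (n : nat) (M : ptopologicalType) (A : smooth_atlas R n M).
Variable g : riemannian_metric A.
Implicit Types (f h : M -> R) (i j : chart_idx A).

Definition Ck_mfd m f := forall i, Ck m (chart_cod i) (f \o chart_inv i).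

Definition overlap i j : set 'rV[R]_n := chart i @` (chart_dom i `&` chart_dom j).

Lemma overlapP i j y : overlap i j y <-> chart_cod i y /\ chart_dom j (chart_inv i y).
Proof.
split=> [[x [dx dx'] <-]|[/chart_cod_psi[d e] d']].
  by split; [exists x|rewrite chartK].
by exists (chart_inv i y).
Qed.

Lemma overlap_open i j : open (overlap i j).
Proof.
have -> : overlap i j = chart_cod i `&` chart_inv i @^-1` chart_dom j.
  by apply/funext => y; apply/propext; exact: overlapP.
apply: open_preimage; [exact: chart_cod_open| |exact: chart_dom_open].
by move=> y; exact: chart_inv_continuous.
Qed.

Definition transition i j y := chart j (chart_inv i y).

Lemma transition_cod i j y : overlap i j y -> chart_cod j (transition i j y).
Proof. by move=> /overlapP[_ d]; exact: chart_cod_phi. Qed.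

Lemma comp_transition i j f : {in overlap i j, (f \o chart_inv j) \o transition i j =1 f \o chart_inv i}.
Proof. by move=> y; rewrite inE => /overlapP[_ d] /=; rewrite /transition chartK. Qed.

Lemma metric_posdef i y : chart_cod i y -> posdef (metric g i y).
Proof. by move=> cy; split; [exact: (Defs.metric_sym g cy)|by move=> v v0; exact: (@metric_pos _ _ _ _ g _ _ _ cy v0)]. Qed.

Lemma metric_transition i j y : overlap i j y ->
  let J := \matrix_(k, l) partial k (fun z => transition i j z ord0 l) y in
  metric g i y = J *m metric g j (transition i j y) *m J^T.
Proof.
move=> Oy; have -> : \matrix_(k, l) partial k (fun z => transition i j z ord0 l) y = jacobian (transition i j) y.
  apply/matrixP => k l; rewrite mxE; apply: esym.
  apply: (@jacobianE _ _ _ (transition i j) (overlap i j)) => //; first exact: overlap_open.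
  by move=> l'; exact: (@transition_smooth _ _ _ A i j l' 1%N).
exact: metric_change.
Qed.

Lemma smooth_on_overlap i j (f : 'rV[R]_n -> R) : smooth_on (chart_cod i) f -> smooth_on (overlap i j) f.
Proof. by move=> Sf m; apply: Ck_sub (Sf m) => y /overlapP[]. Qed.

Let transition_s i j l : smooth_on (overlap i j) (fun y => transition i j y ord0 l).
Proof. exact: (@transition_smooth _ _ _ A i j l). Qed.

Let overlap_posdef i j y : overlap i j y -> posdef (metric g i y).
Proof. by move=> /overlapP[cy _]; exact: metric_posdef. Qed.

Lemma dprod_chart i x f h : Ck_mfd 1 f -> Ck_mfd 1 h -> chart_dom i x ->
  dprod g f h x = local_dprod (metric g i) (f \o chart_inv i) (h \o chart_inv i) (chart i x).
Proof.
move=> Cf Ch dx; rewrite /dprod; set j := chart_at A x.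
have Oy : overlap i j (chart i x) by exists x => //; split=> //; exact: chart_atP.
have tE : transition i j (chart i x) = chart j x by rewrite /transition chartK.
apply: esym; apply: etrans (esym (eq_local_dprod (metric g i) (@overlap_open i j) (@comp_transition i j f) (@comp_transition i j h) Oy)) _.
by rewrite (local_dprod_transition (@overlap_open i j) (@chart_cod_open _ _ _ A j)
  (@overlap_posdef i j) (@metric_posdef j) (@transition_s i j) (@transition_cod i j)
  (@metric_transition i j) (Cf j) (Ch j) Oy) tE.
Qed.

Lemma laplacian_chart i x f : smooth A f -> chart_dom i x ->
  laplacian g f x = local_laplacian (metric g i) (f \o chart_inv i) (chart i x).
Proof.
move=> Sf dx; rewrite /laplacian; set j := chart_at A x.
have Oy : overlap i j (chart i x) by exists x => //; split=> //; exact: chart_atP.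
have tE : transition i j (chart i x) = chart j x by rewrite /transition chartK.
apply: esym; apply: etrans (esym (eq_local_laplacian (metric g i) (@overlap_open i j) (@comp_transition i j f) Oy)) _.
have Sft : smooth_on (overlap i j) ((f \o chart_inv j) \o transition i j).
  apply: (@eq_smooth_on _ _ _ (@overlap_open i j) (f \o chart_inv i)).
    by move=> z zO; rewrite (@comp_transition i j f z zO).
  exact/smooth_on_overlap/Sf.
have Gs a b : smooth_on (overlap i j) (fun y => metric g i y a b).
  by apply: smooth_on_overlap; exact: metric_smooth.
by rewrite (local_laplacian_transition (@overlap_open i j) (@chart_cod_open _ _ _ A j)
  Gs (@metric_smooth _ _ _ _ g j) (@overlap_posdef i j) (@metric_posdef j) (@transition_s i j)
  (@transition_cod i j) (@metric_transition i j) (Sf j) Sft Oy) tE.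
Qed.

Lemma Ck_mfd_of_charts m f (F : forall i, 'rV[R]_n -> R) :
  (forall i x, chart_dom i x -> f x = F i (chart i x)) ->
  (forall i, Ck m (chart_cod i) (F i)) -> Ck_mfd m f.
Proof.
move=> fF CF i; apply: (eq_Ck (@chart_cod_open _ _ _ A i) _ (CF i)) => y; rewrite inE => cy.
by have [d e] := chart_cod_psi cy; rewrite /= (fF i _ d) e.
Qed.

Lemma smooth_Ck_mfd m f : smooth A f -> Ck_mfd m f.
Proof. by move=> Sf i; exact: Sf. Qed.

Lemma dprod_smoothM f h : smooth A f -> smooth A h -> smooth A (dprod g f h).
Proof.
move=> Sf Sh i m.
apply: (@Ck_mfd_of_charts m _ (fun i => local_dprod (metric g i) (f \o chart_inv i) (h \o chart_inv i))).
  by move=> {}i x; apply: dprod_chart; exact: smooth_Ck_mfd.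
move=> {}i; apply: (dprod_smooth (@chart_cod_open _ _ _ A i)).
- by move=> a b; exact: metric_smooth.
- by move=> y; exact: metric_posdef.
- exact: Sf.
- exact: Sh.
Qed.

Lemma laplacian_smoothM f : smooth A f -> smooth A (laplacian g f).
Proof.
move=> Sf i m.
apply: (@Ck_mfd_of_charts m _ (fun i => local_laplacian (metric g i) (f \o chart_inv i))).
  by move=> {}i x; exact: laplacian_chart.
move=> {}i; apply: (laplacian_smooth (@chart_cod_open _ _ _ A i)).
- by move=> a b; exact: metric_smooth.
- by move=> y; exact: metric_posdef.
- exact: Sf.
Qed.

Lemma dprod_C0M f h : Ck_mfd 1 f -> Ck_mfd 1 h -> Ck_mfd 0 (dprod g f h).
Proof.
move=> Cf Ch.
apply: (@Ck_mfd_of_charts 0 _ (fun i => local_dprod (metric g i) (f \o chart_inv i) (h \o chart_inv i))).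
  by move=> i x; exact: dprod_chart.
move=> i; have oi := @chart_cod_open _ _ _ A i.
apply: Ck_sum => // a _; apply: Ck_sum => // b _; apply: CkM => //; last exact: (Ck_partial b (Ch i)).
apply: CkM => //; last exact: (Ck_partial a (Cf i)).
apply: (smooth_on_inv oi a b (@metric_smooth _ _ _ _ g i)) => y; exact: metric_posdef.
Qed.

Lemma C0M_continuous f : Ck_mfd 0 f -> continuous f.
Proof.
move=> Cf x; set i := chart_at A x; have dx : chart_dom i x := chart_atP A x.
have cf : {for x, continuous ((f \o chart_inv i) \o chart i)}.
  apply: continuous_comp; first exact: chart_continuous.
  by have [cf _] := Cf i; apply: cf; exists x.
have E : {near x, (f \o chart_inv i) \o chart i =1 f}.
  near=> z; rewrite /= chartK //; near: z.
  by apply: open_nbhs_nbhs; split=> //; exact: chart_dom_open.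
move: cf; rewrite /prop_for /continuous_at /= chartK // => cf.
by apply: cvg_trans cf; apply: near_eq_cvg.
Unshelve. all: by end_near. Qed.

Lemma dprod_near f f' h x (W : set M) : open W -> W x -> (forall z, W z -> f z = f' z) ->
  dprod g f h x = dprod g f' h x /\ dprod g h f x = dprod g h f' x.
Proof.
move=> oW Wx E; rewrite /dprod; set i := chart_at A x.
have dx : chart_dom i x := chart_atP A x.
have oV : open (chart_cod i `&` chart_inv i @^-1` W).
  apply: open_preimage => //; first exact: chart_cod_open.
  by move=> y; exact: chart_inv_continuous.
have Vx : (chart_cod i `&` chart_inv i @^-1` W) (chart i x).
  by split; [exists x|rewrite /= chartK].
by split; apply: (eq_local_dprod _ oV _ _ Vx) => // y; rewrite inE => -[_ Wy] /=; exact: E.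
Qed.

Lemma laplacian_near f f' x (W : set M) : open W -> W x -> (forall z, W z -> f z = f' z) ->
  laplacian g f x = laplacian g f' x.
Proof.
move=> oW Wx E; rewrite /laplacian; set i := chart_at A x.
have dx : chart_dom i x := chart_atP A x.
have oV : open (chart_cod i `&` chart_inv i @^-1` W).
  apply: open_preimage => //; first exact: chart_cod_open.
  by move=> y; exact: chart_inv_continuous.
have Vx : (chart_cod i `&` chart_inv i @^-1` W) (chart i x).
  by split; [exists x|rewrite /= chartK].
by apply: (eq_local_laplacian _ oV _ Vx) => y; rewrite inE => -[_ Wy] /=; exact: E.
Qed.

Lemma dprod0 h x : dprod g (fun=> 0) h x = 0 /\ dprod g h (fun=> 0) x = 0.
Proof.
have p0 k i y : partial k ((fun _ : M => 0 : R) \o chart_inv i) y = 0 by exact: partial_cst.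
by split; rewrite /dprod; apply: big1 => a _; apply: big1 => b _; rewrite p0 ?mulr0 ?mul0r.
Qed.

Lemma laplacian0 x : laplacian g (fun=> 0) x = 0.
Proof.
rewrite /laplacian /local_laplacian (_ : local_hess _ _ _ = 0) ?mulmx0 ?mxtrace0 //.
apply/matrixP => a b; rewrite !mxE (_ : partial b _ = fun=> 0); last first.
  by apply/funext => y; exact: partial_cst.
rewrite partial_cst sub0r big1 ?oppr0 // => k _.
by rewrite (_ : partial k _ _ = 0) ?mulr0 //; exact: partial_cst.
Qed.

End ManifoldCalculus.

(** * The spectral gap criterion *)

Lemma discriminant_le (R : realFieldType) (a b c : R) : 0 <= c ->
  (forall t, 0 <= a + 2 * t * b + t ^+ 2 * c) -> b ^+ 2 <= a * c.
Proof.
rewrite le_eqVlt => /predU1P[<-|c0] H.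
  rewrite mulr0; have [->|b0] := eqVneq b 0; first by rewrite expr0n.
  (* An affine function with nonzero slope is not bounded below: this [t] gives the value -1. *)
  have := H (- ((a + 1) / (2 * b))); rewrite mulr0 addr0.
  have -> : a + 2 * - ((a + 1) / (2 * b)) * b = - 1 by field.
  by rewrite lerNr oppr0 ler10.
have := H (- (b / c)).
have cn : c != 0 by rewrite gt_eqF.
have -> : a + 2 * - (b / c) * b + (- (b / c)) ^+ 2 * c = (a * c - b ^+ 2) / c by field.
by rewrite pmulr_lge0 ?invr_gt0 // subr_ge0.
Qed.

(* A complete semi-inner product space: the set [D] of elements of finite norm,
   in which nonzero vectors may have norm zero. *)
Section SemiHilbert.
Variables (R : realType) (V : lmodType R) (D : V -> Prop) (ip : V -> V -> R).
Hypothesis D0 : D 0.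
Hypothesis Dlin : forall a u v, D u -> D v -> D (a *: u + v).
Hypothesis ipC : forall u v, ip u v = ip v u.
Hypothesis iplin : forall a u v w, D u -> D v -> D w ->
  ip (a *: u + v) w = a * ip u w + ip v w.
Hypothesis ip_ge0 : forall u, 0 <= ip u u.

Definition seminorm u := Num.sqrt (ip u u).

Definition semicvg (u : nat -> V) l := forall e : R, 0 < e ->
  exists N, forall m, (N <= m)%N -> seminorm (u m - l) < e.

Hypothesis complete : forall u : nat -> V, (forall m, D (u m)) ->
  (forall e : R, 0 < e -> exists N, forall p q, (N <= p)%N -> (N <= q)%N ->
     seminorm (u p - u q) < e) ->
  exists2 l, D l & semicvg u l.

Lemma DD u v : D u -> D v -> D (u + v).
Proof. by move=> Du Dv; rewrite -[u]scale1r; exact: Dlin. Qed.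

Lemma DZ a u : D u -> D (a *: u).
Proof. by move=> Du; rewrite -[_ *: _]addr0; exact: Dlin. Qed.

Lemma DB u v : D u -> D v -> D (u - v).
Proof. by move=> Du Dv; rewrite addrC -scaleN1r; exact: Dlin. Qed.

Lemma ipD u v w : D u -> D v -> D w -> ip (u + v) w = ip u w + ip v w.
Proof. by move=> Du Dv Dw; rewrite -[u in LHS]scale1r iplin // mul1r. Qed.

Lemma ip0 w : D w -> ip 0 w = 0.
Proof.
move=> Dw; have := ipD D0 D0 Dw; rewrite addr0 => /eqP.
by rewrite -subr_eq0 opprD addrA subrr add0r oppr_eq0 => /eqP.
Qed.

Lemma ipZ a u w : D u -> D w -> ip (a *: u) w = a * ip u w.
Proof. by move=> Du Dw; rewrite -[a *: u]addr0 iplin // ip0 // addr0. Qed.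

Lemma ipB u v w : D u -> D v -> D w -> ip (u - v) w = ip u w - ip v w.
Proof.
by move=> Du Dv Dw; rewrite addrC -scaleN1r iplin // mulN1r addrC.
Qed.

Lemma ip_sqr_lin a u v : D u -> D v ->
  ip (u + a *: v) (u + a *: v) = ip u u + 2 * a * ip u v + a ^+ 2 * ip v v.
Proof.
move=> Du Dv; have Dav := DZ a Dv; have Duv := DD Du Dav.
rewrite ipD // ipZ // ![ip _ (u + _)]ipC !ipD // !ipZ // (ipC v u); ring.
Qed.

Lemma cauchy_schwarz u v : D u -> D v -> ip u v ^+ 2 <= ip u u * ip v v.
Proof.
move=> Du Dv; apply: discriminant_le => // t.
by rewrite -ip_sqr_lin.
Qed.

Lemma seminorm_ge0 u : 0 <= seminorm u. Proof. exact: sqrtr_ge0. Qed.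

Lemma sqr_seminorm u : seminorm u ^+ 2 = ip u u.
Proof. by rewrite sqr_sqrtr. Qed.

Lemma ip_le_seminorm u v : D u -> D v -> `|ip u v| <= seminorm u * seminorm v.
Proof.
move=> Du Dv; rewrite -sqrtrM // -sqrtr_sqr ler_wsqrtr //; exact: cauchy_schwarz.
Qed.

Lemma seminormD u v : D u -> D v -> seminorm (u + v) <= seminorm u + seminorm v.
Proof.
move=> Du Dv; rewrite -(@ler_pXn2r _ 2) // ?nnegrE ?addr_ge0 ?seminorm_ge0 //.
rewrite sqrrD !sqr_seminorm -[v in leLHS]scale1r ip_sqr_lin // expr1n mul1r mulr1.
rewrite lerD2r lerD2l mulr2n mulrDl mul1r.
have := le_trans (ler_norm _) (ip_le_seminorm Du Dv); lra.
Qed.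

Lemma seminormZ a u : D u -> seminorm (a *: u) = `|a| * seminorm u.
Proof.
move=> Du; have Dau := DZ a Du.
rewrite /seminorm ipZ // ipC ipZ // mulrA -expr2 sqrtrM ?sqr_ge0 //.
by rewrite sqrtr_sqr.
Qed.

Lemma seminorm0 : seminorm 0 = 0.
Proof. by rewrite /seminorm ip0 // sqrtr0. Qed.

Lemma seminormBC u v : D u -> D v -> seminorm (u - v) = seminorm (v - u).
Proof.
move=> Du Dv; have -> : u - v = -1 *: (v - u) by rewrite scaleN1r opprB.
rewrite seminormZ; last exact: DB.
by rewrite normrN1 mul1r.
Qed.

Lemma seminorm_triangle u v w : D u -> D v -> D w ->
  seminorm (u - w) <= seminorm (u - v) + seminorm (v - w).
Proof.
move=> Du Dv Dw; have -> : u - w = (u - v) + (v - w) by rewrite addrA subrK.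
by apply: seminormD; exact: DB.
Qed.

Lemma parallelogram u v : D u -> D v ->
  ip (u - v) (u - v) + ip (u + v) (u + v) = 2 * ip u u + 2 * ip v v.
Proof.
move=> Du Dv; have := ip_sqr_lin 1 Du Dv; have := ip_sqr_lin (-1) Du Dv.
by rewrite scaleN1r scale1r => -> ->; ring.
Qed.

(** Projection on the closure of [W]. Since [W] itself is not closed, the component of [f] along it
    is only a limit of elements of [W], obtained from a minimizing sequence for the distance to
    [f]. *)
Lemma orthogonal_decomposition (W : V -> Prop) f : D f ->
  (forall v, W v -> D v) -> W 0 -> (forall a u v, W u -> W v -> W (a *: u + v)) ->
  exists k, [/\ D k, forall v, W v -> ip k v = 0 &
    exists2 w : nat -> V, (forall m, W (w m)) & semicvg w (f - k)].
Proof.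
move=> Df WD W0 Wlin.
pose S := [set ip (f - v) (f - v) | v in W].
have hS : has_inf S.
  split; first by exists (ip (f - 0) (f - 0)), 0.
  by exists 0 => _ [v _ <-].
pose d := inf S.
have d_le v : W v -> d <= ip (f - v) (f - v).
  by move=> Wv; apply: (ge_inf hS.2); exists v.
have eps m : 0 < (m.+1%:R)^-1 :> R by rewrite invr_gt0.
have /choice[w Hw] m : exists v, W v /\ ip (f - v) (f - v) < d + (m.+1%:R)^-1.
  by have [_ [v Wv <-] ?] := inf_adherent (eps m) hS; exists v.
have Ww m := (Hw m).1; have Dw m := WD _ (Ww m).
have Dfw m : D (f - w m) by exact: DB.
(* The midpoint of [w p] and [w q] lies in [W], hence is at squared distance at least [d] from [f];
   the parallelogram law then bounds the gap by the two errors. *)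
have cauchy p q : ip (w p - w q) (w p - w q) <= 2 * (p.+1%:R)^-1 + 2 * (q.+1%:R)^-1.
  have := parallelogram (Dfw q) (Dfw p).
  have -> : f - w q - (f - w p) = w p - w q.
    by rewrite opprB addrC addrA subrK.
  have -> : f - w q + (f - w p) = 2 *: (f - 2^-1 *: (w p + w q)).
    rewrite scalerBr scalerA divff ?pnatr_eq0 // scale1r scaler_nat mulr2n.
    by rewrite addrACA -opprD [w q + _]addrC.
  have Wm : W (2^-1 *: (w p + w q)).
    rewrite -[_ *: _]addr0; apply: (Wlin _ _ _) => //.
    by rewrite -[w p]scale1r; exact: Wlin.
  have Dm := DB Df (WD _ Wm); have D2 := DZ 2 Dm.
  rewrite ipZ // (ipC _ (2 *: _)) ipZ //.
  have := d_le _ Wm; have := (Hw p).2; have := (Hw q).2.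
  by move: (p.+1%:R^-1 : R) (q.+1%:R^-1 : R) => x y; lra.
have arch (e : R) : 0 < e -> exists N, forall m, (N <= m)%N -> (m.+1%:R)^-1 < e.
  move=> e0; have [N _ HN] := near_infty_natSinv_lt (PosNum e0).
  by exists N => m Nm; exact: HN.
have [l Dl wl] : exists2 l, D l & semicvg w l.
  apply: complete => // e e0.
  have [|N HN] := arch (e ^+ 2 / 4); first by rewrite divr_gt0 // exprn_gt0.
  exists N => p q Np Nq; rewrite -(@ltr_pXn2r _ 2) // ?nnegrE ?seminorm_ge0 ?(ltW e0) //.
  rewrite sqr_seminorm; apply: le_lt_trans (cauchy p q) _.
  have := HN _ Np; have := HN _ Nq.
  by move: (p.+1%:R^-1 : R) (q.+1%:R^-1 : R) => x y; lra.
exists (f - l); split; first exact: DB.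
- move=> v Wv; have Dv := WD _ Wv.
  (* Moving [w m] by any multiple of [v] gains at most its error in optimality, and the discriminant
     turns this into near orthogonality. *)
  have small m : ip (f - w m) v ^+ 2 <= (m.+1%:R)^-1 * ip v v.
    apply: discriminant_le => // t.
    have /d_le : W (w m - t *: v) by rewrite addrC -scaleNr; exact: Wlin.
    have -> : f - (w m - t *: v) = f - w m + t *: v by rewrite opprB addrA addrAC.
    rewrite ip_sqr_lin //; have := (Hw m).2.
    by move: (m.+1%:R^-1 : R) => x; lra.
  apply/eqP; rewrite -normr_le0; apply/ler_addgt0Pr => e e0; rewrite add0r.
  have [N1 HN1] : exists N, forall m, (N <= m)%N -> `|ip (f - w m) v| <= e / 2.
    have [|N HN] := arch ((e / 2) ^+ 2 / (ip v v + 1)).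
      by rewrite divr_gt0 ?ltr_wpDl // exprn_gt0 // divr_gt0.
    exists N => m /HN H; rewrite -(@ler_pXn2r _ 2) // ?nnegrE ?normr_ge0 ?divr_ge0 ?(ltW e0) //.
    rewrite real_normK ?num_real //; apply: le_trans (small m) _.
    rewrite ltr_pdivlMr ?ltr_wpDl // in H; apply: le_trans (ltW H).
    by rewrite ler_wpM2l ?lerDl // invr_ge0.
  have [|N2 HN2] := wl (e / 2 / (seminorm v + 1)).
    by rewrite !divr_gt0 // ltr_wpDl // seminorm_ge0.
  pose m := maxn N1 N2.
  have -> : f - l = (f - w m) + (w m - l) by rewrite addrA subrK.
  rewrite ipD //; last exact: DB.
  apply: le_trans (ler_normD _ _) _; rewrite [e]splitr lerD ?HN1 ?leq_maxl //.
  apply: le_trans (ip_le_seminorm (DB (Dw m) Dl) Dv) _.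
  have /HN2 : (N2 <= m)%N by rewrite leq_maxr.
  have s1 : 0 < seminorm v + 1 by rewrite ltr_wpDl // seminorm_ge0.
  rewrite ltr_pdivlMr // => /ltW; apply: le_trans.
  by rewrite ler_wpM2l ?seminorm_ge0 // lerDl.
- by exists w => //; rewrite opprB addrC subrK.
Qed.

Lemma semicvg_ip (w : nat -> V) l u : (forall m, D (w m)) -> D l -> D u ->
  semicvg w l -> (fun m => ip u (w m)) @ \oo --> ip u l.
Proof.
move=> Dw Dl Du wl; apply/cvgrPdist_lt => e e0.
have s1 : 0 < seminorm u + 1 by rewrite ltr_wpDl // seminorm_ge0.
have [|N HN] := wl (e / (seminorm u + 1)); first by rewrite divr_gt0.
exists N => // m /= /HN; rewrite ltr_pdivlMr // => H.
rewrite distrC (ipC _ (w m)) (ipC _ l) -ipB // ipC.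
apply: le_lt_trans (ip_le_seminorm Du (DB (Dw m) Dl)) _.
rewrite mulrC; apply: le_lt_trans H.
by rewrite ler_wpM2l ?seminorm_ge0 // lerDl.
Qed.

Lemma semicvg_seminorm (w : nat -> V) l : (forall m, D (w m)) -> D l ->
  semicvg w l -> (fun m => seminorm (w m)) @ \oo --> seminorm l.
Proof.
move=> Dw Dl wl; apply/cvgrPdist_lt => e e0.
have [N HN] := wl e e0; exists N => // m /= /HN; apply: le_lt_trans.
rewrite ler_norml; apply/andP; split.
  have := seminormD (DB (Dw m) Dl) Dl; rewrite subrK; lra.
have := seminormD (DB Dl (Dw m)) (Dw m); rewrite subrK seminormBC //; lra.
Qed.

(** With [r = f - k] and [w = A u], symmetry gives [ip r w = ip h u]. Cauchy-Schwarz for the energy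
    form and the gap hypothesis yield [lam (ip r w)^2 <= (- ip r h) (ip w w)]. As [w] tends to [r],
    a factor [ip r r] can be cancelled. *)
Lemma spectral_gap_of_square (A : V -> V -> Prop) (lam : R) : 0 < lam ->
  (forall f h, A f h -> D f /\ D h) -> A 0 0 ->
  (forall a f h u v, A f h -> A u v -> A (a *: f + u) (a *: h + v)) ->
  (forall f h u v, A f h -> A u v -> ip f v = ip h u) ->
  (forall f h, D f -> D h -> (forall u v, A u v -> ip f v = ip h u) -> A f h) ->
  (forall f h, A f h -> 0 <= - ip f h) ->
  (forall f h, A f h -> lam * - ip f h <= ip h h) ->
  forall f h, A f h -> exists2 k, A k 0 & lam * ip (f - k) (f - k) <= - ip f h.
Proof.
move=> lam0 AD A00 Alin Asym Aadj Apos Agap f h Afh.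
have [Df Dh] := AD _ _ Afh.
have [|||k [Dk korth [w Ww wfk]]] := @orthogonal_decomposition
    (fun v => exists u, A u v) f Df.
- by move=> v [u /AD[]].
- by exists 0.
- by move=> a u v [u' Au] [v' Av]; exists (a *: u' + v'); exact: Alin.
(* Orthogonality to the range says that the adjoint sends [k] to zero, and the adjoint is [A]. *)
have Ak0 : A k 0.
  apply: Aadj => // u v Auv; rewrite korth; last by exists u.
  by have [Du _] := AD _ _ Auv; rewrite ip0.
exists k => //; set r := f - k; have Dr : D r by exact: DB.
have Arh : A r h.
  have := Alin (-1) _ _ _ _ Ak0 Afh.
  by rewrite scaleN1r addrC scaler0 add0r.
have -> : - ip f h = - ip r h.
  rewrite /r ipB // (korth h) ?subr0 //; by exists f.
have Dw m : D (w m) by have [u /AD[]] := Ww m.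
have bound m : lam * ip r (w m) ^+ 2 <= - ip r h * ip (w m) (w m).
  have [u Auw] := Ww m; have [Du _] := AD _ _ Auw.
  have rw : ip r (w m) = ip h u by exact: Asym Arh Auw.
  (* Positivity of the energy of [t u + r] for every [t], read as a discriminant condition. *)
  have CS : ip r (w m) ^+ 2 <= - ip r h * - ip u (w m).
    rewrite -[X in X ^+ 2]opprK sqrrN; apply: discriminant_le; first exact: Apos.
    move=> t; have := Apos _ _ (Alin t _ _ _ _ Auw Arh).
    have Dtwh : D (t *: w m + h) by exact: Dlin.
    rewrite iplin // (ipC u) (ipC r) iplin // iplin // (ipC (w m) r) (ipC (w m) u).
    rewrite -rw (ipC h r) => H; apply: le_trans H _.
    by rewrite le_eqVlt; apply/orP; left; apply/eqP; ring.
  apply: le_trans (ler_wpM2l (ltW lam0) CS) _.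
  by rewrite mulrCA ler_wpM2l ?Apos //; exact: Agap.
have c1 : (fun m => lam * ip r (w m) ^+ 2) @ \oo --> lam * ip r r ^+ 2.
  have c := semicvg_ip Dw Dr Dr wfk.
  by apply: cvgM; [exact: cvg_cst|rewrite expr2; under eq_fun do rewrite expr2; exact: cvgM].
have c2 : (fun m => - ip r h * ip (w m) (w m)) @ \oo --> - ip r h * ip r r.
  have c := semicvg_seminorm Dw Dr wfk.
  apply: cvgM; first exact: cvg_cst.
  rewrite -sqr_seminorm expr2; under eq_fun do rewrite -sqr_seminorm expr2.
  exact: cvgM.
have : lam * ip r r ^+ 2 <= - ip r h * ip r r.
  by apply: (ler_cvg_to c1 c2); exact: nearW.
have [->|r0] := eqVneq (ip r r) 0; first by rewrite !mulr0 => _; exact: (Apos _ _ Arh).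
by rewrite expr2 mulrA ler_pM2r // lt_neqAle eq_sym r0 ip_ge0.
Qed.

End SemiHilbert.

(** * Uniform boundedness and semigroups modulo null vectors *)

Section UniformBoundedness.
Variables (R : realType) (V : lmodType R) (D : V -> Prop) (ip : V -> V -> R).
Hypothesis D0 : D 0.
Hypothesis Dlin : forall a u v, D u -> D v -> D (a *: u + v).
Hypothesis ipC : forall u v, ip u v = ip v u.
Hypothesis iplin : forall a u v w, D u -> D v -> D w ->
  ip (a *: u + v) w = a * ip u w + ip v w.
Hypothesis ip_ge0 : forall u, 0 <= ip u u.
Hypothesis complete : forall u : nat -> V, (forall m, D (u m)) ->
  (forall e : R, 0 < e -> exists N, forall p q, (N <= p)%N -> (N <= q)%N ->
     seminorm ip (u p - u q) < e) ->
  exists2 l, D l & semicvg ip u l.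

Let nrm := seminorm ip.
Let nD := seminormD D0 Dlin ipC iplin ip_ge0.
Let nZ := seminormZ D0 Dlin ipC iplin.
Let n0 := seminorm0 D0 iplin.
Let nT := seminorm_triangle D0 Dlin ipC iplin ip_ge0.
Let nBC := seminormBC D0 Dlin ipC iplin.
Let DB' := DB Dlin.
Let DD' := DD Dlin.
Let DZ' := DZ D0 Dlin.
Let nge0 : forall u, 0 <= nrm u := seminorm_ge0 ip.

(* Linear maps are only required to be linear modulo vectors of norm zero. *)
Definition sublinear_op (T : V -> V) :=
  [/\ forall u, D u -> D (T u),
      forall a u v, D u -> D v -> nrm (T (a *: u + v) - (a *: T u + T v)) = 0
    & exists C : R, forall u, D u -> nrm (T u) <= C * nrm u].

Lemma eq_seminorm u v : D u -> D v -> nrm (u - v) = 0 -> nrm u = nrm v.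
Proof.
move=> Du Dv uv; apply/eqP; rewrite eq_le; apply/andP; split.
  by have := nD (DB' Du Dv) Dv; rewrite subrK -/nrm uv add0r.
by have := nD (DB' Dv Du) Du; rewrite subrK (nBC Dv Du) -/nrm uv add0r.
Qed.

Lemma op_sub T u v : sublinear_op T -> D u -> D v ->
  nrm (T (u - v)) = nrm (T u - T v).
Proof.
move=> [TD Tlin _] Du Dv; apply: eq_seminorm; first exact/TD/DB'.
  by apply: DB'; exact: TD.
have := Tlin (-1) _ _ Dv Du; rewrite !scaleN1r.
by rewrite [- v + u]addrC [- T v + T u]addrC.
Qed.

(** Baire's argument made explicit: without a common bound, every ball contains a smaller one on
    which some [T k] is at least [m]. The centres of the nested balls converge by completeness, and
    pointwise boundedness fails at the limit. *)
Lemma uniform_boundedness (T : nat -> V -> V) : (forall k, sublinear_op (T k)) ->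
  (forall u, D u -> exists B : R, forall k, nrm (T k u) <= B) ->
  exists2 C : R, 0 <= C & forall k u, D u -> nrm (T k u) <= C * nrm u.
Proof.
move=> Top Tpt; apply: contrapT => unb.
have big C : 0 <= C -> exists k u, D u /\ C * nrm u < nrm (T k u).
  move=> C0; apply: contrapT => H; apply: unb; exists C => // k u Du.
  rewrite leNgt; apply/negP => lt; apply: H; by exists k, u.
have step (m : nat) (b : V * R) : exists c : V * R, D b.1 -> 0 < b.2 ->
  [/\ D c.1, 0 < c.2, c.2 <= b.2 / 2, nrm (c.1 - b.1) + c.2 <= b.2
     & exists k, forall z, D z -> nrm (z - c.1) <= c.2 -> m%:R <= nrm (T k z)].
  case: b => x r; have [[Dx r0]|H] := pselect (D x /\ 0 < r); last first.
    by exists (x, r) => Dx r0; case: H.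
  (* Rescaling to norm [r / 2] a vector that violates the bound [C] yields a [g] with [nrm (T k g)]
     above [m + 1]. *)
  pose C := 2 * (m%:R + 1) / r.
  have C0 : 0 <= C by rewrite divr_ge0 ?(ltW r0) // mulr_ge0 // addr_ge0.
  have [k [f [Df Hf]]] := big C C0; have [TD Tlin [B HB]] := Top k.
  have f0 : 0 < nrm f.
    rewrite lt_neqAle nge0 andbT eq_sym; apply/eqP => nf0.
    by have := HB _ Df; rewrite nf0 mulr0 leNgt; move: Hf; rewrite nf0 mulr0 => ->.
  pose g := (r / 2 / nrm f) *: f.
  have Dg : D g by exact: DZ'.
  have ng : nrm g = r / 2.
    by rewrite /nrm nZ // ger0_norm ?divr_ge0 ?(ltW r0) ?(ltW f0) // divfK // gt_eqF.
  have Tg : m%:R + 1 < nrm (T k g).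
    have E : nrm (T k g) = r / 2 / nrm f * nrm (T k f).
      have := Tlin (r / 2 / nrm f) _ _ Df D0; rewrite addr0 -/g => H.
      have Tf0 : nrm (T k 0) = 0.
        by apply/eqP; rewrite eq_le nge0 andbT; have := HB 0 D0; rewrite /nrm n0 mulr0.
      rewrite (eq_seminorm (TD _ Dg) _ H); last by apply: DD'; [apply: DZ'|]; exact: TD.
      rewrite (@eq_seminorm _ ((r / 2 / nrm f) *: T k f)).
      - by rewrite /nrm nZ ?ger0_norm ?divr_ge0 ?(ltW r0) ?(ltW f0) //; exact: TD.
      - by apply: DD'; [apply: DZ'|]; exact: TD.
      - by apply: DZ'; exact: TD.
      - by rewrite [_ + T k 0]addrC addrK.
    rewrite E; have -> : m%:R + 1 = r / 2 / nrm f * (C * nrm f).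
      by rewrite /C; field; rewrite !gt_eqF.
    by rewrite ltr_pM2l // !divr_gt0.
  (* Since [2 g] is the difference of [x + g] and [x - g], the image of one of the two has norm
     above [m + 1]. *)
  have [y [Dy yx Ty]] : exists y, [/\ D y, nrm (y - x) = r / 2 & m%:R + 1 < nrm (T k y)].
    have [Tp|Tp] := ltP (m%:R + 1) (nrm (T k (x + g))).
      by exists (x + g); split=> //; [exact: DD'|rewrite [x + g]addrC addrK].
    exists (x - g); split; first exact: DB'.
      by rewrite addrAC subrr -ng /nrm nBC // subr0.
    rewrite ltNge; apply/negP => Tm.
    have E2 : nrm (T k (2 *: g)) = nrm (T k (x + g) - T k (x - g)).
      have -> : 2 *: g = (x + g) - (x - g).
        by rewrite opprB addrC addrA subrK scaler_nat mulr2n.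
      by apply: op_sub; [exact: Top|exact: DD'|exact: DB'].
    have E3 : nrm (T k (2 *: g)) = 2 * nrm (T k g).
      have := Tlin 1 _ _ Dg Dg; rewrite !scale1r => H.
      rewrite scaler_nat mulr2n (eq_seminorm (TD _ (DD' Dg Dg)) _ H); last first.
        by apply: DD'; exact: TD.
      have -> : T k g + T k g = 2 *: T k g by rewrite scaler_nat mulr2n.
      by rewrite /nrm nZ ?ger0_norm //; exact: TD.
    have := nT (TD _ (DD' Dx Dg)) D0 (TD _ (DB' Dx Dg)).
    rewrite subr0 sub0r -[X in _ <= _ + X](_ : nrm (T k (x - g)) = _); last first.
      by rewrite /nrm -[- _ in RHS]sub0r nBC ?subr0 //; exact/TD/DB'.
    rewrite -/nrm -E2 E3; move: Tp Tm Tg; rewrite -/nrm; lra.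
  have B1 : 0 < `|B| + 1 by rewrite ltr_wpDl.
  (* Within this radius [T k] varies by at most 1, and the new ball stays inside the old one. *)
  pose s := Num.min (r / 2) ((`|B| + 1)^-1).
  have s0 : 0 < s by rewrite lt_min divr_gt0 // invr_gt0.
  exists (y, s) => _ _; split=> //=.
  - by rewrite ge_min lexx.
  - rewrite yx; have : s <= r / 2 by rewrite ge_min lexx.
    lra.
  - exists k => z Dz zy.
    have sB : s <= (`|B| + 1)^-1 by rewrite ge_min lexx orbT.
    have Tzy : nrm (T k z - T k y) <= 1.
      rewrite -op_sub //; apply: le_trans (HB _ (DB' Dz Dy)) _.
      rewrite -(@divff _ (`|B| + 1)) ?gt_eqF //.
      apply: le_trans (_ : (`|B| + 1) * nrm (z - y) <= _).
        by rewrite ler_wpM2r // (le_trans (ler_norm B)) // lerDl.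
      by rewrite ler_wpM2l ?(ltW B1) //; exact: le_trans zy sB.
    have := nD (TD _ Dz) (DB' (TD _ Dy) (TD _ Dz)).
    rewrite addrC subrK (nBC (TD _ Dy) (TD _ Dz)) -/nrm.
    move: Tzy Ty; rewrite -/nrm; lra.
have /choice[next Hnext] : forall mb : nat * (V * R), exists c : V * R,
    D mb.2.1 -> 0 < mb.2.2 ->
  [/\ D c.1, 0 < c.2, c.2 <= mb.2.2 / 2, nrm (c.1 - mb.2.1) + c.2 <= mb.2.2
     & exists k, forall z, D z -> nrm (z - c.1) <= c.2 -> mb.1%:R <= nrm (T k z)].
  by move=> [m b]; exact: step.
pose b := fix b m : V * R := if m is m'.+1 then next (m', b m') else (0, 1).
have bD m : D (b m).1 /\ 0 < (b m).2.
  elim: m => [|m [IH1 IH2]]; first by split; [exact: D0|exact: ltr01].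
  by have [? ? _ _ _] := Hnext (m, b m) IH1 IH2.
have bS m := Hnext (m, b m) (bD m).1 (bD m).2.
have b2 m : (b m).2 <= 2^-1 ^+ m.
  elim: m => [|m IH]; first by rewrite expr0.
  have [_ _ h _ _] := bS m; apply: le_trans h _.
  by rewrite exprSr ler_wpM2r.
have nested m p : nrm ((b (m + p)%N).1 - (b m).1) + (b (m + p)%N).2 <= (b m).2.
  elim: p => [|p IH]; first by rewrite addn0 subrr /nrm n0 add0r.
  rewrite addnS; have [_ _ _ h _] := bS (m + p)%N; rewrite /= in h.
  have := nT (bD (m + p).+1).1 (bD (m + p)%N).1 (bD m).1; rewrite -/nrm => h'.
  by move: IH h h'; rewrite /= ; lra.
have near_center m p q : (m <= p)%N -> (m <= q)%N ->
    nrm ((b p).1 - (b q).1) <= 2 * (b m).2.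
  move=> mp mq; have h1 := nested m (p - m)%N; have h2 := nested m (q - m)%N.
  rewrite subnKC // in h1; rewrite subnKC // in h2.
  have := nT (bD p).1 (bD m).1 (bD q).1; rewrite (nBC (bD m).1 (bD q).1) -/nrm.
  have [_ pp] := bD p; have [_ qq] := bD q; lra.
have [l Dl bl] : exists2 l, D l & semicvg ip (fun m => (b m).1) l.
  apply: complete => [m|e e0]; first exact: (bD m).1.
  have [N HN] : exists N, 2 * 2^-1 ^+ N < e.
    have e2 : 0 < e / 2 by rewrite divr_gt0.
    have : (fun m => 2^-1 ^+ m : R) @ \oo --> (0 : R).
      by apply: cvg_expr; rewrite ger0_norm // invf_lt1 // ltr1n.
    move=> /cvgrPdist_lt/(_ _ e2)[N _ /(_ N (leqnn N))] /=.
    rewrite sub0r normrN ger0_norm ?exprn_ge0 // => H; exists N; move: H; lra.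
  exists N => p q Np Nq; apply: le_lt_trans HN.
  by apply: le_trans (near_center _ _ _ Np Nq) _; rewrite ler_wpM2l.
have in_ball m : nrm (l - (b m).1) <= (b m).2.
  apply/ler_addgt0Pr => e e0; have [N HN] := bl e e0.
  pose p := maxn N m; have /HN := leq_maxl N m : (N <= p)%N.
  have := nested m (p - m)%N; rewrite subnKC ?leq_maxr // => h1.
  have [_ h2] := bD p; have := nT Dl (bD p).1 (bD m).1.
  rewrite (nBC Dl (bD p).1) -/nrm; lra.
have [B HB] := Tpt l Dl.
pose m := (Num.truncn `|B|).+1.
have Bm : B < m%:R by apply: le_lt_trans (ler_norm B) _; rewrite /m truncnS_gt.
have [_ _ _ _ [k Hk]] := bS m.
have := Hk l Dl (in_ball m.+1); rewrite leNgt => /negP; apply.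
exact: le_lt_trans (HB k) Bm.
Qed.

(** A zero derivative at time 0 makes the orbit constant: cut [[0, t]] into small steps, each of
    which moves [f] by little compared with its length, and transport the errors by operators
    bounded uniformly for small times. *)
Lemma semigroup_fixed (P : R -> V -> V) f :
  (forall t, 0 <= t -> sublinear_op (P t)) ->
  (forall u, D u -> nrm (P 0 u - u) = 0) ->
  (forall s t u, 0 <= s -> 0 <= t -> D u -> nrm (P (s + t) u - P s (P t u)) = 0) ->
  (forall u, D u -> forall e : R, 0 < e ->
     exists2 d : R, 0 < d & forall t, 0 < t -> t < d -> nrm (P t u - u) < e) ->
  D f -> (forall e : R, 0 < e ->
     exists2 d : R, 0 < d & forall t, 0 < t -> t < d -> nrm (P t f - f) <= t * e) ->
  forall t, 0 <= t -> nrm (P t f - f) = 0.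
Proof.
move=> Pop P0 Padd Pcont Df Pgen.
have PD t u : 0 <= t -> D u -> D (P t u) by move=> t0; have [+ _ _] := Pop t t0; exact.
(* Otherwise there are times tending to 0 whose operators have unbounded norms, although strong
   continuity bounds them on each vector. *)
have [del del0 [C C0 HC]] : exists2 del : R, 0 < del & exists2 C : R, 0 <= C &
    forall t u, 0 <= t -> t <= del -> D u -> nrm (P t u) <= C * nrm u.
  apply: contrapT => unb.
  have /choice[tau Htau] k : exists t : R, [/\ 0 <= t, t <= k.+1%:R^-1 &
      exists2 u, D u & k%:R * nrm u < nrm (P t u)].
    apply: contrapT => H; apply: unb; exists k.+1%:R^-1; first by rewrite invr_gt0.
    exists k%:R => // t u t0 tk Du; rewrite leNgt; apply/negP => lt.
    by apply: H; exists t; split=> //; exists u.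
  have [|u Du|C C0 HC] := @uniform_boundedness (fun k => P (tau k)).
  - by move=> k; apply: Pop; have [] := Htau k.
  - have [d d0 Hd] := Pcont u Du 1 ltr01.
    have [N HN] : exists N, forall k, (N <= k)%N -> k.+1%:R^-1 < d.
      by have [N _ HN] := near_infty_natSinv_lt (PosNum d0); exists N => k Nk; exact: HN.
    (* A bound for the finitely many times too large for strong continuity to control. *)
    pose B0 := \sum_(k < N) nrm (P (tau k) u).
    exists (B0 + (nrm u + 1)) => k; have [t0 tk _] := Htau k.
    have [kN|Nk] := ltnP k N.
      rewrite -[leLHS]addr0 lerD ?addr_ge0 // /B0 (bigD1 (Ordinal kN)) //=.
      by rewrite lerDl sumr_ge0.
    rewrite -[leLHS]add0r lerD ?sumr_ge0 //.
    have : nrm (P (tau k) u - u) <= 1.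
      move: t0; rewrite le_eqVlt => /predU1P[<-|t0]; first by rewrite P0.
      by apply/ltW/Hd => //; apply: le_lt_trans tk (HN _ Nk).
    have := nD (DB' (PD _ _ t0 Du) Du) Du; rewrite subrK -/nrm; lra.
  - pose k := (Num.truncn C).+1.
    have Ck : C <= k%:R by apply: ltW; rewrite truncnS_gt.
    have [_ _ [u Du]] := Htau k; rewrite ltNge => /negP; apply.
    by apply: le_trans (HC k u Du) _; rewrite ler_wpM2r.
have fixed_small t : 0 <= t -> t <= del -> nrm (P t f - f) = 0.
  move=> t0 td; apply/eqP; rewrite eq_le nge0 andbT.
  apply/ler_addgt0Pr => e e0; rewrite add0r.
  move: t0; rewrite le_eqVlt => /predU1P[<-|t0]; first by rewrite P0 // ltW.
  (* The steps have total length [t] and each error is amplified by at most [C + 1], so the sum is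
     [e]. *)
  pose e' := e / (t * (C + 1)).
  have C1 : 0 < C + 1 by rewrite ltr_wpDl.
  have e'0 : 0 < e' by rewrite divr_gt0 // mulr_gt0.
  have [d d0 Hd] := Pgen e' e'0.
  have [N HN] : exists N, t / N.+1%:R < d.
    have [N _ HN] := near_infty_natSinv_lt (PosNum (divr_gt0 d0 t0)).
    exists N; have := HN N (leqnn N); rewrite /= ltr_pdivlMr // mulrC; exact.
  pose h := t / N.+1%:R; have h0 : 0 < h by rewrite divr_gt0.
  have Nh : N.+1%:R * h = t by rewrite /h mulrC divfK.
  have Ph : nrm (P h f - f) <= h * e' by exact: Hd.
  have DPh : D (P h f) by apply: PD => //; exact: ltW.
  have iter k : (k <= N.+1)%N -> nrm (P (k%:R * h) f - f) <= k%:R * (C + 1) * (h * e').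
    elim: k => [_|k IH kN]; first by rewrite !mul0r P0.
    have kh0 : 0 <= k%:R * h by rewrite mulr_ge0 // ltW.
    have khd : k%:R * h <= del.
      apply: le_trans td; rewrite -Nh ler_wpM2r ?(ltW h0) // ler_nat; exact: ltnW.
    have E : k.+1%:R * h = k%:R * h + h by rewrite -natr1 mulrDl mul1r.
    have D1 : D (P (k%:R * h) (P h f)) by exact: PD.
    have D2 : D (P (k%:R * h) f) by exact: PD.
    have D3 : D (P (k.+1%:R * h) f) by apply: PD => //; rewrite mulr_ge0 // ltW.
    have s1 := Padd _ _ _ kh0 (ltW h0) Df; rewrite -E in s1.
    have s2 : nrm (P (k%:R * h) (P h f) - P (k%:R * h) f) <= (C + 1) * (h * e').
      rewrite -op_sub //; last exact: Pop.
      apply: le_trans (HC _ _ kh0 khd (DB' DPh Df)) _.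
      by rewrite ler_pM // lerDl.
    have := nT D3 D1 Df; have := nT D1 D2 Df; have := IH (ltnW kN).
    have -> : k.+1%:R * (C + 1) * (h * e') = k%:R * (C + 1) * (h * e') + (C + 1) * (h * e').
      by rewrite -natr1; ring.
    rewrite -/nrm s1; move: s2.
    move: (k%:R * (C + 1) * _) ((C + 1) * _) => a b; lra.
  have := iter N.+1 (leqnn _); rewrite Nh => H; apply: le_trans H _.
  rewrite mulrAC mulrA Nh /e' le_eqVlt; apply/orP; left; apply/eqP.
  by field; rewrite !gt_eqF.
(* The uniform bound holds up to [del] only; larger times are sums of times below it. *)
have add_fixed s t : 0 <= s -> 0 <= t -> nrm (P s f - f) = 0 -> nrm (P t f - f) = 0 ->
    nrm (P (s + t) f - f) = 0.
  move=> s0 t0 Hs Ht; apply/eqP; rewrite eq_le nge0 andbT.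
  have Dst : D (P (s + t) f) by apply: PD; rewrite ?addr_ge0.
  have DsPt : D (P s (P t f)) by exact: (PD _ _ s0 (PD _ _ t0 Df)).
  have DPs := PD s f s0 Df; have DPt := PD t f t0 Df.
  have [_ _ [B HB]] := Pop s s0.
  have := HB _ (DB' DPt Df); rewrite Ht mulr0 op_sub //; last exact: Pop.
  have := nT Dst DsPt Df; have := nT DsPt DPs Df; rewrite -/nrm Padd // Hs.
  lra.
move=> t t0; pose N := (Num.truncn (t / del)).+1.
have tN : t / N%:R <= del.
  rewrite ler_pdivrMr ?ltr0n // mulrC -ler_pdivrMr //; apply: ltW.
  by rewrite truncnS_gt.
have sN0 : 0 <= t / N%:R by rewrite divr_ge0.
have : forall k, nrm (P (k%:R * (t / N%:R)) f - f) = 0.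
  elim=> [|k IH]; first by rewrite mul0r P0.
  rewrite -natr1 mulrDl mul1r; apply: add_fixed => //; first by rewrite mulr_ge0.
  exact: fixed_small.
by move=> /(_ N); rewrite mulrC divfK // pnatr_eq0.
Qed.

End UniformBoundedness.

(** * Square integrable functions as a semi-Hilbert space *)

Section L2Space.
Context d (T : measurableType d) (R : realType) (mu : probability T R).
Implicit Types f g h : T -> R.

Definition ip f g : R := \int[mu]_x (f x * g x).

Lemma L2_measurable f : L2 mu f -> measurable_fun [set: T] f.
Proof. by rewrite /L2 inE => /andP[]; rewrite inE. Qed.

Lemma L2norm_sqr f : L2norm mu f = ((\int[mu]_x (f x * f x)%:E) `^ 2^-1)%E.
Proof.
rewrite /L2norm unlock /=; congr (_ `^ _)%E; apply: eq_integral => x _.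
by rewrite /= powR_mulrn ?normr_ge0 // real_normK ?num_real // expr2.
Qed.

Lemma L2P f : L2 mu f <->
  measurable_fun [set: T] f /\ (\int[mu]_x (f x * f x)%:E < +oo)%E.
Proof.
split=> [L2f|[mf fy]].
  split; first exact: L2_measurable.
  have /integrableP[_] := Lfun2_integrable_sqr L2f.
  apply: le_lt_trans; rewrite le_eqVlt; apply/orP; left; apply/eqP.
  by apply: eq_integral => x _; rewrite /= ger0_norm ?sqr_ge0 // expr2.
rewrite /L2 inE; apply/andP; rewrite inE; split=> //; rewrite inE /= /finite_norm.
by rewrite -/(L2norm mu f) L2norm_sqr poweR_lty.
Qed.

Lemma L2_mul_integrable f g : L2 mu f -> L2 mu g ->
  mu.-integrable [set: T] (EFin \o (fun x => f x * g x)).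
Proof. by move=> Lf Lg; apply/Lfun1_integrable; exact: Lfun2_mul_Lfun1. Qed.

Lemma L2_lin a f g : L2 mu f -> L2 mu g -> L2 mu (fun x => a * f x + g x).
Proof.
move=> Lf Lg; have p1 : (1 <= 2%:E :> \bar R)%E by rewrite lee_fin ler1n.
apply: (Lfun_addr_closed mu p1).2 => //.
have -> : (fun x => a * f x) = (a \o* f) by apply/funext => x; rewrite /= mulrC.
by apply: Lfun_scale => //; rewrite ler1n.
Qed.

Lemma L2_cst a : L2 mu (cst a).
Proof. exact: Lfun_cst. Qed.

Lemma ip_sym f g : ip f g = ip g f.
Proof. by apply: eq_Rintegral => x _; rewrite mulrC. Qed.

Lemma ip_lin a f g h : L2 mu f -> L2 mu g -> L2 mu h ->
  ip (fun x => a * f x + g x) h = a * ip f h + ip g h.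
Proof.
move=> Lf Lg Lh; rewrite /ip -RintegralZl //; last exact: L2_mul_integrable.
rewrite -RintegralD //; last 2 first.
- have := L2_mul_integrable (L2_lin a Lf (L2_cst 0)) Lh.
  by apply: eq_integrable => // x _ /=; rewrite addr0 mulrA.
- exact: L2_mul_integrable.
by apply: eq_Rintegral => x _; rewrite mulrDl mulrA.
Qed.

Lemma ip_pos f : 0 <= ip f f.
Proof. by apply: Rintegral_ge0 => x _; rewrite -expr2 sqr_ge0. Qed.

(* [T -> R^o] is the left module of real functions on [T]. *)
Let V : lmodType R := (T -> R^o : Type).

Lemma L2_lin_mod (a : R) (u v : V) : L2 mu u -> L2 mu v -> L2 mu (a *: u + v).
Proof. exact: L2_lin. Qed.

Lemma ip_lin_mod (a : R) (u v w : V) : L2 mu u -> L2 mu v -> L2 mu w ->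
  ip (a *: u + v) w = a * ip u w + ip v w.
Proof. exact: ip_lin. Qed.

Lemma L2_0 : L2 mu (0 : V).
Proof. exact: L2_cst. Qed.

Lemma L2_sub (u v : V) : L2 mu u -> L2 mu v -> L2 mu (u - v).
Proof. exact: (DB L2_lin_mod). Qed.

Definition nrm : V -> R := seminorm (ip : V -> V -> R).

Lemma ip_int f : L2 mu f -> (\int[mu]_x (f x * f x)%:E)%E = (ip f f)%:E.
Proof.
move=> Lf; rewrite /ip /Rintegral fineK //.
exact: integrable_fin_num (L2_mul_integrable Lf Lf).
Qed.

Lemma L2normE (f : V) : L2 mu f -> L2norm mu f = (nrm f)%:E.
Proof.
move=> Lf; rewrite L2norm_sqr ip_int // poweR_EFin powR12_sqrt //; exact: ip_pos.
Qed.

Lemma L2norm_lty (f : V) (C : R) : measurable_fun [set: T] f ->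
  (\int[mu]_x (f x * f x)%:E <= C%:E)%E -> L2 mu f /\ ip f f <= C.
Proof.
move=> mf fC; have Lf : L2 mu f by apply/L2P; split=> //; exact: le_lt_trans fC (ltry _).
by split=> //; rewrite -lee_fin -ip_int.
Qed.

(** Riesz-Fischer: a subsequence with consecutive distances below [2^-k] has an integrable sum of
    increments, hence converges almost everywhere, and Fatou's lemma makes its limit a limit in
    norm. *)
Lemma L2_complete (u : nat -> V) : (forall m, L2 mu (u m)) ->
  (forall e : R, 0 < e -> exists N, forall p q, (N <= p)%N -> (N <= q)%N ->
     nrm (u p - u q) < e) ->
  exists2 l : V, L2 mu l & semicvg (ip : V -> V -> R) u l.
Proof.
move=> Lu Cu.
have half_gt0 k : 0 < 2^-1 ^+ k :> R by rewrite exprn_gt0 // invr_gt0.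
have /choice[n Hn] k := Cu _ (half_gt0 k).
(* Running maxima make the extracted indices nondecreasing. *)
pose N k := (\max_(j < k.+1) n j)%N.
have nN k : (n k <= N k)%N by exact: (leq_bigmax (@ord_max k)).
have NS k j : (k <= j)%N -> (N k <= N j)%N.
  move=> kj; apply/bigmax_leqP => i _.
  by apply: (leq_bigmax (widen_ord (_ : (k.+1 <= j.+1)%N) i)).
pose v k : V := u (N k).
have Lv k : L2 mu (v k) by exact: Lu.
have mv k := L2_measurable (Lv k).
pose dd k x : R := `|v k.+1 x - v k x|.
have mdd k : measurable_fun [set: T] (dd k).
  by apply: measurableT_comp => //; exact: measurable_funB.
have dd0 k x : 0 <= dd k x by exact: normr_ge0.
(* On a probability space the L^1 norm is at most the L^2 norm, by Cauchy-Schwarz against 1. *)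
have dd_int k : (\int[mu]_x (dd k x)%:E <= (2^-1 ^+ k)%:E)%E.
  have ddE x : dd k x * dd k x = (v k.+1 - v k) x * (v k.+1 - v k) x.
    by rewrite /dd -normrM ger0_norm // -expr2 sqr_ge0.
  have Ldd : L2 mu (dd k).
    apply/L2P; split=> //; have /L2P[_] := L2_sub (Lv k.+1) (Lv k).
    by under eq_integral do rewrite -ddE.
  have -> : (\int[mu]_x (dd k x)%:E)%E = (ip (dd k) (cst 1))%:E.
    rewrite /ip /Rintegral fineK; first by apply: eq_integral => x _; rewrite mulr1.
    exact: integrable_fin_num (L2_mul_integrable Ldd (L2_cst 1)).
  rewrite lee_fin; apply: le_trans (ler_norm _) _.
  apply: le_trans (ip_le_seminorm L2_0 L2_lin_mod ip_sym ip_lin_mod ip_pos Ldd (L2_cst 1)) _.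
  have -> : seminorm (ip : V -> V -> R) (cst 1) = 1.
    rewrite /seminorm /ip; under eq_Rintegral do rewrite mulr1.
    by rewrite Rintegral_cst //= probability_setT mulr1 sqrtr1.
  rewrite mulr1; apply/ltW.
  have -> : seminorm (ip : V -> V -> R) (dd k) = nrm (v k.+1 - v k).
    by congr Num.sqrt; apply: eq_Rintegral => x _; rewrite ddE.
  by apply: Hn; [exact: leq_trans (nN _) (NS _ _ (leqnSn _))|exact: nN].
pose S x := (\sum_(k <oo) (dd k x)%:E)%E.
have S0 x : (0 <= S x)%E by apply: nneseries_ge0 => k _ _; rewrite lee_fin dd0.
have mS : measurable_fun [set: T] S.
  apply: ge0_emeasurable_sum => [k x _|k _]; first by rewrite lee_fin dd0.
  exact/measurable_EFinP.
have intS : (\int[mu]_x S x < +oo)%E.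
  rewrite integral_nneseries //; last 2 first.
  - by move=> k; exact/measurable_EFinP.
  - by move=> k x _; rewrite lee_fin dd0.
  apply: (@le_lt_trans _ _ (\sum_(k <oo) (2^-1 ^+ k)%:E)%E).
    apply: lee_nneseries => // k _ _; by apply: integral_ge0 => x _; rewrite lee_fin dd0.
  have c : (fun m => (\sum_(0 <= k < m) (2^-1 ^+ k)%:E)%E) @ \oo --> (2%:E : \bar R).
    under eq_fun do rewrite sumEFin.
    apply/cvg_EFin; first exact: nearW.
    rewrite [X in X @ _ --> _](_ : _ = series (geometric 1 2^-1)); last first.
      by apply/funext => m; rewrite /series /=; apply: eq_bigr => k _; rewrite mul1r.
    have e2 : 1 / (1 - 2^-1) = 2 :> R by field.
    rewrite -[X in _ --> X]e2.
    by apply: cvg_geometric_series; rewrite ger0_norm ?invr_ge0 // invf_lt1 // ltr1n.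
  by rewrite (cvg_lim _ c) // ltry.
pose E := [set x | S x < +oo]%E.
have mE : measurable E.
  by have := emeasurable_fun_infty_o measurableT mS +oo%E; rewrite setTI.
have muE : mu (~` E) = 0%E.
  have iS : mu.-integrable [set: T] S.
    apply/integrableP; split=> //; apply: le_lt_trans intS.
    by under eq_integral do rewrite gee0_abs //.
  have [A [mA A0 sub]] := integrable_ae measurableT iS.
  apply/eqP; rewrite eq_le measure_ge0 andbT -A0; apply: le_measure; rewrite ?inE //.
    exact: measurableC.
  move=> x /= nE; apply: sub => /= /(_ I) fS; apply: nE.
  by rewrite /E /= -ge0_fin_numE.
(* Killing the null set of divergence makes the sequence converge everywhere, so that its limit is
   measurable. *)
pose v' k x := v k x * \1_E x.
have mv' k : measurable_fun [set: T] (v' k) by apply: measurable_funM.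
have cv' x : cvgn (v' ^~ x).
  rewrite /v' indicE; have [xE|xE] := boolP (x \in E); last first.
    by under eq_fun do rewrite mulr0; exact: is_cvg_cst.
  under eq_fun do rewrite mulr1.
  have -> : (v ^~ x) = (fun k => v 0%N x + series (telescope (v ^~ x)) k).
    by apply/funext => k; exact: (eq_sum_telescope (v ^~ x)).
  apply: is_cvgD; first exact: is_cvg_cst.
  apply: normed_cvg.
  have -> : [normed series (telescope (v ^~ x))] = (fun m => \sum_(0 <= k < m) dd k x) by [].
  apply: nondecreasing_is_cvgn.
    by apply/nondecreasing_seqP => k; rewrite big_nat_recr //= lerDl.
  exists (fine (S x)) => _ [k _ <-]; rewrite -lee_fin fineK; last first.
    by rewrite ge0_fin_numE //; rewrite inE in xE.
  by rewrite -sumEFin; apply: nneseries_lim_ge => // i _; rewrite lee_fin dd0.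
pose l x : R := limn (v' ^~ x).
have ml : measurable_fun [set: T] l.
  by apply: (measurable_fun_cvg mv') => x _; exact: cv'.
have v'v k : v' k = v k %[ae mu].
  exists (~` E); split=> //; first exact: measurableC.
  move=> x /= H xE; apply: H => _.
  by rewrite /v' indicE mem_set // mulr1.
(* Fatou's lemma carries the Cauchy estimate to the pointwise limit, before the latter is known to
   be square integrable. *)
have close p K : (forall k, (K <= k)%N -> nrm (v k - u p) <= 2^-1 ^+ K) ->
    (\int[mu]_x ((l x - u p x) * (l x - u p x))%:E <= (2^-1 ^+ K * 2^-1 ^+ K)%:E)%E.
  move=> HK.
  pose F k x := ((v' (k + K)%N x - u p x) * (v' (k + K)%N x - u p x))%:E.
  have mF k : measurable_fun [set: T] (F k).
    apply/measurable_EFinP; apply: measurable_funM; apply: measurable_funB => //;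
    exact: L2_measurable.
  have F0 k x : [set: T] x -> (0 <= F k x)%E by move=> _; rewrite lee_fin -expr2 sqr_ge0.
  have FK k : (\int[mu]_x F k x <= (2^-1 ^+ K * 2^-1 ^+ K)%:E)%E.
    have -> : (\int[mu]_x F k x)%E = (ip (v (k + K)%N - u p) (v (k + K)%N - u p))%:E.
      rewrite -ip_int; last exact: L2_sub.
      apply: ae_eq_integral => //.
        apply/measurable_EFinP; apply: measurable_funM; apply: measurable_funB => //;
        exact: L2_measurable.
      apply: filterS (v'v (k + K)%N) => x H _; rewrite /F H //.
    rewrite lee_fin -(@sqr_seminorm R V ip ip_sym ip_pos) expr2.
    have h := HK (k + K)%N (leq_addl _ _).
    by apply: ler_pM => //; exact: seminorm_ge0.
  have liml x : limn_einf (F ^~ x) = ((l x - u p x) * (l x - u p x))%:E.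
    apply: (cvg_limn_einf_sup _).1; apply/cvg_EFin; first exact: nearW.
    have c : (fun k => v' (k + K)%N x - u p x) @ \oo --> l x - u p x.
      apply: cvgB; last exact: cvg_cst.
      have H : v' ^~ x @ \oo --> l x by exact: cv'.
      by move: H; rewrite -(cvg_shiftn K).
    exact: (cvgM c c).
  under eq_integral do rewrite -liml.
  apply: le_trans (fatou mu measurableT mF F0) _.
  rewrite limn_einf_lim; apply: lime_le; first exact: is_cvg_einfs.
  apply: nearW => k; apply: le_trans (FK k); apply: ereal_inf_lbound.
  by exists k => /=.
have half_cvg (e : R) : 0 < e -> exists K, 2^-1 ^+ K < e.
  move=> e0; have : (fun m => 2^-1 ^+ m : R) @ \oo --> (0 : R).
    by apply: cvg_expr; rewrite ger0_norm ?invr_ge0 // invf_lt1 // ltr1n.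
  move=> /cvgrPdist_lt/(_ _ e0)[K _ /(_ K (leqnn K))] /=.
  by rewrite sub0r normrN ger0_norm ?exprn_ge0 ?invr_ge0 //; exists K.
have mlu p : measurable_fun [set: T] (fun x => l x - u p x).
  by apply: measurable_funB => //; exact: L2_measurable.
have lclose K p : (N K <= p)%N -> L2 mu ((l : V) - u p) /\ ip ((l : V) - u p) ((l : V) - u p) <= 2^-1 ^+ K * 2^-1 ^+ K.
  move=> Np; apply: L2norm_lty; first exact: mlu.
  apply: (close p K) => k Kk; apply/ltW/Hn.
    exact: leq_trans (nN K) (NS _ _ Kk).
  exact: leq_trans (nN K) Np.
have Ll : L2 mu l.
  have [H _] := lclose 0%N (N 0%N) (leqnn _).
  have := L2_lin_mod 1 H (Lu (N 0%N)).
  by rewrite scale1r subrK.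
exists l => // e e0; have [K HK] := half_cvg e e0; exists (N K) => m Nm.
rewrite (seminormBC L2_0 L2_lin_mod ip_sym ip_lin_mod (Lu m) Ll).
apply: le_lt_trans HK; rewrite -(@ler_pXn2r _ 2) // ?nnegrE ?seminorm_ge0 ?(ltW (half_gt0 _)) //.
by rewrite (@sqr_seminorm R V ip ip_sym ip_pos) expr2; exact: (lclose K m Nm).2.
Qed.

End L2Space.

(** * From an inequality on a core to the spectral gap *)

Section SpectralGap.
Context d (T : measurableType d) (R : realType) (mu : probability T R).
Implicit Types f g h : T -> R.

Let V : lmodType R := (T -> R^o : Type).
Local Notation ipV := (ip mu : V -> V -> R).
Let D : V -> Prop := L2 mu.
Let D0 : D 0 := L2_0 mu.
Let Dl := @L2_lin_mod _ _ _ mu : forall a (u v : V), D u -> D v -> D (a *: u + v).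
Let ipC := @ip_sym _ _ _ mu : forall u v : V, ipV u v = ipV v u.
Let ipl := @ip_lin_mod _ _ _ mu : forall a (u v w : V), D u -> D v -> D w ->
  ipV (a *: u + v) w = a * ipV u w + ipV v w.
Let ip0 := @ip_pos _ _ _ mu : forall u : V, 0 <= ipV u u.
Let cpl := @L2_complete _ _ _ mu.

Lemma L2cvg_semicvg (F : nat -> V) (f : V) : (forall m, L2 mu (F m)) -> L2 mu f ->
  L2cvg mu F f -> semicvg ipV F f.
Proof.
move=> LF Lf.
have LFf m : L2 mu (F m - f) by exact: L2_sub.
have E m : L2norm mu (F m \- f) = (nrm mu (F m - f))%:E by rewrite -L2normE.
rewrite /L2cvg; under eq_fun do rewrite E.
move=> /fine_cvgP[_] /cvgrPdist_lt H e /H[N _ HN]; exists N => m /HN /=.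
by rewrite sub0r normrN ger0_norm //; exact: seminorm_ge0.
Qed.

Lemma right_limit_nrm (F : R -> V) : (forall t, 0 < t -> L2 mu (F t)) ->
  (fun t => L2norm mu (F t)) @ 0^'+ --> 0%E ->
  forall e : R, 0 < e -> exists2 r : R, 0 < r & forall t, 0 < t -> t < r -> nrm mu (F t) < e.
Proof.
move=> LF /fine_cvgP[_] /cvgrPdist_lt H e e0.
have [r /= r0 Hr] := H e e0.
exists r => // t t0 tr.
have := Hr t; rewrite /= sub0r normrN ger0_norm ?(ltW t0) // => /(_ tr t0).
by rewrite sub0r normrN L2normE //=; [rewrite ger0_norm //; exact: seminorm_ge0|exact: LF].
Qed.

Lemma measurable_sq f : L2 mu f -> measurable_fun [set: T] (fun x => (f x * f x)%:E).
Proof. by move=> /L2_measurable mf; apply/measurable_EFinP; exact: measurable_funM. Qed.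

Lemma ae_eq_nrm (f g : V) : L2 mu f -> L2 mu g -> f = g %[ae mu] -> nrm mu (f - g) = 0.
Proof.
move=> Lf Lg fg; have Lfg := L2_sub Lf Lg.
have : ip mu (f - g) (f - g) = 0.
  apply: EFin_inj; rewrite -ip_int //.
  rewrite (ge0_ae_eq_integral (g := cst 0%E)) ?integral0 //.
  - exact: (measurable_sq Lfg).
  - by move=> x _; rewrite lee_fin -expr2 sqr_ge0.
  - apply: filterS fg => x /(_ I) H _; have -> : (f - g) x = 0 by apply/eqP; rewrite subr_eq0; exact/eqP.
    by rewrite mulr0.
by rewrite /nrm /seminorm => ->; rewrite sqrtr0.
Qed.

Lemma nrm_ae_eq (f g : V) : L2 mu f -> L2 mu g -> nrm mu (f - g) = 0 -> f = g %[ae mu].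
Proof.
move=> Lf Lg fg; have Lfg := L2_sub Lf Lg.
have ip00 : ip mu (f - g) (f - g) = 0.
  have <- := @sqr_seminorm R V ipV ipC ip0 (f - g).
  by rewrite [seminorm _ _]fg expr0n.
have : (\int[mu]_x `|(((f - g) x * (f - g) x)%:E)| = 0)%E.
  under eq_integral do rewrite gee0_abs ?lee_fin -?expr2 ?sqr_ge0 //.
  by under eq_integral do rewrite expr2; rewrite ip_int // ip00.
move=> /ae_eq_integral_abs H; have /H : measurable_fun [set: T]
    (fun x => ((f - g) x * (f - g) x)%:E).
  exact: (measurable_sq Lfg).
move=> /(_ measurableT); apply: filterS => x /(_ I) [/eqP].
by rewrite mulf_eq0 orbb subr_eq0 => /eqP ? _.
Qed.

(** The generator vanishes at [k], which says that [P t k - k] is small compared with [t]: the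
    hypothesis of [semigroup_fixed]. *)
Lemma kernel_fixed (A : (T -> R) -> (T -> R) -> Prop) (P : R -> (T -> R) -> (T -> R)) k :
  semigroup_generated_by mu A P -> A k (fun=> 0) ->
  forall t, 0 <= t -> P t k = k %[ae mu].
Proof.
move=> [PL2 Plin Pbd P0 Padd Pcont Pgen] Ak0.
have [Lk _ Pk] := (Pgen _ _).1 Ak0.
pose Q : R -> V -> V := P.
have LZ a (u : V) : L2 mu u -> L2 mu (a *: u) by exact: (DZ D0 Dl).
have fixed : forall t : R, 0 <= t -> nrm mu (Q t k - (k : V)) = 0.
  apply: (semigroup_fixed D0 Dl ipC ipl ip0 cpl).
  - move=> t t0; split.
    + by move=> u Lu; exact: PL2.
    + move=> a u v Lu Lv; apply: ae_eq_nrm.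
      * by apply: (PL2 _ _) => //; exact: L2_lin_mod.
      * by apply: L2_lin_mod; exact: PL2.
      * exact: Plin.
    + have [C HC] := Pbd t t0; exists C => u Lu.
      by have := HC u Lu; rewrite !L2normE ?lee_fin //; exact: PL2.
  - by move=> u Lu; apply: ae_eq_nrm => //; [exact: PL2|exact: P0].
  - move=> s t u s0 t0 Lu; apply: ae_eq_nrm; last exact: Padd.
    + by apply: (PL2 _ _) => //; exact: addr_ge0.
    + by apply: (PL2 _ _) => //; exact: PL2.
  - move=> u Lu; apply: (right_limit_nrm (F := fun t => Q t u - u)); last exact: Pcont.
    by move=> t /ltW t0; apply: L2_sub => //; exact: PL2.
  - exact: Lk.
  - move=> e e0.
    have LF t : 0 < t -> L2 mu (t^-1 *: (Q t k - (k : V))).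
      by move=> /ltW t0; apply/LZ/L2_sub => //; exact: PL2.
    have [|r r0 Hr] := right_limit_nrm LF _ e0.
      rewrite [X in X @ _](_ : _ = (fun t => L2norm mu (fun x => t^-1 * (P t k x - k x) - 0))) //.
      by apply/funext => t; congr (L2norm _ _); apply/funext => x; rewrite subr0.
    exists r => // t t0 tr; have /ltW := Hr t t0 tr.
    have Lq : L2 mu (Q t k - (k : V)) by apply: L2_sub => //; exact: PL2 (ltW t0) Lk.
    rewrite /nrm (seminormZ D0 Dl ipC ipl) // ger0_norm ?invr_ge0 ?(ltW t0) //.
    by rewrite mulrC ler_pdivrMr // mulrC.
by move=> t t0; apply: nrm_ae_eq => //; [exact: PL2|exact: fixed].
Qed.

Lemma VarE f : Var mu f = ip mu f f - (ip mu f (cst 1)) ^+ 2.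
Proof.
have -> : ip mu f (cst 1) = \int[mu]_x f x by apply: eq_Rintegral => x _; exact: mulr1.
by have -> : ip mu f f = \int[mu]_x (f x ^+ 2) by apply: eq_Rintegral => x _; rewrite expr2.
Qed.

Lemma ip_one : ip mu (cst 1) (cst 1) = 1.
Proof.
rewrite /ip; under eq_Rintegral do rewrite mulr1.
by rewrite Rintegral_cst //= probability_setT mulr1.
Qed.

(** Among constants the mean is the closest to [f]; the two sides differ by the square of the mean
    minus [a]. *)
Lemma Var_le_ip f (a : R) : L2 mu f -> Var mu f <= ip mu (fun x => f x - a) (fun x => f x - a).
Proof.
move=> Lf; have L1 := L2_cst mu 1.
have E : ip mu (fun x => f x - a) (fun x => f x - a) =
    ip mu f f + 2 * (- a) * ip mu f (cst 1) + (- a) ^+ 2 * ip mu (cst 1) (cst 1).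
  rewrite -(@ip_sqr_lin R V D ipV D0 Dl ipC ipl (- a) f (cst 1)) //.
  congr (ip mu _ _); apply/funext => x; exact: (esym (congr1 _ (mulr1 _))).
rewrite VarE E ip_one mulr1 -addrA lerD2l -subr_ge0.
have -> : 2 * - a * ip mu f (cst 1) + (- a) ^+ 2 - - ip mu f (cst 1) ^+ 2 =
  (ip mu f (cst 1) - a) ^+ 2 by ring.
exact: sqr_ge0.
Qed.

Lemma Var_ge0 f : L2 mu f -> 0 <= Var mu f.
Proof.
move=> Lf; have L1 := L2_cst mu 1.
rewrite VarE subr_ge0.
have := @cauchy_schwarz R V D ipV D0 Dl ipC ipl ip0 f (cst 1) Lf L1.
by rewrite ip_one mulr1.
Qed.

(** Both inequalities are closed under convergence in the graph, so they pass from [B] to its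
    closure. The kernel part [k] of [f] is fixed by the semigroup, hence constant, and the variance
    is at most the squared distance from [f] to a constant. *)
Lemma spectral_gap_core (B : (T -> R) -> (T -> R) -> Prop)
    (P : R -> (T -> R) -> (T -> R)) (lam : R) : 0 < lam ->
  (forall f h, B f h -> L2 mu f /\ L2 mu h) ->
  (forall a f h u v, B f h -> B u v ->
     B (fun x => a * f x + u x) (fun x => a * h x + v x)) ->
  B (fun=> 0) (fun=> 0) ->
  (forall f h, B f h -> 0 <= - ip mu f h) ->
  (forall f h, B f h -> lam * - ip mu f h <= ip mu h h) ->
  essentially_self_adjoint mu B ->
  semigroup_generated_by mu (op_closure mu B) P -> ergodic mu P ->
  (lam%:E <= spectral_gap mu (op_closure mu B))%E.
Proof.
move=> lam0 BL2 Blin B0 Bpos Bgap [_ Badj] PB Perg.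
pose A := op_closure mu B.
have approx f h : A f h -> [/\ L2 mu f, L2 mu h & exists F H : nat -> V,
    [/\ forall m, B (F m) (H m), forall m, L2 mu (F m), forall m, L2 mu (H m),
        semicvg ipV F f & semicvg ipV H h]].
  move=> [Lf Lh [F [H [BFH cF cH]]]]; split=> //; exists F, H.
  have LF m := (BL2 _ _ (BFH m)).1; have LH m := (BL2 _ _ (BFH m)).2.
  by split=> //; exact: L2cvg_semicvg.
have cvg2 (F H : nat -> V) (f h : V) : (forall m, L2 mu (F m)) -> (forall m, L2 mu (H m)) ->
    L2 mu f -> L2 mu h -> semicvg ipV F f -> semicvg ipV H h ->
    (fun m => ipV (F m) (H m)) @ \oo --> ipV f h.
  move=> LF LH Lf Lh cF cH.
  have c1 := semicvg_ip D0 Dl ipC ipl ip0 LF Lf Lh cF.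
  have c2 : (fun m => ipV (F m) ((H m - h) : V)) @ \oo --> 0.
    have cn := semicvg_seminorm D0 Dl ipC ipl ip0 LF Lf cF.
    have cz : (fun m => seminorm ipV (H m - h)) @ \oo --> (0 : R).
      apply/cvgrPdist_lt => e e0; have [N HN] := cH e e0; exists N => // m /HN.
      by rewrite /= sub0r normrN ger0_norm //; exact: seminorm_ge0.
    apply/norm_cvg0P.
    have c3 : (fun m => seminorm ipV (F m) * seminorm ipV (H m - h)) @ \oo --> (0 : R).
      by rewrite -(mulr0 (seminorm ipV f)); exact: (cvgM cn cz).
    apply: (squeeze_cvgr _ _ c3); last exact: cvg_cst.
    apply: nearW => m; rewrite normr_ge0 /=.
    by apply: (ip_le_seminorm D0 Dl ipC ipl ip0); [exact: LF|exact: L2_sub].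
  have -> : (fun m => ipV (F m) (H m)) = (fun m => ipV h (F m) + ipV (F m) ((H m - h) : V)).
    apply/funext => m.
    have E := ipB ipl (LH m) Lh (LF m).
    by rewrite (ipC (F m) (H m - h)) E addrC subrK; exact: ipC.
  by rewrite -(addr0 (ipV f h)) [X in X + _](ipC f h); exact: (cvgD c1 c2).
have gap := @spectral_gap_of_square R V D ipV D0 Dl ipC ipl ip0 cpl A lam lam0.
apply: le_ereal_inf_tmp => _ [f [h [Afh Vf ->]]].
have Lf := let: And3 Lf _ _ := Afh in Lf.
have Vf0 : 0 < Var mu f by rewrite lt_neqAle eq_sym Vf Var_ge0.
rewrite lee_fin ler_pdivlMr //.
have -> : \int[mu]_x (- f x * h x) = - ipV f h.
  rewrite -mulN1r -(@ipZ R V D ipV D0 ipl) //; last by have [] := Afh.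
  apply: eq_Rintegral => x _; congr (_ * _); exact: (esym (mulN1r _)).
have [|||||||k Ak0 Hk] := gap _ _ _ _ _ _ _ f h Afh.
- by move=> u v [].
- split; [exact: L2_0|exact: L2_0|]; exists (fun _ _ => 0), (fun _ _ => 0); split=> //.
  + rewrite /L2cvg (_ : (fun m => _) = cst 0%E); first exact: cvg_cst.
    apply/funext => m; rewrite (_ : _ \- _ = (0 : V)); last by apply/funext => x; rewrite /= subr0.
    by rewrite L2normE ?L2_0 // /nrm (seminorm0 D0 ipl).
  + rewrite /L2cvg (_ : (fun m => _) = cst 0%E); first exact: cvg_cst.
    apply/funext => m; rewrite (_ : _ \- _ = (0 : V)); last by apply/funext => x; rewrite /= subr0.
    by rewrite L2normE ?L2_0 // /nrm (seminorm0 D0 ipl).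
(* Linearity is checked on the adjoint, where it is immediate, rather than on approximating
   sequences. *)
- move=> a p q u v /Badj[Lp Lq Hpq] /Badj[Lu Lv Huv]; apply/Badj; split.
  + exact: L2_lin_mod.
  + exact: L2_lin_mod.
  + move=> y z Ayz; have [Ly Lz _] := Ayz.
    have E2 : ipV p z = ipV q y := Hpq y z Ayz.
    have E1 : ipV u z = ipV v y := Huv y z Ayz.
    apply: (etrans (ipl a Lp Lu Lz)); apply: (etrans _ (esym (ipl a Lq Lv Ly))).
    exact: (congr2 (fun s t => a * s + t) E2 E1).
- move=> p q u v Apq /Badj[Lu Lv Huv]; rewrite ipC [RHS]ipC.
  exact: (esym (Huv p q Apq)).
- by move=> p q Lp Lq Hpq; apply/Badj; split.
- move=> p q /approx[Lp Lq [F [H [BFH LF LH cF cH]]]].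
  rewrite oppr_ge0; have c := cvg2 _ _ _ _ LF LH Lp Lq cF cH.
  apply: (ler_cvg_to c (cvg_cst 0)); apply: nearW => m.
  by rewrite -oppr_ge0; exact: Bpos.
- move=> p q /approx[Lp Lq [F [H [BFH LF LH cF cH]]]].
  have c := cvg2 _ _ _ _ LF LH Lp Lq cF cH; have c' := cvg2 _ _ _ _ LH LH Lq Lq cH cH.
  apply: (ler_cvg_to (cvgM (cvg_cst lam) (cvgN c)) c'); apply: nearW => m.
  exact: Bgap.
have fixk := kernel_fixed PB Ak0.
have Lk : L2 mu k by have [] := Ak0.
have [a ka] := Perg k Lk fixk.
apply: le_trans Hk; rewrite ler_wpM2l ?(ltW lam0) //.
apply: le_trans (Var_le_ip a Lf) _.
rewrite le_eqVlt; apply/orP; left; apply/eqP; congr fine.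
have Lfa : L2 mu (fun x => f x - a) by exact: (L2_sub (v := cst a) Lf (L2_cst mu a)).
have Lfk := L2_sub Lf Lk.
apply: ae_eq_integral => //.
- exact: measurable_sq.
- exact: (measurable_sq Lfk).
- by apply: filterS ka => x H _; rewrite [(_ - _) x]/(f x - k x) H.
Qed.

End SpectralGap.

(** * Stokes' theorem *)

Section PositivePartSquare.
Variable R : realType.

(** A C^1 cutoff profile suffices: cutoffs multiply the factor [p] of the field [p grad u], whose
    divergence differentiates [p] once. *)
Definition sqp (t : R) : R := Num.max 0 t ^+ 2.

Lemma sqp_ge0 t : 0 <= sqp t.
Proof. exact: sqr_ge0. Qed.

Lemma sqp_eq0 t : t <= 0 -> sqp t = 0.
Proof. by move=> t0; rewrite /sqp max_l // expr0n. Qed.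

Lemma sqpE t : 0 <= t -> sqp t = t ^+ 2.
Proof. by move=> t0; rewrite /sqp max_r. Qed.

Lemma sqp_expand t s : `|sqp (s + t) - sqp t - s * (2 * Num.max 0 t)| <= s ^+ 2.
Proof.
rewrite /sqp ler_norml; have [t0|t0] := leP 0 t; have [st0|st0] := leP 0 (s + t); nra.
Qed.

Lemma sqp_derive (t : R) : is_derive t 1 sqp (2 * Num.max 0 t).
Proof.
have H : (fun h : R => h^-1 *: ((sqp \o shift t) (h *: 1) - sqp t)) @ 0^' --> 2 * Num.max 0 t.
  apply/cvgrPdist_lt => e e0; near=> h.
  have h0 : h != 0 by near: h; exact: nbhs_dnbhs_neq.
  have he : `|h| < e by near: h; exact: dnbhs0_lt.
  apply: le_lt_trans he; rewrite distrC /= -[h *: 1]/(h * 1) mulr1 -[h^-1 *: _]/(h^-1 * _).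
  have -> : h^-1 * (sqp (h + t) - sqp t) - 2 * Num.max 0 t =
      h^-1 * (sqp (h + t) - sqp t - h * (2 * Num.max 0 t)).
    by rewrite [RHS]mulrBr mulrA mulVf // mul1r.
  rewrite normrM normrV ?unitfE // ler_pdivrMl ?normr_gt0 //.
  by apply: le_trans (sqp_expand t h) _; rewrite -normrM -expr2 ler_norm.
by apply: DeriveDef; [apply/cvg_ex; exists (2 * Num.max 0 t)|apply/cvg_lim].
Unshelve. all: by end_near. Qed.

Lemma sqp_dcontinuous : continuous (fun t : R => 2 * Num.max 0 t).
Proof.
move=> t; apply: cvgM; first exact: cvg_cst.
apply/cvgrPdist_lt => e e0; near=> x.
have : `|t - x| < e by near: x; apply: cvgr_dist_lt => //; exact: cvg_id.
by rewrite !ltr_norml; have [t0|t0] := leP 0 t; have [x0|x0] := leP 0 x; lra.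
Unshelve. all: by end_near. Qed.

(* A positive [C^1] function on [[0, +oo[] that is the identity beyond [1]. *)
Definition floor1 (t : R) : R := t + sqp (1 - t).

Lemma floor1_gt0 t : 0 <= t -> 0 < floor1 t.
Proof.
move=> t0; rewrite /floor1; have [t1|t1] := leP t 2^-1; last by apply: ltr_pwDl; [lra|exact: sqp_ge0].
by rewrite sqpE; [nra|lra].
Qed.

Lemma floor1E t : 1 <= t -> floor1 t = t.
Proof. by move=> t1; rewrite /floor1 sqp_eq0 ?addr0 // subr_le0. Qed.

End PositivePartSquare.

Section ClosureC1.
Variables (R : realType) (n : nat) (U : set 'rV[R]_n).
Hypothesis oU : open U.

Lemma C1_sqp f : Ck 1 U f -> Ck 1 U (fun y => sqp (f y)).
Proof.
by apply: (C1_comp_scalar oU) => [t|]; [exact: sqp_derive|exact: sqp_dcontinuous].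
Qed.

Lemma C1_floor1 f : Ck 1 U f -> Ck 1 U (fun y => floor1 (f y)).
Proof.
move=> Cf; apply: CkD => //; apply: C1_sqp.
by apply: CkB => //; exact: Ck_cst.
Qed.

Lemma partial_coord k l y : derivable (fun z : 'rV[R]_n => z ord0 l) y (delta_mx ord0 k) /\
  partial k (fun z : 'rV[R]_n => z ord0 l) y = (l == k)%:R.
Proof.
have E : (fun h : R => h^-1 *: (((fun z : 'rV[R]_n => z ord0 l) \o shift y) (h *: delta_mx ord0 k) - y ord0 l))
    @ 0^' --> ((l == k)%:R : R).
  apply: cvg_near_cst; near=> h; have h0 : h != 0 by near: h; exact: nbhs_dnbhs_neq.
  by rewrite /= !mxE /= addrK -[_ *: _]/(_ * _) mulrA mulVf // mul1r.
by split; [apply/cvg_ex; exists ((l == k)%:R)|apply/cvg_lim].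
Unshelve. all: by end_near. Qed.

Lemma Ck_coord m l : Ck m U (fun z => z ord0 l).
Proof.
have cc (y : 'rV[R]_n) : {for y, continuous (fun z : 'rV[R]_n => z ord0 l)} by exact: coord_continuous.
case: m => [|m]; split=> // k; split=> [y _|]; first exact: (partial_coord k l y).1.
rewrite (_ : partial k _ = fun=> (l == k)%:R); first exact: Ck_cst.
by apply/funext => y; exact: (partial_coord k l y).2.
Qed.

End ClosureC1.

(** * Bump functions and partitions of unity *)

Section Bumps.
Variables (R : realType) (n : nat) (M : ptopologicalType) (A : smooth_atlas R n M).

(** The squared Euclidean distance is polynomial in the coordinates, unlike the sup norm carried by
    row vectors. *)
Let rho (c y : 'rV[R]_n) : R := \sum_l (y ord0 l - c ord0 l) * (y ord0 l - c ord0 l).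

Let rho_C1 U c : open U -> Ck 1 U (rho c).
Proof.
move=> oU; apply: Ck_sum => // l _.
by apply: CkM => //; apply: CkB => //; [exact: Ck_coord|exact: Ck_cst|exact: Ck_coord|exact: Ck_cst].
Qed.

Let rho_ge (c y : 'rV[R]_n) l : (y ord0 l - c ord0 l) * (y ord0 l - c ord0 l) <= rho c y.
Proof.
rewrite /rho (bigD1 l) //= lerDl; apply: sumr_ge0 => k _; rewrite -expr2; exact: sqr_ge0.
Qed.

Let disc (c : 'rV[R]_n) (r : R) := [set y : 'rV[R]_n | rho c y <= r * r].

Let disc_box c r : 0 < r -> disc c r `<=` [set y | forall l, `|y ord0 l - c ord0 l| <= r].
Proof.
move=> r0 y; rewrite /disc /= => H l; have := le_trans (rho_ge c y l) H.
by rewrite ler_norml; move: (_ - _) => t; nra.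
Qed.

Let disc_compact c r : 0 < r -> compact (disc c r).
Proof.
move=> r0; apply: (@subclosed_compact _ _ (box (`|c| + r))).
- rewrite (_ : disc c r = rho c @^-1` [set t | t <= r * r]) //.
  apply: closed_comp; last exact: closed_le.
  move=> y _; apply: (Ck_continuous (rho_C1 c openT)); exact: I.
- exact: box_compact.
- move=> y /(disc_box r0) H l; have := H l.
  have : `|c ord0 l| <= `|c|.
    rewrite [leRHS]/Num.norm /= mx_normrE.
    exact: (le_bigmax _ (fun i : 'I_1 * 'I_n => `|c i.1 i.2|) (ord0, l)).
  have := ler_normD (y ord0 l - c ord0 l) (c ord0 l); rewrite subrK; lra.
Qed.

Definition supported_in_chart (f : M -> R) :=
  exists2 i : chart_idx A, Ck_mfd A 1 f & exists K : set M,
    [/\ compact K, K `<=` chart_dom i & forall x, ~ K x -> f x = 0].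

(** The value 2 at the centre leaves an open neighbourhood where the bump exceeds 1, the threshold
    beyond which [floor1] is the identity. *)
Lemma bump_function (x : M) : exists p : M -> R,
  [/\ supported_in_chart p, forall z, 0 <= p z & p x = 2].
Proof.
set i := chart_at A x; have dx : chart_dom i x := chart_atP A x.
have [r r0 Hr] := open_rV_ball (@chart_cod_open _ _ _ A i) (ex_intro2 _ _ x dx erefl).
set c := chart i x in Hr.
pose s := r / 2; have s0 : 0 < s by rewrite divr_gt0.
have dcod : disc c s `<=` chart_cod i.
  move=> y /(disc_box s0) H; apply: Hr; apply: (@le_lt_trans _ _ s); last by rewrite /s; lra.
  rewrite [leLHS]/Num.norm /= mx_normrE; apply: bigmax_le => [|[a b] _ /=]; first exact: ltW.
  by rewrite !mxE (ord1 a); exact: H.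
pose K := chart_inv i @` disc c s.
have cK : compact K.
  apply: continuous_compact; last exact: disc_compact.
  apply: continuous_in_subspaceT => y /set_mem/dcod cy; exact: chart_inv_continuous cy.
have Kdom : K `<=` chart_dom i by move=> _ [y /dcod/chart_cod_psi[d _] <-].
(* At the centre [sqp] takes the value [(s * s)^2], which the power -2 normalizes. *)
pose q (y : 'rV[R]_n) : R := 2 * (s * s) `^ (- 2%:R) * sqp (s * s - rho c y).
pose p (z : M) : R := if `[< chart_dom i z >] then q (chart i z) else 0.
have qC U : open U -> Ck 1 U q.
  move=> oU; apply: CkM => //; first exact: Ck_cst.
  apply: C1_sqp => //; apply: CkB => //; [exact: Ck_cst|exact: rho_C1].
have p0 z : ~ K z -> p z = 0.
  rewrite /p; case: asboolP => // dz nK; rewrite /q sqp_eq0 ?mulr0 // subr_le0 leNgt.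
  apply/negP => H; apply: nK; exists (chart i z); last by rewrite chartK.
  exact: ltW.
have pC : Ck_mfd A 1 p.
  (* Near a point of the domain of chart [i] the bump is [q] after a transition map; elsewhere it
     vanishes on the complement of [K], which is open because [M] is Hausdorff. *)
  move=> j; apply: Ck_local => y cy; have [dj yE] := chart_cod_psi cy.
  have [di|ndi] := pselect (chart_dom i (chart_inv j y)).
    exists (overlap j i); first exact/overlapP.
    apply: (@eq_Ck _ _ _ _ (q \o transition j i)); first exact: overlap_open.
      move=> z /set_mem/overlapP[_ dz] /=; rewrite /p /transition.
      by case: asboolP.
    apply: (C1_comp (U' := setT)) => //.
    + exact: overlap_open.
    + exact: openT.
    + by move=> l; exact: (@transition_smooth _ _ _ A j i l 1%N).
    + by apply: qC; exact: openT.
  have oV : open (chart_cod j `&` chart_inv j @^-1` (~` K)).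
    apply: open_preimage; first exact: chart_cod_open.
    - by move=> z; exact: chart_inv_continuous.
    - exact: closed_openC (compact_closed (atlas_hausdorff A) cK).
  exists (chart_cod j `&` chart_inv j @^-1` (~` K)).
    by split=> // /Kdom.
  apply: (@eq_Ck _ _ _ _ (fun=> 0)) => //; last exact: Ck_cst.
  by move=> z /set_mem[_ nK] /=; rewrite p0.
exists p; split.
- by exists i => //; exists K.
- move=> z; rewrite /p; case: asboolP => // _; rewrite /q mulr_ge0 ?sqp_ge0 //.
  by rewrite mulr_ge0 // powR_ge0.
- rewrite /p; case: asboolP => // _; rewrite /q -/c /rho big1 => [|l _]; last by rewrite subrr mul0r.
  have s2 : 0 < s * s by rewrite mulr_gt0.
  rewrite subr0 sqpE ?ltW // -powR_mulrn ?ltW // -mulrA -powRD; last by apply/implyP => _; rewrite gt_eqF.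
  by rewrite addNr powRr0 mulr1.
Qed.

(** Finitely many bumps have a sum [P] above 1 near [K]. Dividing by [floor1 P], which never
    vanishes, keeps the quotients C^1 everywhere and makes them add up to 1 where [P > 1]. *)
Lemma C1_partition (K : set M) : compact K ->
  exists (s : seq M) (chi : M -> M -> R) (W : set M),
    [/\ forall a, supported_in_chart (chi a), open W, K `<=` W &
        forall x, W x -> \sum_(a <- s) chi a x = 1].
Proof.
move=> cK; have /choice[p Hp] := bump_function.
have pC a : Ck_mfd A 1 (p a) by have [[i Cp _] _ _] := Hp a.
have pcont a : continuous (p a) by apply: (@C0M_continuous _ _ _ A) => i; exact: (CkS (pC a i)).
have popen a : open [set x | 1 < p a x].
  apply: (@open_comp _ _ (p a) [set t | 1 < t]); first by move=> x _; exact: pcont.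
  exact: open_gt.
have cover : K `<=` \bigcup_(a in [set: M]) [set x | 1 < p a x].
  by move=> x Kx; exists x => //=; have [_ _ ->] := Hp x; rewrite ltr1n.
move: cK; rewrite compact_cover => /(_ M setT _ (fun a _ => popen a) cover)[D _ HD].
pose P x := \sum_(a <- (finmap.enum_fset D)) p a x.
have P0 x : 0 <= P x by apply: sumr_ge0 => a _; have [_ H _] := Hp a; exact: H.
have PC (i : chart_idx A) : Ck 1 (chart_cod i) (P \o chart_inv i).
  by apply: Ck_sum => [|a _]; [exact: chart_cod_open|exact: (pC a i)].
have fC (i : chart_idx A) : Ck 1 (chart_cod i) (fun y => floor1 (P (chart_inv i y)) `^ (-1)).
  apply: Ck_powR; [exact: chart_cod_open|by move=> y _; exact: floor1_gt0|].
  by apply: C1_floor1; [exact: chart_cod_open|exact: PC].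
exists (finmap.enum_fset D), (fun a x => p a x * floor1 (P x) `^ (-1)), [set x | 1 < P x]; split.
- move=> a; have [[i Cp [L [cL Ld L0]]] _ _] := Hp a.
  exists i; last by exists L; split=> // x /L0 ->; rewrite mul0r.
  by move=> j; apply: CkM; [exact: chart_cod_open|exact: Cp|exact: fC].
- have Pcont : continuous P by apply: (@C0M_continuous _ _ _ A) => i; exact: (CkS (PC i)).
  apply: (@open_comp _ _ P [set t | 1 < t]); first by move=> x _; exact: Pcont.
  exact: open_gt.
- move=> x /HD[a aD /= ax]; apply: lt_le_trans ax _; rewrite /P.
  rewrite (big_rem a) /=; last by [].
  by rewrite lerDl; apply: sumr_ge0 => b _; have [_ H _] := Hp b; exact: H.
- move=> x /= P1; rewrite -mulr_suml -/(P x) floor1E ?ltW // -{1}[P x]powRr1 ?P0 //.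
  rewrite -powRD ?subrr ?powRr0 //; apply/implyP => _; rewrite gt_eqF //.
  exact: lt_trans P1.
Qed.

End Bumps.

(** * The divergence theorem *)

Section Stokes.
Variables (R : realType) (n : nat) (M : ptopologicalType) (A : smooth_atlas R n M).
Variables (g : riemannian_metric A) (vol : {measure set (borelType M) -> \bar R}).
Hypothesis vol_g : is_volume g vol.
Implicit Types (p u f h : M -> R).

(* The divergence of [p grad u]. *)
Definition theta p u x := p x * laplacian g u x + dprod g p u x.

Lemma theta_C0 p u : Ck_mfd A 1 p -> smooth A u -> Ck_mfd A 0 (theta p u).
Proof.
move=> Cp Su i; have oi := @chart_cod_open _ _ _ A i.
apply: CkD => //; last exact: (dprod_C0M g Cp (smooth_Ck_mfd 1 Su) i).
by apply: CkM => //; [exact: (CkS (Cp i))|exact: (laplacian_smoothM g Su i 0%N)].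
Qed.

Lemma theta_near0 p u x (W : set M) : open W -> W x ->
  (forall z, W z -> p z = 0) \/ (forall z, W z -> u z = 0) -> theta p u x = 0.
Proof.
move=> oW Wx [p0|u0]; rewrite /theta.
  by rewrite p0 // mul0r add0r (dprod_near g u oW Wx p0).1 (dprod0 g u x).1.
by rewrite (laplacian_near g oW Wx u0) laplacian0 mulr0 add0r (dprod_near g p oW Wx u0).2 (dprod0 g p x).2.
Qed.

Section Chart.
Variable m : {measure set (borelType 'rV[R]_n) -> \bar R}.
Hypothesis Lm : lebesgue_like m.

(** In the chart, the divergence times the volume density is a sum of partial derivatives of
    compactly supported functions, which [lebesgue_like] integrates to zero. *)
Lemma chart_stokes p u : supported_in_chart A p -> smooth A u ->
  (\int[vol]_x (theta p u x)%:E = 0)%E.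
Proof.
move=> [i Cp [K [cK Kd K0]]] Su; have oi := @chart_cod_open _ _ _ A i.
set cod := chart_cod i; set psi := chart_inv i.
have clK : closed K := compact_closed (atlas_hausdorff A) cK.
have t0 x : ~ K x -> theta p u x = 0.
  by move=> nK; apply: (theta_near0 (W := ~` K)) => //; [exact: closed_openC|left].
have mt : measurable_fun [set: borelType M] (theta p u : borelType M -> R).
  apply: borel_measurable_real; first exact: openT.
  by move=> x _; exact: (C0M_continuous (theta_C0 Cp Su)).
rewrite (chart_integral vol_g Lm (i := i) mt); last by move=> x nd; apply: t0 => /Kd.
pose K' := chart i @` K.
have cK' : compact K'.
  apply: continuous_compact => //.
  by apply: continuous_in_subspaceT => x /set_mem/Kd dx; exact: chart_continuous dx.
have oK' : open (~` K').
  exact: closed_openC (compact_closed (@norm_hausdorff _ _) cK').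
pose Phi0 a y := p (psi y) * (Num.sqrt (\det (metric g i y)) * lgrad (metric g i) (u \o psi) y ord0 a).
pose Phi a y := if `[< cod y >] then Phi0 a y else 0.
have Phi_out a y : ~ K' y -> Phi a y = 0.
  rewrite /Phi; case: asboolP => // cy nK; have [d e] := chart_cod_psi cy.
  by rewrite /Phi0 K0 ?mul0r // => Ky; apply: nK; exists (psi y).
have PhiE a : {in cod, Phi0 a =1 Phi a}.
  by move=> y /set_mem cy; rewrite /Phi; case: asboolP.
have dets := sqrt_det_smooth oi (@metric_smooth _ _ _ _ g i) (@metric_posdef _ _ _ _ g i).
have Zs a := lgrad_smooth oi (@metric_smooth _ _ _ _ g i) (@metric_posdef _ _ _ _ g i) a (Su i).
have C0 a : Ck 1 cod (Phi0 a).
  by apply: CkM; [exact: oi|exact: (Cp i)|apply: CkM; [exact: oi|exact: dets|exact: Zs]].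
(* The chart image and the complement of the compact [K'] are open and cover the space; on the
   second the extension is zero. *)
have C a : Ck 1 setT (Phi a).
  apply: Ck_local => y _; have [cy|ncy] := pselect (cod y).
    by exists cod => //; exact: (eq_Ck oi (PhiE a)).
  exists (~` K'); first by move=> [x /Kd dx xy]; apply: ncy; rewrite -xy; exact: chart_cod_phi.
  apply: (@eq_Ck _ _ _ _ (fun=> 0)) => //; last exact: Ck_cst.
  by move=> z /set_mem nz; rewrite Phi_out.
have [B HB] : exists B, K' `<=` box B.
  have [B0 [_ HB]] := compact_bounded cK'.
  exists (B0 + 1) => y Ky l; apply: le_trans (HB (B0 + 1) _ y Ky); last by rewrite ltrDl.
  rewrite [leRHS]/Num.norm /= mx_normrE.
  exact: (le_bigmax _ (fun i : 'I_1 * 'I_n => `|y i.1 i.2|) (ord0, l)).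
have Pbox a y : ~ box B y -> Phi a y = 0 by move=> nb; apply: Phi_out => /HB.
have [_ mB mS] := Lm.
transitivity (\int[m]_y (\sum_a (partial a (Phi a) y)%:E))%E; last first.
  rewrite (@integral_sum _ _ _ m _ measurableT) => [|a].
    by apply: big1 => a _; exact: (mS a (Phi a) B (C a) (Pbox a)).
  apply: (box_integrable (mB B)).
    by move=> y; exact: (Ck_continuous (Ck_partial a (C a)) I).
  by move=> y; apply: partial_eq0_outside; exact: Pbox.
apply: eq_integral => y _; rewrite sumEFin; congr EFin; rewrite /vol_weight indicE.
have [cy|ncy] := pselect (cod y); last first.
  rewrite memNset // !mulr0 big1 // => a _; rewrite -(partial_cst (0 : R) a y).
  apply: (eq_partial_on oK') => [z /set_mem nz|]; first by rewrite Phi_out.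
  by move=> [x /Kd dx xy]; apply: ncy; rewrite -xy; exact: chart_cod_phi.
rewrite mem_set // mulr1; have [d e] := chart_cod_psi cy.
rewrite /theta (laplacian_chart g Su d) (dprod_chart g Cp (smooth_Ck_mfd 1 Su) d) e.
set G := metric g i; set q := p \o psi; set v := u \o psi.
have dq a : derivable q y (delta_mx ord0 a) := Ck_derivable (Cp i) cy.
have ds a : derivable (fun z => Num.sqrt (\det (G z)) * lgrad G v z ord0 a) y (delta_mx ord0 a).
  apply: derivableM; first exact: smooth_on_derivable dets cy.
  exact: smooth_on_derivable (Zs a) cy.
transitivity (\sum_a (q y * partial a (fun z => Num.sqrt (\det (G z)) * lgrad G v z ord0 a) y +
    Num.sqrt (\det (G y)) * lgrad G v y ord0 a * partial a q y)); last first.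
  apply: eq_bigr => a _; rewrite -(eq_partial_on oi a (PhiE a) cy).
  by rewrite -[RHS]/(partial a (fun z => q z * (Num.sqrt (\det (G z)) * lgrad G v z ord0 a)) y) partialM.
rewrite big_split /= -mulr_sumr (sqrt_det_ldiv oi (@metric_smooth _ _ _ _ g i) (@metric_posdef _ _ _ _ g i)) //; last first.
  by move=> a; exact: smooth_on_derivable (Zs a) cy.
rewrite (ldiv_grad oi (@metric_smooth _ _ _ _ g i) (@metric_posdef _ _ _ _ g i) (Su i) cy).
rewrite (local_dprodC (@metric_posdef _ _ _ _ g i) q v cy) local_dprodE.
under [X in _ = _ + X]eq_bigr do rewrite -mulrA.
rewrite -mulr_sumr -[p (chart_inv i y)]/(q y) -/G -/psi -/v.
by move: (\sum_b _) (Num.sqrt _) (q y) (local_laplacian _ _ _) => s1 s2 s3 s4; ring.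
Qed.

End Chart.

Lemma dprod_sum (s : seq M) (F : M -> M -> R) u x : (forall a, Ck_mfd A 1 (F a)) ->
  dprod g (fun z => \sum_(a <- s) F a z) u x = \sum_(a <- s) dprod g (F a) u x.
Proof.
move=> CF; rewrite /dprod; set i := chart_at A x.
have cx : chart_cod i (chart i x) by exists x => //; exact: chart_atP.
rewrite /local_dprod [RHS]exchange_big /=; apply: eq_bigr => k _.
rewrite [RHS]exchange_big /=; apply: eq_bigr => l _.
rewrite -mulr_suml -mulr_sumr; congr (_ * _ * _).
have [_ ->] := @partial_sum R n _ s xpredT (fun a => F a \o chart_inv i) k (chart i x)
  (fun a _ => Ck_derivable (CF a i) cx).
by [].
Qed.

Variables (omega : M -> R) (beta : R) (mu : probability (borelType M) R).
Hypothesis omega_smooth : smooth A omega.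
Hypothesis omega_gt0 : forall x, 0 < omega x.
Hypothesis mu_density : forall B : set (borelType M), measurable B ->
  mu B = (\int[vol]_(x in B) (omega x `^ (- beta))%:E)%E.

Lemma powR_smooth s : smooth A (fun x => omega x `^ s).
Proof.
move=> i; apply: smooth_on_powR; first exact: chart_cod_open.
  by move=> y _; exact: omega_gt0.
exact: omega_smooth.
Qed.

Lemma C0_measurable h : Ck_mfd A 0 h -> measurable_fun [set: borelType M] (h : borelType M -> R).
Proof.
move=> Ch; apply: borel_measurable_real; first exact: openT.
by move=> x _; exact: (C0M_continuous Ch).
Qed.

Definition C0_compact h := Ck_mfd A 0 h /\ exists2 K : set M, compact K & forall x, ~ K x -> h x = 0.

Lemma C0_compact_mul h f : C0_compact h -> Ck_mfd A 0 f -> C0_compact (fun x => h x * f x).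
Proof.
move=> [Ch [K cK K0]] Cf; split; last by exists K => // x /K0 ->; rewrite mul0r.
by move=> i; apply: CkM; [exact: chart_cod_open|exact: Ch|exact: Cf].
Qed.

Lemma C0_compact_integrable h : C0_compact h -> mu.-integrable [set: _] (EFin \o (h : borelType M -> R)).
Proof.
move=> [Ch [K cK K0]].
apply: measurable_bounded_integrable => //.
- by rewrite (le_lt_trans (probability_le1 _ _)) ?ltry.
- exact: C0_measurable.
have /compact_bounded[B [Br HB]] : compact (h @` K).
  by apply: continuous_compact => //; apply: continuous_subspaceT; exact: (C0M_continuous Ch).
exists (Num.max B 0); split; first exact: num_real.
move=> C; rewrite gt_max => /andP[BC C0] x _ /=.
have [Kx|nK] := pselect (K x); first by apply: (HB C BC); exists x.
by rewrite K0 // normr0 ltW.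
Qed.

Lemma C0_compact_L2 h : C0_compact h -> L2 mu (h : borelType M -> R).
Proof.
move=> Ch; apply/L2P; split; first exact: (C0_measurable Ch.1).
have /integrableP[_] := C0_compact_integrable (C0_compact_mul Ch Ch.1).
by under eq_integral do rewrite gee0_abs ?lee_fin -?expr2 ?sqr_ge0 //.
Qed.

(** The factor [omega^beta] undoes the density of [mu], leaving the Riemannian integral of a
    divergence. Only [u] has compact support, so the partition of unity is taken around [K] and
    multiplied into [p]. *)
Lemma mu_theta p u (K : set M) : Ck_mfd A 1 p -> smooth A u -> compact K ->
  (forall x, ~ K x -> u x = 0) ->
  (\int[mu]_x (omega x `^ beta * theta p u x)%:E = 0)%E.
Proof.
move=> Cp Su cK K0; have [m Lm] := lebesgue_measure_rV R n.
have [s [chi [W [Hchi oW KW W1]]]] := C1_partition A cK.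
have chiC a : Ck_mfd A 1 (chi a) by have [? ?] := Hchi a.
pose q a x := p x * chi a x.
have qs a : supported_in_chart A (q a).
  have [i Ci [L [cL Ld L0]]] := Hchi a; exists i; last first.
    by exists L; split=> // x /L0; rewrite /q => ->; rewrite mulr0.
  by move=> j; apply: CkM; [exact: chart_cod_open|exact: Cp|exact: chiC].
have qC a : Ck_mfd A 1 (q a) by have [? ?] := qs a.
(* On [W] the cutoffs add up to 1 in a neighbourhood, so their derivatives cancel too; off [W]
   everything vanishes with [u]. *)
have tE x : theta p u x = \sum_(a <- s) theta (q a) u x.
  have [Wx|nW] := pselect (W x); last first.
    have oV : open (~` K) := closed_openC (compact_closed (atlas_hausdorff A) cK).
    have nK : (~` K) x by move=> /KW.
    have t0 p' : theta p' u x = 0 by apply: (theta_near0 oV nK); right.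
    by rewrite t0 big1.
  rewrite /theta big_split /= -mulr_suml; congr (_ * _ + _).
    by rewrite /q -mulr_sumr W1 // mulr1.
  rewrite -(dprod_sum s u x qC); apply: (dprod_near g u oW Wx _).1 => z Wz.
  by rewrite /q -mulr_sumr W1 // mulr1.
have tC a : C0_compact (fun x => theta (q a) u x * omega x `^ beta).
  apply: C0_compact_mul; last exact: smooth_Ck_mfd (powR_smooth beta).
  split; first exact: theta_C0.
  have [i _ [L [cL _ L0]]] := qs a; exists L => // x nL.
  apply: (theta_near0 (W := ~` L)) => //; last by left.
  exact: closed_openC (compact_closed (atlas_hausdorff A) cL).
transitivity (\int[mu]_x (\sum_(a <- s) (theta (q a) u x * omega x `^ beta)%:E))%E.
  by apply: eq_integral => x _; rewrite sumEFin tE mulr_sumr; congr EFin; apply: eq_bigr => a _; rewrite mulrC.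
rewrite (@integral_sum _ _ _ _ _ measurableT) => [|a]; last exact: C0_compact_integrable.
apply: big1 => a _.
have mt : measurable_fun [set: borelType M] ((fun x => theta (q a) u x * omega x `^ beta) : borelType M -> R).
  exact: (C0_measurable (tC a).1).
rewrite (integral_density _ _ mu_density mt).
- rewrite -[RHS](chart_stokes Lm (qs a) Su); apply: eq_integral => x _; congr EFin.
  rewrite -mulrA -powRD ?subrr ?powRr0 ?mulr1 //.
  by apply/implyP => _; rewrite gt_eqF.
- exact: (C0_measurable (smooth_Ck_mfd 0 (powR_smooth (- beta)))).
- by move=> x; exact: powR_ge0.
Qed.

End Stokes.

(** * Linearity of the local operators *)

Section LocalLinearity.
Variables (R : realType) (n : nat) (U : set 'rV[R]_n) (G : 'rV[R]_n -> 'M[R]_n).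
Hypothesis oU : open U.

Lemma eq_ltheta q q' p p' y : {in U, q =1 q'} -> {in U, p =1 p'} -> U y ->
  ltheta G q p y = ltheta G q' p' y.
Proof.
move=> qq pp Uy; rewrite /ltheta (eq_local_laplacian G oU pp Uy) (eq_local_dprod G oU qq pp Uy).
by rewrite (qq y (mem_set Uy)).
Qed.

Lemma partial_lin a f h k y : smooth_on U f -> smooth_on U h -> U y ->
  partial k (fun z => a * f z + h z) y = a * partial k f y + partial k h y.
Proof.
move=> Sf Sh Uy; have df := smooth_on_derivable (k := k) Sf Uy.
have [daf E] := partialZ a df.
by rewrite (partialD daf (smooth_on_derivable (k := k) Sh Uy)) E.
Qed.

Lemma local_laplacian_lin a f h y : smooth_on U f -> smooth_on U h -> U y ->
  local_laplacian G (fun z => a * f z + h z) y = a * local_laplacian G f y + local_laplacian G h y.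
Proof.
move=> Sf Sh Uy; rewrite /local_laplacian.
have -> : local_hess G (fun z => a * f z + h z) y = a *: local_hess G f y + local_hess G h y.
  apply/matrixP => k l; rewrite [LHS]mxE [RHS]mxE [X in _ = X + _]mxE.
  rewrite [X in _ = _ * X + _]mxE [X in _ = _ + X]mxE.
  have -> : partial k (partial l (fun z => a * f z + h z)) y =
      a * partial k (partial l f) y + partial k (partial l h) y.
    rewrite -(partial_lin a k (smooth_on_partial l Sf) (smooth_on_partial l Sh) Uy).
    apply: (eq_partial_on oU k _ Uy) => z /set_mem Uz; exact: partial_lin.
  have -> : \sum_j christoffel G j k l y * partial j (fun z => a * f z + h z) y =
      a * (\sum_j christoffel G j k l y * partial j f y) + \sum_j christoffel G j k l y * partial j h y.
    rewrite mulr_sumr -big_split; apply: eq_bigr => j _ /=.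
    by rewrite partial_lin // mulrDr; congr (_ + _); rewrite mulrCA.
  by move: (partial k _ y) (\sum_j _) (partial k _ y) (\sum_j _) => x1 x2 x3 x4; ring.
by rewrite mulmxDr linearD /= -scalemxAr linearZ.
Qed.

Lemma local_dprod_linr w a f h y : smooth_on U f -> smooth_on U h -> U y ->
  local_dprod G w (fun z => a * f z + h z) y = a * local_dprod G w f y + local_dprod G w h y.
Proof.
move=> Sf Sh Uy; rewrite /local_dprod mulr_sumr -big_split; apply: eq_bigr => k _ /=.
rewrite mulr_sumr -big_split; apply: eq_bigr => l _ /=.
by rewrite partial_lin // mulrDr; congr (_ + _); rewrite mulrCA.
Qed.

End LocalLinearity.

(** * The integrated inequality for the diffusion operator *)

Section Energy.
Variables (R : realType) (n : nat) (M : ptopologicalType) (A : smooth_atlas R n M).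
Variables (g : riemannian_metric A) (vol : {measure set (borelType M) -> \bar R}).
Variables (omega : M -> R) (beta c : R) (mu : probability (borelType M) R).
Hypothesis vol_g : is_volume g vol.
Hypothesis omega_smooth : smooth A omega.
Hypothesis omega_gt0 : forall x, 0 < omega x.
Hypothesis mu_density : forall B : set (borelType M), measurable B ->
  mu B = (\int[vol]_(x in B) (omega x `^ (- beta))%:E)%E.
Hypothesis beta_gt1 : 1 < beta.
Implicit Types (f h u p q : M -> R).

Local Notation L := (diffusion g omega beta).
Local Notation W s := (fun x => omega x `^ s).
(** The mean as an inner product with 1, so that linearity of [ip] applies to it. *)
Local Notation E h := (ip mu h (cst 1)).

Let W_smooth s : smooth A (W s).
Proof. exact: powR_smooth. Qed.

Lemma smooth_mul f h : smooth A f -> smooth A h -> smooth A (fun x => f x * h x).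
Proof. by move=> Sf Sh i; apply: smooth_onM; [exact: chart_cod_open|exact: Sf|exact: Sh]. Qed.

Lemma smooth_lin a f h : smooth A f -> smooth A h -> smooth A (fun x => a * f x + h x).
Proof.
move=> Sf Sh i; have oi := @chart_cod_open _ _ _ A i.
apply: smooth_onD; [exact: oi| |exact: (Sh i)].
by apply: smooth_onM; [exact: oi|exact: smooth_on_cst|exact: (Sf i)].
Qed.

Lemma diffusion_smooth f : smooth A f -> smooth A (L f).
Proof.
move=> Sf i; have oi := @chart_cod_open _ _ _ A i.
apply: smooth_onB; [exact: oi|apply: smooth_onM|apply: smooth_onM]; try exact: oi.
- exact: (omega_smooth i).
- exact: (laplacian_smoothM g Sf i).
- exact: smooth_on_cst.
- exact: (dprod_smoothM g omega_smooth Sf i).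
Qed.

Let at_chart x : chart_cod (chart_at A x) (chart (chart_at A x) x).
Proof. by exists x => //; exact: chart_atP. Qed.

Let chart_atK x : chart_inv (chart_at A x) (chart (chart_at A x) x) = x.
Proof. by rewrite chartK //; exact: chart_atP. Qed.

Lemma thetaE p u x : let i := chart_at A x in
  theta g p u x = ltheta (metric g i) (p \o chart_inv i) (u \o chart_inv i) (chart i x).
Proof. by rewrite /= /theta /ltheta /= chart_atK. Qed.

Lemma dprod_mulM p q f x : smooth A p -> smooth A q ->
  dprod g (fun z => p z * q z) f x = p x * dprod g q f x + q x * dprod g p f x.
Proof.
move=> Sp Sq; rewrite /dprod; set i := chart_at A x.
have := @dprod_mull _ _ (chart_cod i) (metric g i) (p \o chart_inv i) (q \o chart_inv i) (f \o chart_inv i) _ (Sp i) (Sq i) (at_chart x).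
by rewrite /= chart_atK.
Qed.

Lemma dprod_powRM s f x : dprod g (W s) f x = s * omega x `^ (s - 1) * dprod g omega f x.
Proof.
rewrite /dprod; set i := chart_at A x.
have := @dprod_powR _ _ (chart_cod i) (metric g i) (omega \o chart_inv i) s (f \o chart_inv i) _ (omega_smooth i) (at_chart x).
by rewrite /= chart_atK; apply; exact: omega_gt0.
Qed.

Lemma dprod_ge0 f x : 0 <= dprod g f f x.
Proof.
rewrite /dprod; set i := chart_at A x; have cx := at_chart x.
rewrite -(lgrad_quad (@metric_posdef _ _ _ _ g i) (f \o chart_inv i) cx).
have [->|v0] := eqVneq (lgrad (metric g i) (f \o chart_inv i) (chart i x)) 0.
  by rewrite /quad !mul0mx mxE.
by apply/ltW; exact: (metric_posdef g cx).2 _ v0.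
Qed.

Lemma curvature_dimension_mfd f x : smooth A f -> beta != 2 ->
  curvature_bound g omega beta c -> ((2 <= n)%N /\ n.+1%:R <= beta) \/ n = 1%N ->
  - (beta - 1) / (beta - 2) / 2 * theta g (W (2 - beta)) (dprod g f f) x
  + (beta - 1) / (beta - 2) * theta g (fun z => omega z `^ (2 - beta) * laplacian g f z) f x
  - (beta - 1) * theta g (fun z => omega z `^ (1 - beta) * dprod g omega f z) f x <=
  omega x `^ (- beta) * L f x ^+ 2 - c * (beta - 1) * omega x `^ (1 - beta) * dprod g f f x.
Proof.
move=> Sf b2 curv dim; rewrite !thetaE; set i := chart_at A x.
have oi := @chart_cod_open _ _ _ A i.
have inv_dom y : y \in chart_cod i -> chart_dom i (chart_inv i y) /\ chart i (chart_inv i y) = y.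
  by move=> /set_mem; exact: chart_cod_psi.
have dE p q : smooth A p -> smooth A q -> {in chart_cod i, dprod g p q \o chart_inv i =1
    local_dprod (metric g i) (p \o chart_inv i) (q \o chart_inv i)}.
  by move=> Sp Sq y /inv_dom[d e] /=; rewrite (dprod_chart g (smooth_Ck_mfd 1 Sp) (smooth_Ck_mfd 1 Sq) d) e.
have lE : {in chart_cod i, laplacian g f \o chart_inv i =1 local_laplacian (metric g i) (f \o chart_inv i)}.
  by move=> y /inv_dom[d e] /=; rewrite (laplacian_chart g Sf d) e.
set G := metric g i; set psi := chart_inv i; set y := chart i x.
have cy : chart_cod i y by exact: at_chart.
have -> : ltheta G (W (2 - beta) \o psi) (dprod g f f \o psi) y =
    ltheta G (fun z => (omega \o psi) z `^ (2 - beta)) (local_dprod G (f \o psi) (f \o psi)) y.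
  by apply: (eq_ltheta G oi _ _ cy); [move=> z _|exact: dE].
have -> : ltheta G ((fun z => omega z `^ (2 - beta) * laplacian g f z) \o psi) (f \o psi) y =
    ltheta G (fun z => (omega \o psi) z `^ (2 - beta) * local_laplacian G (f \o psi) z) (f \o psi) y.
  by apply: (eq_ltheta G oi _ _ cy) => // z cz; rewrite /= -(lE z cz).
have -> : ltheta G ((fun z => omega z `^ (1 - beta) * dprod g omega f z) \o psi) (f \o psi) y =
    ltheta G (fun z => (omega \o psi) z `^ (1 - beta) * local_dprod G (omega \o psi) (f \o psi) z) (f \o psi) y.
  by apply: (eq_ltheta G oi _ _ cy) => // z cz; rewrite /= -(dE omega f omega_smooth Sf z cz).
have := @curvature_dimension_ineq _ _ (chart_cod i) (metric g i) oi (@metric_smooth _ _ _ _ g i)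
  (@metric_posdef _ _ _ _ g i) (omega \o chart_inv i) (f \o chart_inv i) beta c (chart i x)
  (omega_smooth i) (Sf i) (fun z _ => omega_gt0 _) b2 beta_gt1 (at_chart x) dim.
rewrite /= chart_atK; apply; exact: curv.
Qed.

Let powRW s t x : omega x `^ s * omega x `^ t = omega x `^ (s + t).
Proof. by rewrite -powRD //; apply/implyP => _; rewrite gt_eqF. Qed.

(** The gradient of [omega^(1-beta)] reproduces the drift of [L]; integration then turns [- f L f]
    into the Dirichlet energy. *)
Lemma theta_energy f x : smooth A f ->
  omega x `^ beta * theta g (fun z => omega z `^ (1 - beta) * f z) f x =
  f x * L f x + omega x * dprod g f f x.
Proof.
move=> Sf; rewrite /theta dprod_mulM // dprod_powRM /diffusion.
have e1 : omega x `^ beta * omega x `^ (1 - beta) = omega x.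
  by rewrite powRW addrC subrK powRr1 // ltW.
have e2 : omega x `^ beta * omega x `^ (1 - beta - 1) = 1.
  by rewrite powRW (_ : beta + (1 - beta - 1) = 0) ?powRr0 //; ring.
move: (omega x `^ beta) (omega x `^ (1 - beta)) (omega x `^ (1 - beta - 1)) e1 e2 => B P Q e1 e2.
move: (laplacian _ _ _) (dprod g f f x) (dprod g omega f x) (f x) => l d1 d2 fx.
transitivity ((B * P) * fx * l + ((B * P) * d1 + fx * (1 - beta) * (B * Q) * d2)); first by ring.
by rewrite e1 e2; ring.
Qed.

Section TestFunction.
Variable f : M -> R.
Hypothesis Cf : Cc_infty A f.
Let K := closure [set x | f x != 0].
Let Sf : smooth A f := Cf.1.
Let cK : compact K := Cf.2.

Let fK x : ~ K x -> f x = 0.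
Proof. by move=> nK; apply/eqP/negPn/negP => fx; apply: nK; exact: subset_closure. Qed.

Let oK : open (~` K).
Proof. exact/closed_openC/closed_closure. Qed.

Let dprodK h x : ~ K x -> dprod g h f x = 0 /\ dprod g f h x = 0.
Proof.
by move=> nK; have [-> ->] := dprod_near g h oK nK fK; have [-> ->] := dprod0 g h x.
Qed.

Let laplacianK x : ~ K x -> laplacian g f x = 0.
Proof. by move=> nK; rewrite (laplacian_near g oK nK fK) laplacian0. Qed.

Lemma diffusion_C0_compact : C0_compact A (L f).
Proof.
split; first exact: smooth_Ck_mfd (diffusion_smooth Sf).
by exists K => // x nK; rewrite /diffusion laplacianK // (dprodK omega nK).1 !mulr0 subr0.
Qed.

Lemma test_C0_compact : C0_compact A f.
Proof. by split; [exact: smooth_Ck_mfd|exists K]. Qed.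

Let gradf x := omega x * dprod g f f x.

Let gradf_C0_compact : C0_compact A gradf.
Proof.
split; first by apply: smooth_Ck_mfd; apply: smooth_mul => //; exact: dprod_smoothM.
by exists K => // x nK; rewrite /gradf (dprodK f nK).1 mulr0.
Qed.

Let LC h (Ch : C0_compact A h) : L2 mu h := C0_compact_L2 mu Ch.
Let L1 : L2 mu (cst 1) := L2_cst mu 1.

Let E_theta p u : Ck_mfd A 1 p -> smooth A u -> (forall x, ~ K x -> u x = 0) ->
  C0_compact A (fun x => omega x `^ beta * theta g p u x) /\
  E (fun x => omega x `^ beta * theta g p u x) = 0.
Proof.
move=> Cp Su uK; split.
  split.
    move=> i; apply: CkM; [exact: chart_cod_open|exact: (W_smooth beta)|exact: theta_C0].
  exists K => // x nK; rewrite (theta_near0 g oK nK) ?mulr0 //.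
  by right=> z nz; exact: uK.
have H := mu_theta vol_g omega_smooth omega_gt0 mu_density Cp Su cK uK.
by rewrite /ip /Rintegral; under eq_integral do rewrite mulr1; rewrite H.
Qed.

Lemma energy_identity : ip mu f (L f) = - E gradf.
Proof.
have [C0 E0] := E_theta (smooth_Ck_mfd 1 (smooth_mul (W_smooth (1 - beta)) Sf)) Sf fK.
apply/eqP; rewrite -addr_eq0 -E0; apply/eqP.
have CfL : C0_compact A (fun x => f x * L f x).
  by apply: C0_compact_mul; [exact: test_C0_compact|exact: diffusion_C0_compact.1].
have -> : ip mu f (L f) = E (fun x => f x * L f x).
  by apply: eq_Rintegral => x _; rewrite mulr1.
rewrite -[E (fun x => f x * L f x)]mul1r -(ip_lin 1 (LC CfL) (LC gradf_C0_compact) L1).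
by apply: eq_Rintegral => x _; rewrite theta_energy // mul1r.
Qed.

Lemma energy_ge0 : 0 <= - ip mu f (L f).
Proof.
rewrite energy_identity opprK; apply: Rintegral_ge0 => x _.
by rewrite mulr1 mulr_ge0 ?dprod_ge0 // ltW.
Qed.

Lemma integrated_curvature_dimension : beta != 2 ->
  curvature_bound g omega beta c -> ((2 <= n)%N /\ n.+1%:R <= beta) \/ n = 1%N ->
  c * (beta - 1) * - ip mu f (L f) <= ip mu (L f) (L f).
Proof.
move=> b2 curv dim; rewrite energy_identity opprK.
have Sff := dprod_smoothM g Sf Sf.
have [C1 E1] := E_theta (smooth_Ck_mfd 1 (W_smooth (2 - beta))) Sff (fun x nK => (dprodK f nK).1).
have [C2 E2] := E_theta (smooth_Ck_mfd 1 (smooth_mul (W_smooth (2 - beta)) (laplacian_smoothM g Sf))) Sf fK.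
have [C3 E3] := E_theta (smooth_Ck_mfd 1 (smooth_mul (W_smooth (1 - beta)) (dprod_smoothM g omega_smooth Sf))) Sf fK.
set T1 := (fun x => _ * theta g (W (2 - beta)) _ x) in C1 E1.
set T2 := (fun x => _ * theta g _ f x) in C2 E2.
set T3 := (fun x => _ * theta g _ f x) in C3 E3.
have CLL : C0_compact A (fun x => L f x * L f x).
  by apply: C0_compact_mul; [exact: diffusion_C0_compact|exact: diffusion_C0_compact.1].
have -> : ip mu (L f) (L f) = E (fun x => L f x * L f x).
  by apply: eq_Rintegral => x _; rewrite mulr1.
have LLL := LC CLL; have Lg := LC gradf_C0_compact.
have LT1 := LC C1; have LT2 := LC C2; have LT3 := LC C3.
pose k1 := (beta - 1) / (beta - 2) / 2; pose k2 := - ((beta - 1) / (beta - 2)).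
have L3 := L2_lin (beta - 1) LT3 LLL.
have L32 := L2_lin k2 LT2 L3.
have L321 := L2_lin k1 LT1 L32.
have : 0 <= E (fun x => - (c * (beta - 1)) * gradf x + (k1 * T1 x + (k2 * T2 x +
    ((beta - 1) * T3 x + L f x * L f x)))).
  apply: Rintegral_ge0 => x _; rewrite mulr1.
  (* The pointwise inequality is relative to the Riemannian volume; multiplying it by [omega^beta]
     makes it relative to [mu]. *)
  have := curvature_dimension_mfd x Sf b2 curv dim; rewrite -(ler_pM2l (powR_gt0 beta (omega_gt0 x))) -subr_ge0.
  move=> /le_trans; apply; rewrite le_eqVlt; apply/orP; left; apply/eqP.
  rewrite /T1 /T2 /T3 /gradf /k1 /k2.
  have e1 : omega x `^ beta * omega x `^ (1 - beta) = omega x.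
    by rewrite powRW addrC subrK powRr1 // ltW.
  have e2 : omega x `^ beta * omega x `^ (- beta) = 1 by rewrite powRW subrr powRr0.
  move: (theta g (W (2 - beta)) (dprod g f f) x)
    (theta g (fun z => omega z `^ (2 - beta) * laplacian g f z) f x)
    (theta g (fun z => omega z `^ (1 - beta) * dprod g omega f z) f x)
    (dprod g f f x) (L f x) => t1 t2 t3 d l.
  move: (omega x `^ beta) (omega x `^ (1 - beta)) (omega x `^ (- beta)) (beta - 1) (beta - 2)^-1 e1 e2
    => B P Q b1 i2 e1 e2.
  transitivity ((B * Q) * l ^+ 2 - c * b1 * (B * P) * d
    - B * (- b1 * i2 / 2 * t1 + b1 * i2 * t2 - b1 * t3)); first by ring.
  by rewrite e1 e2; field.
rewrite (ip_lin _ Lg L321 L1) (ip_lin _ LT1 L32 L1) (ip_lin _ LT2 L3 L1) (ip_lin _ LT3 LLL L1).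
by rewrite E1 E2 E3 !mulr0 !add0r mulNr addrC subr_ge0.
Qed.

End TestFunction.

Lemma diffusion_lin a f u x : smooth A f -> smooth A u ->
  L (fun z => a * f z + u z) x = a * L f x + L u x.
Proof.
move=> Sf Su; rewrite /diffusion /laplacian /dprod; set i := chart_at A x.
have oi := @chart_cod_open _ _ _ A i.
have l := local_laplacian_lin (metric g i) oi a (Sf i) (Su i) (at_chart x).
have d := local_dprod_linr (metric g i) (omega \o chart_inv i) a (Sf i) (Su i) (at_chart x).
rewrite -[(fun z => a * f z + u z) \o _]/(fun y => a * (f \o chart_inv i) y + (u \o chart_inv i) y) l d.
by move: (local_laplacian _ _ _) (local_laplacian _ _ _) (local_dprod _ _ _ _) (local_dprod _ _ _ _)
  => x1 x2 x3 x4; ring.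
Qed.

Lemma Cc_infty_lin a f u : Cc_infty A f -> Cc_infty A u -> Cc_infty A (fun x => a * f x + u x).
Proof.
move=> [Sf Kf] [Su Ku]; split; first exact: smooth_lin.
apply: (subclosed_compact _ (compactU Kf Ku)); first exact: closed_closure.
rewrite -closureU; apply: closure_subset => x /=; apply: contraPP => /not_orP[/negP + /negP].
by rewrite !negbK => /eqP -> /eqP ->; rewrite mulr0 addr0 eqxx.
Qed.

Lemma diffusion_spectral_gap (P : R -> (borelType M -> R) -> (borelType M -> R)) :
  0 < c -> beta != 2 -> curvature_bound g omega beta c ->
  ((2 <= n)%N /\ n.+1%:R <= beta) \/ n = 1%N ->
  essentially_self_adjoint mu (diffusion_op g omega beta) ->
  semigroup_generated_by mu (op_closure mu (diffusion_op g omega beta)) P -> ergodic mu P ->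
  ((c * (beta - 1))%:E <= spectral_gap mu (op_closure mu (diffusion_op g omega beta)))%E.
Proof.
move=> c0 b2 curv dim esa PL Perg; apply: (spectral_gap_core _ _ _ _ _ _ esa PL Perg).
- by rewrite mulr_gt0 // subr_gt0.
- move=> f h [Cf ->]; split; apply: C0_compact_L2; [exact: test_C0_compact|exact: diffusion_C0_compact].
- move=> a f h u v [Cf ->] [Cu ->]; split; first exact: Cc_infty_lin.
  by apply/funext => x; rewrite diffusion_lin; [|exact: Cf.1|exact: Cu.1].
- split; last first.
    by apply/funext => x; rewrite /diffusion laplacian0 (dprod0 g omega x).2 !mulr0 subr0.
  split; first by move=> i; exact: smooth_on_cst.
  rewrite (_ : [set _ | _] = set0) ?closure0; first exact: compact0.
  by apply/seteqP; split=> x //=; rewrite eqxx.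
- by move=> f h [Cf ->]; exact: energy_ge0.
- by move=> f h [Cf ->]; exact: integrated_curvature_dimension.
Qed.

End Energy.

Theorem theorem4p7 (R : realType) (n : nat) (M : ptopologicalType)
    (A : smooth_atlas R n M) (g : riemannian_metric A)
    (vol : {measure set (borelType M) -> \bar R})
    (omega : M -> R) (beta c : R)
    (mu : probability (borelType M) R)
    (P : R -> (borelType M -> R) -> (borelType M -> R))
    (g_complete : riem_complete g)
    (vol_g : is_volume g vol)
    (omega_smooth : smooth A omega)
    (omega_gt0 : forall x, 0 < omega x)
    (beta_gt0 : 0 < beta)
    (mu_density : forall B : set (borelType M), measurable B ->
       mu B = (\int[vol]_(x in B) (omega x `^ (- beta))%:E)%E)
    (beta_neq2 : beta != 2)
    (c_gt0 : 0 < c)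
    (curv : curvature_bound g omega beta c)
    (L_esa : essentially_self_adjoint mu (diffusion_op g omega beta))
    (P_L : semigroup_generated_by mu
       (op_closure mu (diffusion_op g omega beta)) P)
    (P_ergodic : ergodic mu P) :
  ((2 <= n)%N -> n.+1%:R <= beta ->
     ((c * (beta - 1))%:E <=
        spectral_gap mu (op_closure mu (diffusion_op g omega beta)))%E) /\
  (n = 1%N -> 1 < beta ->
     ((c * (beta - 1))%:E <=
        spectral_gap mu (op_closure mu (diffusion_op g omega beta)))%E).
Proof.
split=> [n2 nb|n1 b1].
  have b1 : 1 < beta by apply: lt_le_trans nb; rewrite ltr1n ltnS; exact: leq_trans n2.
  by apply: (diffusion_spectral_gap vol_g omega_smooth omega_gt0 mu_density b1 _ _ curv _ L_esa P_L P_ergodic) => //; left.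
by apply: (diffusion_spectral_gap vol_g omega_smooth omega_gt0 mu_density b1 _ _ curv _ L_esa P_L P_ergodic) => //; right.
Qed.
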